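(* Let $I=(-\frac12,\frac12)$, $K^R=\{(\alpha,\zeta)\in\mathbb R\times\mathbb R:|\alpha|+|\zeta|\le2\}$, and consider the one-dimensional problem of the context (with $\mathbb C\xi=\xi$). Let $V\in C^2(\mathbb R)$ satisfy $-M\le V''\le0$ for some constant $M\ge 0$, $V(\theta)=V(-\theta)$ for every $\theta$, and $V'(\theta)=-1$ if and only if $\theta\ge1$. Let $\boldsymbol w^R(t,y)=ty$, $u_0^R=0$, $e_0^R=0$, $p_0^R=0$ on $[-\frac12,\frac12]$. Assume that $z_0^R:[-\frac12,\frac12]\to\mathbb R$ is odd, continuous on $[-\frac12,0)\cup(0,\frac12]$, and satisfies $z_0^R(0+)=1>z_0^R(y)\ge0$ for every $y\in(0,\frac12]$. Let $(\boldsymbol u^R,\boldsymbol e^R,\boldsymbol\mu^R)$ be an approximable quasistatic evolution with boundary datum $\boldsymbol w^R$ and initial condition $(u_0^R,e_0^R,p_0^R,z_0^R)$. Then for every $t\in[0,+\infty)$ $$\boldsymbol u^R(t,y)=\begin{cases}ty&\text{if }t\in[0,1],\ y\in[-\frac12,\frac12],\\ y+\frac{t-1}2&\text{if }t\in(1,+\infty),\ y\in(0,\frac12],\\ y-\frac{t-1}2&\text{if }t\in(1,+\infty),\ y\in[-\frac12,0),\end{cases}$$ $$\boldsymbol e^R(t)=\min\{t,1\},\qquad \boldsymbol\mu^R_t=\tfrac12\delta_{(\boldsymbol p^R(t),\,z_0^R+\boldsymbol p^R(t))}+\tfrac12\delta_{(\boldsymbol p^R(t),\,z_0^R-\boldsymbol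 p^R(t))},$$ where $\boldsymbol p^R(t):=(t-1)^+\delta_0$ and $\delta_0$ is the unit Dirac mass at $0$. Moreover, for every $T>0$, $\mathcal D_{H^R}(\boldsymbol\mu^R;0,T)=2(T-1)^+$, and the energy inequality holds with equality, i.e., with $\boldsymbol\sigma^R=\boldsymbol e^R$, $$\tfrac12\|\boldsymbol e^R(T)\|_2^2+\mathcal D_{H^R}(\boldsymbol\mu^R;0,T)+\langle\{V\}(\theta,\eta),\boldsymbol\mu^R_T(y,\beta,\theta,\eta)\rangle=\int_{-1/2}^{1/2}V(z_0^R)\,dy+\int_0^T\langle\boldsymbol\sigma^R(t),D\dot{\boldsymbol w}^R(t)\rangle\,dt.$$
   Context: $D$ denotes the derivative in $y$; norms and $\langle\cdot,\cdot\rangle$ (for functions) are those of $L^2(I)$. $(\cdot)^+$ is the positive part. Here $H^R(\xi,\theta)=\sup_{(\alpha,\zeta)\in K^R}(\alpha\xi+\zeta\theta)=2\max\{|\xi|,|\theta|\}$ and $N^\varepsilon_{K^R}(\alpha,\zeta)=\frac1\varepsilon((\alpha,\zeta)-P_{K^R}(\alpha,\zeta))$, with $P_{K^R}$ the orthogonal projection onto $K^R$. $V^\infty(\theta)=\lim_{t\to+\infty}V(t\theta)/t$; $\{V\}(\theta,\eta)=\eta V(\theta/\eta)$ if $\eta>0$, $=V^\infty(\theta)$ if $\eta\le0$. $M_b(\overline I;\Xi)$: bounded $\Xi$-valued Borel measures on $\overline I=[-\frac12,\frac12]$; $L^1$ functions are identified with measures. One-dimensional $\varepsilon$-regularized problem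 (Dirichlet condition at both endpoints $\pm\frac12$). A solution with boundary datum $\boldsymbol w$ and initial condition $(u_0,e_0,p_0,z_0)$ is a quadruple with $\boldsymbol u_\varepsilon\in H^1_{loc}([0,+\infty);H^1(I))$ and $\boldsymbol e_\varepsilon,\boldsymbol p_\varepsilon,\boldsymbol z_\varepsilon\in H^1_{loc}([0,+\infty);L^2(I))$ such that: the values at $t=0$ are $(u_0,e_0,p_0,z_0)$; for every $t>0$, $D\boldsymbol u_\varepsilon(t)=\boldsymbol e_\varepsilon(t)+\boldsymbol p_\varepsilon(t)$ a.e. in $I$, $\boldsymbol u_\varepsilon(t,\pm\frac12)=\boldsymbol w(t,\pm\frac12)$, and the stress $\boldsymbol\sigma_\varepsilon(t)=\boldsymbol e_\varepsilon(t)$ satisfies $D\boldsymbol\sigma_\varepsilon(t)=0$ in $I$ (i.e. is constant in space); for a.e. $t>0$, $(\dot{\boldsymbol p}_\varepsilon(t),\dot{\boldsymbol z}_\varepsilon(t))=N^\varepsilon_{K^R}(\boldsymbol\sigma_\varepsilon(t),-V'(\boldsymbol z_\varepsilon(t)))$ a.e. in $I$. (It exists and is unique for each $\varepsilon>0$.) Generalized Young measures. For a finite dimensional Hilbert space $\Xi$, $C^{hom}(\overline I\times\Xi\times\mathbb R)$ is the Banach space of continuous $f(y,\xi,\eta)$ positively one-homogeneous in $(\xi,\eta)$, with the sup norm over $y\in\overline I$, $|\xi|^2+\eta^2=1$. $GY(\overline I;\Xi)$ is the set of $\mu$ in its dual such that $\langle f,\mu\rangle\ge0$ if $f\ge0$;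 $\langle f,\mu\rangle=0$ if $f$ vanishes on $\overline I\times\Xi\times[0,+\infty)$; $\langle\varphi(y)\eta,\mu\rangle=\int_I\varphi\,dy$ for $\varphi\in C(\overline I)$. For $p\in M_b(\overline I;\Xi)$, $\delta_p\in GY(\overline I;\Xi)$ is $\langle f,\delta_p\rangle=\int_{\overline I}f(y,\frac{dp}{d\lambda},\frac{d\mathcal L^1}{d\lambda})\,d\lambda$ for any bounded positive $\lambda$ with $p,\mathcal L^1\ll\lambda$. $SGY([0,+\infty),\overline I;\Xi)$ is the set of families $\boldsymbol\mu=(\boldsymbol\mu_{t_1\dots t_m})$, $\boldsymbol\mu_{t_1\dots t_m}\in GY(\overline I;\Xi^m)$, indexed by finite increasing sequences in $[0,+\infty)$, such that whenever $\{s_1<\dots<s_n\}\subset\{t_1<\dots<t_m\}$, $\boldsymbol\mu_{s_1\dots s_n}$ is the image of $\boldsymbol\mu_{t_1\dots t_m}$ under $(y,\xi_{t_1},\dots,\xi_{t_m},\eta)\mapsto(y,\xi_{s_1},\dots,\xi_{s_n},\eta)$. For $\boldsymbol p:[0,+\infty)\to M_b(\overline I;\Xi)$, $(\boldsymbol\delta_{\boldsymbol p})_{t_1\dots t_m}:=\delta_{(\boldsymbol p(t_1),\dots,\boldsymbol p(t_m))}$. $\boldsymbol\mu$ is weakly$^*$ left-continuous if $\boldsymbol\mu_{s_1\dots s_m}\rightharpoonup\boldsymbol\mu_{t_1\dots t_m}$ weakly$^*$ as $s_i\to t_i$, $s_i\le t_i$. For $\Xi=\mathbb R\times\mathbb R$,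 $\mathcal D_{H^R}(\boldsymbol\mu;a,b)=\sup\sum_{i=1}^k\langle H^R(\beta_i-\beta_{i-1},\theta_i-\theta_{i-1}),\boldsymbol\mu_{t_0\dots t_k}(y,\beta_0,\theta_0,\dots,\beta_k,\theta_k,\eta)\rangle$ over all $a=t_0<\dots<t_k=b$. Definition. An approximable quasistatic evolution with boundary datum $\boldsymbol w$ and initial condition $(u_0,e_0,p_0,z_0)$ is a triple $(\boldsymbol u,\boldsymbol e,\boldsymbol\mu)$ with $\boldsymbol u\in L^\infty_{loc}([0,+\infty);BV(I))$, $\boldsymbol e\in L^\infty_{loc}([0,+\infty);L^2(I))$, $\boldsymbol\mu\in SGY([0,+\infty),\overline I;\mathbb R\times\mathbb R)$, all weakly$^*$ left-continuous, for which there exist a positive sequence $\varepsilon_k\to0$ and $\Theta\subset[0,+\infty)$ containing $0$, with $\mathcal L^1([0,+\infty)\setminus\Theta)=0$, such that the solutions of the $\varepsilon_k$-regularized problems with the same data satisfy $\boldsymbol u_{\varepsilon_k}(t)\rightharpoonup\boldsymbol u(t)$ weakly$^*$ in $BV(I)$ and $\boldsymbol e_{\varepsilon_k}(t)\rightharpoonup\boldsymbol e(t)$ weakly in $L^2(I)$ for every $t\in\Theta$, and $(\boldsymbol\delta_{(\boldsymbol p_{\varepsilon_k},\boldsymbol z_{\varepsilon_k})})_{t_1\dots t_m}\rightharpoonup\boldsymbol\mu_{t_1\dots t_m}$ weakly$^*$ for every $t_1<\dots<t_m$ in $\Theta$. *)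

(* Defs.v *)
From HB Require Import structures.
From mathcomp Require Import all_boot all_order all_algebra.
From mathcomp Require Import all_classical all_reals all_analysis.

Set Implicit Arguments.
Unset Strict Implicit.
Unset Printing Implicit Defensive.

Import Order.TTheory GRing.Theory Num.Theory.
Import numFieldNormedType.Exports.

Local Open Scope classical_set_scope.
Local Open Scope ring_scope.

Section Spaces.
Context {R : realType}.

Definition leb := @lebesgue_measure R.
Definition I_ : set R := `]- (2^-1), 2^-1[%classic.
Definition Ibar : set R := `[- (2^-1), 2^-1]%classic.
Definition halfline : set R := `[0, +oo[%classic.

(* Elements of L^1(I), L^2(I), H^1(I), BV(I) are represented by functions
   R -> R, of which only the a.e. class on I is meaningful. *)
Definition L1I (f : R -> R) : Prop := leb.-integrable I_ (EFin \o f).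

Definition L2I (f : R -> R) : Prop :=
  measurable_fun I_ f /\ leb.-integrable I_ (fun y => (f y ^+ 2)%:E).

Definition innerI (f g : R -> R) : R := \int[leb]_(y in I_) (f y * g y).

Definition eqI (f g : R -> R) : Prop := {ae leb, forall y, I_ y -> f y = g y}.

(* C^1 functions with compact support in I. *)
Definition test_fun (phi : R -> R) : Prop :=
  [/\ forall y, derivable phi y 1,
      continuous (derive1 phi) &
      exists a b : R, [/\ - (2^-1) < a, b < 2^-1 &
        forall y, ~ (a <= y <= b) -> phi y = 0]].

Definition weak_deriv (f g : R -> R) : Prop :=
  forall phi, test_fun phi -> innerI f (derive1 phi) = - innerI g phi.

Definition has_boundary_values (f : R -> R) (a b : R) : Prop :=
  exists g : R -> R, [/\ {within Ibar, continuous g}, eqI f g,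
    g (- (2^-1)) = a & g (2^-1) = b].

(* v in H^1_loc([0,+oo); L^2(I)) with time derivative vdot.
   L^2_loc([0,+oo); L^2(I)) is identified with L^2_loc([0,+oo) x I); the
   Bochner integral of vdot is then the pointwise one, and v is the
   continuous primitive v(t) = v(0) + \int_0^t vdot(s) ds. *)
Definition H1loc_L2 (v vdot : R -> R -> R) : Prop :=
  [/\ forall t, 0 <= t -> L2I (v t),
      measurable_fun (halfline `*` I_) (fun x : R * R => vdot x.1 x.2),
      forall T, 0 < T -> (leb \x leb)%E.-integrable (([set s | 0 <= s <= T] : set R) `*` I_)
        (fun x : R * R => (vdot x.1 x.2 ^+ 2)%:E) &
      forall t, 0 <= t ->
        eqI (v t) (fun y => v 0 y + \int[leb]_(s in `[0, t]) vdot s y)].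

Definition H1loc_H1 (v : R -> R -> R) : Prop :=
  exists vdot Dv Dvdot : R -> R -> R,
    [/\ H1loc_L2 v vdot, H1loc_L2 Dv Dvdot &
        forall t, 0 <= t -> weak_deriv (v t) (Dv t)].

(* Bounded measures on I or Ibar are represented by charges on R, whose values
   on subsets of I, resp. Ibar, are the only ones used. *)
Definition signed_measure := {charge set (measurableTypeR R) -> \bar R}.

(* The measure f dy on I, for f in L^1(I). *)
Definition L1_charge (f : R -> R) : signed_measure :=
  match pselect (leb.-integrable setT (EFin \o (f \_ I_))) with
  | left intf => induced_charge intf
  | right _ => czero
  end.

Definition dirac_charge (x : R) : signed_measure :=
  charge_of_finite_measure (@dirac _ (measurableTypeR R) x R).

Definition hahnP (nu : signed_measure) := projT1 (cid (Hahn_decomposition nu)).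
Definition hahnN (nu : signed_measure) :=
  projT1 (cid (projT2 (cid (Hahn_decomposition nu)))).
Definition hahnPN (nu : signed_measure) :
    hahn_decomposition nu (hahnP nu) (hahnN nu) :=
  projT2 (cid (projT2 (cid (Hahn_decomposition nu)))).

Definition charge_integral (nu : signed_measure) (D : set R) (f : R -> R) : R :=
  \int[jordan_pos (hahnPN nu)]_(y in D) f y -
  \int[jordan_neg (hahnPN nu)]_(y in D) f y.

Definition total_variation (nu : signed_measure) (D : set R) : R :=
  fine (charge_variation (hahnPN nu) D).

Definition measure_deriv (f : R -> R) (nu : signed_measure) : Prop :=
  forall phi, test_fun phi ->
    innerI f (derive1 phi) = - charge_integral nu I_ phi.

Definition BVI (f : R -> R) : Prop := L1I f /\ exists nu, measure_deriv f nu.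

(* Determined by f on subsets of I only. *)
Definition BV_deriv (f : R -> R) : signed_measure :=
  match pselect (exists nu, measure_deriv f nu) with
  | left h => projT1 (cid h)
  | right _ => czero
  end.

Definition BV_norm (f : R -> R) : R :=
  \int[leb]_(y in I_) `|f y| + total_variation (BV_deriv f) I_.

Definition C0I (phi : R -> R) : Prop :=
  [/\ {within Ibar, continuous phi}, phi (- (2^-1)) = 0 & phi (2^-1) = 0].

(* Weak* convergence in BV(I) along F: strong convergence in L^1(I) and weak*
   convergence of the derivatives as bounded measures on I. *)
Definition BV_wcvg {T : Type} (F : set_system T) (f_ : T -> R -> R)
    (f : R -> R) : Prop :=
  (\int[leb]_(y in I_) `|f_ i y - f y|) @[i --> F] --> (0 : R) /\
  forall phi, C0I phi ->
    charge_integral (BV_deriv (f_ i)) I_ phi @[i --> F] -->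
      charge_integral (BV_deriv f) I_ phi.

Definition L2_wcvg {T : Type} (F : set_system T) (f_ : T -> R -> R)
    (f : R -> R) : Prop :=
  forall g, L2I g -> innerI (f_ i) g @[i --> F] --> innerI f g.

(* Measurability in time is meant in the weak* sense. *)
Definition BV_Linfty_loc (u : R -> R -> R) : Prop :=
  [/\ forall t, 0 <= t -> BVI (u t),
      forall phi, test_fun phi ->
        measurable_fun halfline (fun t => innerI (u t) phi) &
      forall T, 0 < T -> exists C : R,
        {ae leb, forall t, 0 <= t <= T -> BV_norm (u t) <= C}].

Definition L2_Linfty_loc (e : R -> R -> R) : Prop :=
  [/\ forall t, 0 <= t -> L2I (e t),
      forall g, L2I g ->
        measurable_fun halfline (fun t => innerI (e t) g) &
      forall T, 0 < T -> exists C : R,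
        {ae leb, forall t, 0 <= t <= T -> innerI (e t) (e t) <= C}].

End Spaces.

Section YoungMeasures.
Context {R : realType}.

(* Here Xi = R x R, and Xi^n is encoded as 'M[R]_(n, 2): row i is the pair
   (beta_i, theta_i). *)
Definition Xpt n := (R * 'M[R]_(n, 2) * R)%type.

Definition Chom n (f : Xpt n -> R) : Prop :=
  {within [set x : Xpt n | Ibar x.1.1], continuous f} /\
  forall y (xi : 'M[R]_(n, 2)) eta c, Ibar y -> 0 <= c ->
    f (y, c *: xi, c * eta) = c * f (y, xi, eta).

Definition Chom_norm_le n (f : Xpt n -> R) (M : R) : Prop :=
  forall y (xi : 'M[R]_(n, 2)) eta, Ibar y ->
    \sum_(i < n) \sum_(j < 2) xi i j ^+ 2 + eta ^+ 2 = 1 ->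
    `|f (y, xi, eta)| <= M.

(* A functional is meaningful only on functions satisfying Chom; boundedness
   makes it insensitive to values outside Ibar. *)
Definition functional n := (Xpt n -> R) -> R.

Definition GY n (mu : functional n) : Prop :=
  [/\ forall c f g, Chom f -> Chom g ->
        mu (fun x => c * f x + g x) = c * mu f + mu g,
      exists C : R, forall f M, Chom f -> Chom_norm_le f M -> `|mu f| <= C * M,
      forall f, Chom f -> (forall x, Ibar x.1.1 -> 0 <= f x) -> 0 <= mu f,
      forall f, Chom f -> (forall x, Ibar x.1.1 -> 0 <= x.2 -> f x = 0) ->
        mu f = 0 &
      forall phi : R -> R, {within Ibar, continuous phi} ->
        mu (fun x => phi x.1.1 * x.2) = \int[leb]_(y in I_) phi y].

Local Open Scope charge_scope.

(* delta_p for p in M_b(Ibar; Xi^n); the value does not depend on the bounded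
   measure lam dominating p and L^1, by one-homogeneity of f. *)
Definition delta n (p : 'I_n -> 'I_2 -> @signed_measure R) : functional n :=
  fun f => xget 0 [set r | exists lam : {finite_measure set (measurableTypeR R) -> \bar R},
    [/\ forall i j, p i j `<< lam,
        L1_charge (fun=> 1) `<< lam &
        r = \int[lam]_(y in Ibar)
          f (y, \matrix_(i, j) fine (('d (p i j) '/d lam) y),
             fine (('d (L1_charge (fun=> 1)) '/d lam) y))]].

Local Close Scope charge_scope.

Definition time_seq n (t : 'I_n -> R) : Prop :=
  (forall i, 0 <= t i) /\ (forall i j : 'I_n, (i < j)%N -> t i < t j).

Definition Yfamily := forall n, ('I_n -> R) -> functional n.

Definition SGY (mu : Yfamily) : Prop :=
  (forall n (t : 'I_n -> R), time_seq t -> GY (mu n t)) /\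
  forall n m (s : 'I_n -> R) (t : 'I_m -> R) (h : 'I_n -> 'I_m),
    time_seq s -> time_seq t -> (forall i, s i = t (h i)) ->
    forall f, Chom f ->
      mu n s f = mu m t (fun x => f (x.1.1, rowsub h x.1.2, x.2)).

Definition Yfamily_lcontinuous (mu : Yfamily) : Prop :=
  forall n (t : 'I_n -> R) f, time_seq t -> Chom f ->
  forall eps, 0 < eps -> exists2 d, 0 < d &
    forall s : 'I_n -> R, time_seq s -> (forall i, t i - d < s i <= t i) ->
      `|mu n s f - mu n t f| < eps.

End YoungMeasures.

Section Evolution.
Context {R : realType}.

Definition KR : set (R * R) := [set x | `|x.1| + `|x.2| <= 2].

Definition dist2 (x q : R * R) : R := (x.1 - q.1) ^+ 2 + (x.2 - q.2) ^+ 2.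

Definition projKR (x : R * R) : R * R :=
  xget (0, 0) [set q | KR q /\ forall q', KR q' -> dist2 x q <= dist2 x q'].

Definition NKR (eps : R) (x : R * R) : R * R :=
  (eps^-1 * (x.1 - (projKR x).1), eps^-1 * (x.2 - (projKR x).2)).

Definition HR (xi th : R) : R :=
  sup [set r | exists2 q : R * R, KR q & r = q.1 * xi + q.2 * th].

Definition dissipation (mu : @Yfamily R) (a b : R) : \bar R :=
  ereal_sup [set r | exists k (t : 'I_k.+1 -> R),
    [/\ time_seq t, t ord0 = a, t ord_max = b &
      r = (\sum_(i < k) mu k.+1 t (fun x =>
             let cur := lift ord0 i in
             let prev := widen_ord (leqnSn k) i in
             HR (x.1.2 cur 0 - x.1.2 prev 0) (x.1.2 cur 1 - x.1.2 prev 1)))%:E]].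

Definition Vinfty (V : R -> R) (th : R) : R :=
  lim ((V (t * th) / t) @[t --> +oo]).

Definition Vbrace (V : R -> R) (th eta : R) : R :=
  if 0 < eta then eta * V (th / eta) else Vinfty V th.

(* The stress sigma is replaced by e throughout. *)
Definition regularized_solution (V : R -> R) (w : R -> R -> R)
    (u0 e0 p0 z0 : R -> R) (eps : R) (u e p z : R -> R -> R) : Prop :=
  H1loc_H1 u /\
  exists edot pdot zdot : R -> R -> R,
    [/\ H1loc_L2 e edot, H1loc_L2 p pdot & H1loc_L2 z zdot] /\
    [/\ eqI (u 0) u0, eqI (e 0) e0, eqI (p 0) p0 & eqI (z 0) z0] /\
    [/\ forall t, 0 < t -> weak_deriv (u t) (fun y => e t y + p t y),
        forall t, 0 < t ->
          has_boundary_values (u t) (w t (- (2^-1))) (w t (2^-1)),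
        forall t, 0 < t -> weak_deriv (e t) (fun=> 0) &
        {ae leb, forall t, 0 < t -> {ae leb, forall y, I_ y ->
          (pdot t y, zdot t y) = NKR eps (e t y, - (derive1 V (z t y)))}}].

Definition pair_charges n (p z : 'I_n -> @signed_measure R) :
    'I_n -> 'I_2 -> @signed_measure R :=
  fun i j => if j == 0 then p i else z i.

Definition approximable_evolution (V : R -> R) (w : R -> R -> R)
    (u0 e0 p0 z0 : R -> R) (u e : R -> R -> R) (mu : @Yfamily R) : Prop :=
  [/\ BV_Linfty_loc u, L2_Linfty_loc e & SGY mu] /\
  [/\ forall t, 0 < t -> BV_wcvg t^'- u (u t),
      forall t, 0 < t -> L2_wcvg t^'- e (e t) &
      Yfamily_lcontinuous mu] /\
  exists (eps : nat -> R) (Theta : set R) (u_ e_ p_ z_ : nat -> R -> R -> R),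
    [/\ forall k, 0 < eps k,
        eps @ \oo --> (0 : R),
        Theta `<=` halfline,
        Theta 0 &
        leb.-negligible (halfline `\` Theta)] /\
    [/\ forall k, regularized_solution V w u0 e0 p0 z0 (eps k)
          (u_ k) (e_ k) (p_ k) (z_ k),
        forall t, Theta t -> BV_wcvg \oo (fun k => u_ k t) (u t),
        forall t, Theta t -> L2_wcvg \oo (fun k => e_ k t) (e t) &
        forall n (t : 'I_n -> R), time_seq t -> (forall i, Theta (t i)) ->
          forall f, Chom f ->
            delta (pair_charges (fun i => L1_charge (p_ k (t i)))
                                (fun i => L1_charge (z_ k (t i)))) f
              @[k --> \oo] --> mu n t f].

End Evolution.

(* Main.v *)
Require Import Defs.
From HB Require Import structures.
From mathcomp Require Import all_boot all_order all_algebra.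
From mathcomp Require Import all_classical all_reals all_analysis measurable_realfun.
From mathcomp Require Import ring lra.

Set Implicit Arguments.
Unset Strict Implicit.
Unset Printing Implicit Defensive.

Import Order.TTheory GRing.Theory Num.Theory.
Import numFieldNormedType.Exports.

Local Open Scope classical_set_scope.
Local Open Scope ring_scope.

(* The stress of a regularized solution is a function s of time alone, with
   s(t) = t - \int p(t), and for almost every y the pair (p, z) at y follows an
   ordinary differential equation driven by s and by the odd, nondecreasing
   force -V', which lies in [-1, 1] and equals 1 exactly on [1, +oo[.  The flow
   equations decouple in the variables x.1 + x.2 and x.1 - x.2.  Only near
   y = 0, where |z0| is close to 1, can the plastic strain flow while s is close
   to 1, and there it flows fast enough as eps -> 0 to keep s below 1 + d.
   Hence s -> min(t, 1), and the whole plastic strain, of mass tending to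
   (t - 1)^+, concentrates at 0.  It satisfies z = z0 + p for y > 0 and
   z = z0 - p for y < 0; since z0 is odd, p is even in y, so that the two
   branches carry half of the mass each.  These limits, found on Theta, extend
   to all times because Theta is dense from the left. *)

(** All regimes of the flow come from one computation: a force [(s, g)] yields only through the part
    of [s + g] and [s - g] beyond [[-2, 2]]. For [|g| <= 1 - d] and [0 <= s <= 1 + d] nothing moves;
    for [0 <= s <= 2] and [0 <= g <= 1] only [s + g] can yield, so [p] and [z] have equal rates; for
    [|g|] close to 1 and [s >= 1 + d] the rate of [p] is of order [d / eps], and this persists
    because [|z|] never decreases. Two obstacles shape the rest. The problem is posed with weak
    derivatives and with equations valid for almost every time and then almost every point, so a du
    Bois-Reymond lemma and a Fubini exchange precede any differential equation at fixed [y]. And a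
    Young measure is known only through its values on homogeneous integrands: where the plastic
    strain is large, the integrand is replaced by its recession function at the origin, at the cost
    of a small multiple of the mass and a constant on a small set. One-time and two-time marginals
    suffice, since [p] is monotone in time and the sums defining the dissipation telescope. *)

(** * The elastic domain, its projection and its support function *)

Section ElasticDomain.
Context {R : realType}.
Implicit Types x y s : R.

(** Overshoot of [x] beyond [[-2, 2]]: [x - excess x] is the nearest point of that interval. *)
Definition excess x : R := Num.max (x - 2) 0 + Num.min (x + 2) 0.

Lemma excess_cases x :
  [\/ x <= -2 /\ excess x = x + 2, -2 <= x <= 2 /\ excess x = 0 |
      2 <= x /\ excess x = x - 2].
Proof.
rewrite /excess; have [h1|h1] := leP (x - 2) 0; have [h2|h2] := leP (x + 2) 0.
- by apply: Or31; lra.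
- by apply: Or32; lra.
- by exfalso; lra.
- by apply: Or33; lra.
Qed.

Lemma excess_mid x : -2 <= x <= 2 -> excess x = 0.
Proof. by move=> h; have [] := excess_cases x => -[]; lra. Qed.

Lemma excess_homo x y : x <= y -> excess x <= excess y.
Proof.
by move=> h; have [] := excess_cases x => -[? ->];
  have [] := excess_cases y => -[? ->]; lra.
Qed.

Lemma excess_lip x y : `|excess x - excess y| <= `|x - y|.
Proof.
wlog xy : x y / x <= y.
  move=> h; have [|/ltW] := leP x y; first exact: h.
  by rewrite distrC (distrC x); exact: h.
rewrite !ler0_norm ?subr_le0 ?excess_homo//.
by have [] := excess_cases x => -[? ->]; have [] := excess_cases y => -[? ->]; lra.
Qed.

(** [|a| + |b|] is the larger of [|a + b|] and [|a - b|]. *)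
Lemma KR_rot (q : R * R) : KR q <-> `|q.1 + q.2| <= 2 /\ `|q.1 - q.2| <= 2.
Proof.
rewrite /KR/= !ler_norml; split.
- have := ler_norm q.1; have := ler_norm q.2.
  have := ler_norm (- q.1); have := ler_norm (- q.2); rewrite !normrN.
  by move=> *; lra.
- by case: (ger0P q.1) => h1; case: (ger0P q.2) => h2 [] *; lra.
Qed.

(* In the coordinates x.1 + x.2 and x.1 - x.2 the domain KR is a square, so that
   the projection clamps each coordinate to [-2, 2]. *)
Lemma projKRE (x : R * R) : projKR x =
  (x.1 - (excess (x.1 + x.2) + excess (x.1 - x.2)) / 2,
   x.2 - (excess (x.1 + x.2) - excess (x.1 - x.2)) / 2).
Proof.
set a := x.1 + x.2; set b := x.1 - x.2.
set q := (X in _ = X).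
have qK : KR q.
  apply/KR_rot; rewrite /q/=.
  have -> : x.1 - (excess a + excess b) / 2 + (x.2 - (excess a - excess b) / 2) = a - excess a.
    by rewrite /a; field.
  have -> : x.1 - (excess a + excess b) / 2 - (x.2 - (excess a - excess b) / 2) = b - excess b.
    by rewrite /b; field.
  rewrite !ler_norml.
  by have [] := excess_cases a => -[? ->]; have [] := excess_cases b => -[? ->]; lra.
(* A form of the obtuse-angle inequality for the projection onto [[-2, 2]], to be applied to each
   rotated coordinate. *)
have obt (c c' : R) : `|c'| <= 2 -> excess c ^+ 2 + (c - excess c - c') ^+ 2 <= (c - c') ^+ 2.
  rewrite ler_norml => /andP[h1 h2]; have [] := excess_cases c => -[h ->]; last 1 first.
  - have : 0 <= (c - 2) * (2 - c') by rewrite mulr_ge0// subr_ge0.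
    nra.
  - have : 0 <= (- 2 - c) * (c' + 2) by rewrite mulr_ge0//; lra.
    nra.
  - by rewrite subr0 expr0n add0r.
(* The two coordinates together give a Pythagorean inequality: [q] is a minimizer, and any minimizer
   that [xget] might return is at distance 0 from it. *)
have key q' : KR q' -> dist2 x q + dist2 q q' <= dist2 x q'.
  move=> /KR_rot[/obt-/(_ a) h1 /obt-/(_ b) h2].
  rewrite /dist2 /q/=.
  suff : forall u v : R, u = a -> v = b ->
    ((x.1 - (x.1 - (excess a + excess b) / 2)) ^+ 2 +
    (x.2 - (x.2 - (excess a - excess b) / 2)) ^+ 2) +
    ((x.1 - (excess a + excess b) / 2 - q'.1) ^+ 2 +
    (x.2 - (excess a - excess b) / 2 - q'.2) ^+ 2)
      <= (x.1 - q'.1) ^+ 2 + (x.2 - q'.2) ^+ 2 by exact.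
  move=> _ _ _ _.
  move: (excess a) (excess b) h1 h2; rewrite /a /b => ea eb h1 h2.
  by nra.
have qP : [set q | KR q /\ forall q', KR q' -> dist2 x q <= dist2 x q'] q.
  split => // q' /key; apply: le_trans.
  by rewrite lerDl /dist2 addr_ge0 ?sqr_ge0.
rewrite /projKR; case: (xgetP (0, 0) [set q | KR q /\ forall q', KR q' -> dist2 x q <= dist2 x q']).
- move=> q' _ [q'K q'min].
  have h1 := key _ q'K; have h2 := q'min _ qK.
  have : dist2 q q' <= 0 by rewrite -(lerD2l (dist2 x q)) addr0 (le_trans h1).
  rewrite /dist2 => h.
  have h3 := sqr_ge0 (q.1 - q'.1); have h4 := sqr_ge0 (q.2 - q'.2).
  have /eqP : (q.1 - q'.1) ^+ 2 = 0 by lra.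
  have /eqP : (q.2 - q'.2) ^+ 2 = 0 by lra.
  rewrite !sqrf_eq0 !subr_eq0 => /eqP e2 /eqP e1.
  by rewrite [RHS](surjective_pairing q) [LHS](surjective_pairing q') e1 e2.
- by move=> /(_ q)[].
Qed.

(** Components of [NKR] at stress [s] and force [zeta]: the speeds of the plastic strain and of the
    internal variable. *)
Definition rate1 (eps s zeta : R) : R :=
  (excess (s + zeta) + excess (s - zeta)) / (2 * eps).
Definition rate2 (eps s zeta : R) : R :=
  (excess (s + zeta) - excess (s - zeta)) / (2 * eps).

Lemma NKRE eps (x : R * R) : eps != 0 ->
  NKR eps x = (rate1 eps x.1 x.2, rate2 eps x.1 x.2).
Proof.
by move=> e0; rewrite /NKR projKRE /rate1 /rate2/=; congr pair; field.
Qed.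

(** A linear form on the l^1 ball of radius 2 is maximal at a vertex on the axis of its larger
    coefficient. *)
Lemma HRE a b : HR a b = 2 * Num.max `|a| `|b| :> R.
Proof.
rewrite /HR; set S := [set r | _].
have ub : ubound S (2 * Num.max `|a| `|b|).
  move=> _ [q qK ->].
  have := ler_norm (q.1 * a); have := ler_norm (q.2 * b); rewrite !normrM.
  have : `|a| <= Num.max `|a| `|b| by rewrite le_max lexx.
  have : `|b| <= Num.max `|a| `|b| by rewrite le_max lexx orbT.
  move: qK; rewrite /KR/=; move: (Num.max _ _) => m.
  have := normr_ge0 q.1; have := normr_ge0 q.2; have := normr_ge0 a.
  move=> *.
  have : `|q.1| * `|a| <= `|q.1| * m by rewrite ler_wpM2l.
  have : `|q.2| * `|b| <= `|q.2| * m by rewrite ler_wpM2l.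
  by nra.
have Sm : S (2 * Num.max `|a| `|b|).
  have [ab|ba] := leP `|a| `|b|.
  - exists (0, 2 * Num.sg b); last by rewrite /= mul0r add0r -mulrA -normrEsg.
    rewrite /KR/= normr0 add0r normrM ger0_norm//.
    have : `|Num.sg b| <= 1 by (rewrite normr_sg lern1; case: (b != 0)).
    move: (Num.sg _) => sg;
    lra.
  - exists (2 * Num.sg a, 0); last by rewrite /= mul0r addr0 -mulrA -normrEsg.
    rewrite /KR/= normr0 addr0 normrM ger0_norm//.
    have : `|Num.sg a| <= 1 by (rewrite normr_sg lern1; case: (a != 0)).
    move: (Num.sg _) => sg;
    lra.
apply/eqP; rewrite eq_le; apply/andP; split.
- by apply: ge_sup => //; exists (2 * Num.max `|a| `|b|).
- by apply: ub_le_sup => //; exists (2 * Num.max `|a| `|b|).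
Qed.

End ElasticDomain.

(** * Monotonicity, last exit and Gronwall on the real line *)

Section ScalarCalculus.
Context {R : realType}.
Implicit Types (f df : R -> R) (a b c t : R).

Lemma derive_le_increment f df a b c : a <= b -> continuous f ->
  (forall x, a < x < b -> is_derive x 1 f (df x)) ->
  (forall x, a < x < b -> df x <= c) -> f b - f a <= c * (b - a).
Proof.
rewrite le_eqVlt => /predU1P[->|ab] cf fdf dfc; first by rewrite !subrr mulr0.
have fdf' x : x \in `]a, b[ -> is_derive x 1 f (df x).
  by rewrite in_itv/=; exact: fdf.
have cf' : {within `[a, b], continuous f} by exact: continuous_subspaceT.
have [x xab ->] := MVT ab fdf' cf'.
by rewrite ler_wpM2r ?subr_ge0 ?(ltW ab)// dfc//; move: xab; rewrite in_itv.
Qed.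

Lemma derive_ge_increment f df a b c : a <= b -> continuous f ->
  (forall x, a < x < b -> is_derive x 1 f (df x)) ->
  (forall x, a < x < b -> c <= df x) -> c * (b - a) <= f b - f a.
Proof.
rewrite le_eqVlt => /predU1P[->|ab] cf fdf dfc; first by rewrite !subrr mulr0.
have fdf' x : x \in `]a, b[ -> is_derive x 1 f (df x).
  by rewrite in_itv/=; exact: fdf.
have cf' : {within `[a, b], continuous f} by exact: continuous_subspaceT.
have [x xab ->] := MVT ab fdf' cf'.
by rewrite ler_wpM2r ?subr_ge0 ?(ltW ab)// dfc//; move: xab; rewrite in_itv.
Qed.

(** The supremum of the times at which [f] is at most [c]. It starts the barrier arguments that
    bound the stress from below and from above. *)
Lemma last_exit f a b c : a <= b -> continuous f -> f a <= c -> c < f b ->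
  exists t, [/\ a <= t <= b, f t <= c & forall s, t < s <= b -> c < f s].
Proof.
move=> ab cf fa fb; pose S := [set s | a <= s <= b /\ f s <= c].
have Sa : S a by rewrite /S/= lexx ab.
have hS : has_sup S by split; [exists a|exists b => s [/andP[]]].
have ub := sup_upper_bound hS.
exists (sup S); split.
- by rewrite ub//= ge_sup//; [exists a|move=> s [/andP[]]].
- rewrite leNgt; apply/negP => h.
  have : \forall s \near sup S, c < f s.
    exact: (cvgr_gt _ (cf (sup S)) _ h).
  move=> [d/= d0 hd].
  have [s Ss ds] := sup_adherent d0 hS.
  have : c < f s.
    by apply: hd; rewrite /ball/= ger0_norm ?subr_ge0 ?ub// ltrBlDr addrC -ltrBlDr.
  by rewrite ltNge => /negP; apply; case: Ss.
- move=> s /andP[ts sb]; rewrite ltNge; apply/negP => fs.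
  have : S s by split => //; rewrite sb (le_trans _ (ltW ts))// ub.
  by move=> /ub; rewrite leNgt ts.
Qed.

(** Gronwall: [exp (-2 L t) * (z1 - z2) ^ 2] does not increase. [F1] and [F2] are the velocities
    along the two curves, so the Lipschitz bound is asked only there, and [L = 0] serves when the
    velocities coincide. *)
Lemma ode_unique (L : R) (z1 z2 F1 F2 : R -> R) :
  continuous z1 -> continuous z2 -> z1 0 = z2 0 ->
  (forall t, 0 < t -> is_derive t 1 z1 (F1 t)) ->
  (forall t, 0 < t -> is_derive t 1 z2 (F2 t)) ->
  (forall t, 0 < t -> `|F1 t - F2 t| <= L * `|z1 t - z2 t|) ->
  forall t, 0 <= t -> z1 t = z2 t.
Proof.
move=> c1 c2 z12 d1 d2 hL t t0.
pose w s := z1 s - z2 s.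
pose h s := expR (- (2 * L) * s) * (w s * w s).
have cw : continuous w by move=> s; apply: cvgB; [exact: c1|exact: c2].
have ch : continuous h.
  move=> s; apply: cvgM; last by apply: cvgM; exact: cw.
  apply: continuous_comp; last exact: continuous_expR.
  by apply: cvgMr; exact: cvg_id.
pose dh s := expR (- (2 * L) * s) * (2 * (w s * (F1 s - F2 s)) - 2 * L * (w s * w s)).
have hle : h t - h 0 <= 0 * (t - 0).
  apply: (derive_le_increment t0 ch (df := dh)).
  - move=> s /andP[s0 _].
    have dw : is_derive s 1 w (F1 s - F2 s).
      by apply: is_deriveB; [exact: d1|exact: d2].
    have de : is_derive s 1 (fun s => expR (- (2 * L) * s)) (- (2 * L) * expR (- (2 * L) * s)).
      have di : is_derive s 1 (fun s => - (2 * L) * s) (- (2 * L)).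
        by apply: (is_derive_eq (is_deriveZ _ (is_derive_id s 1))); rewrite /GRing.scale/= mulr1.
      apply: (is_derive_eq (@is_derive1_comp R expR ( *%R (- (2 * L))) s _ _ (is_derive_expR _) di)).
      exact: mulrC.
    have dww := is_deriveM dw dw.
    apply: (is_derive_eq (is_deriveM de dww)).
    rewrite /dh /GRing.scale/= (_ : (w * w) s = w s * w s)//; ring.
  - move=> s /andP[s0 _]; rewrite /dh pmulr_rle0 ?expR_gt0// subr_le0.
    rewrite -mulrA ler_pM2l//; apply: (le_trans (ler_norm _)); rewrite normrM.
    apply: (le_trans (ler_wpM2l (normr_ge0 _) (hL s s0))).
    by rewrite mulrCA -normrM ger0_norm// -expr2 sqr_ge0.
have : h t <= 0.
  by move: hle; rewrite mul0r subr_le0 {2}/h /w z12 subrr mul0r mulr0.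
rewrite /h pmulr_rle0 ?expR_gt0// -expr2 => h0.
have : w t ^+ 2 = 0 by apply/eqP; rewrite eq_le h0 sqr_ge0.
by move/eqP; rewrite sqrf_eq0 subr_eq0 => /eqP.
Qed.

End ScalarCalculus.

(** * Real-valued integrals modulo null sets *)

Section RealIntegral.
Context d (T : measurableType d) {R : realType} (mu : {measure set T -> \bar R}).
Variable D : set T.
Hypothesis mD : measurable D.
Implicit Types f g h : T -> R.

Notation intg := (fun f => mu.-integrable D (EFin \o f)).

Lemma intgD f g : intg f -> intg g -> intg (fun x => f x + g x).
Proof. by move=> intf intg; have := integrableD mD intf intg. Qed.

Lemma intgB f g : intg f -> intg g -> intg (fun x => f x - g x).
Proof. by move=> intf intg; have := integrableB mD intf intg. Qed.

Lemma intgZ c f : intg f -> intg (fun x => c * f x).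
Proof. by move=> intf; have := integrableZl mD c intf. Qed.

Lemma intg_norm f : intg f -> intg (fun x => `|f x|).
Proof. by move=> /integrable_norm. Qed.

Lemma intg_measurable f : intg f -> measurable_fun D f.
Proof. by move=> /measurable_int/measurable_EFinP. Qed.

Lemma intg_le f g : measurable_fun D f -> intg g ->
  (forall x, D x -> `|f x| <= g x) -> intg f.
Proof.
move=> mf gi h; apply: le_integrable gi => //; first exact/measurable_EFinP.
by move=> x Dx /=; rewrite lee_fin (le_trans (h x Dx))// ler_norm.
Qed.

Lemma intg_ae_le f g : measurable_fun D f -> intg g ->
  {ae mu, forall x, D x -> `|f x| <= g x} -> intg f.
Proof.
move=> mf gi h; apply/integrableP; split; first exact/measurable_EFinP.
have /integrableP[mg] := gi; apply: le_lt_trans.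
apply: ae_ge0_le_integral => //.
- by do 2 apply: measurableT_comp => //; exact: measurable_EFinP.
- by apply: measurableT_comp => //; exact: measurable_EFinP.
- by apply: filterS h => x h Dx /=; rewrite lee_fin (le_trans (h Dx))// ler_norm.
Qed.

Lemma ae_eq_Rintegral f g : intg f -> intg g ->
  {ae mu, forall x, D x -> f x = g x} ->
  \int[mu]_(x in D) f x = \int[mu]_(x in D) g x.
Proof.
move=> fi gi fg; congr fine; apply: ae_eq_integral => //.
- exact: measurable_int fi.
- exact: measurable_int gi.
- by apply: filterS fg => x h Dx /=; rewrite h.
Qed.

Lemma intg_ae_eq f g : intg f -> measurable_fun D g ->
  {ae mu, forall x, D x -> f x = g x} -> intg g.
Proof.
move=> fi mg fg; apply: (intg_ae_le mg (intg_norm fi)).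
by apply: filterS fg => x h Dx; rewrite h.
Qed.

Lemma Rintegral_norm_eq0 f : intg f -> \int[mu]_(x in D) `|f x| = 0 ->
  {ae mu, forall x, D x -> f x = 0}.
Proof.
move=> fi f0.
have mf : measurable_fun D (EFin \o f) by exact: measurable_int fi.
have /(ae_eq_integral_abs mu mD mf) : (\int[mu]_(x in D) `|(EFin \o f) x| = 0)%E.
  have := integrable_fin_num mD (intg_norm fi).
  by move/fineK; rewrite -/(Rintegral _ _ _) f0 /= => <-.
by apply: filterS => x h /h /= [].
Qed.

Lemma ae_le_Rintegral f g : intg f -> intg g ->
  {ae mu, forall x, D x -> f x <= g x} ->
  \int[mu]_(x in D) f x <= \int[mu]_(x in D) g x.
Proof.
move=> fi gi fg; rewrite -subr_ge0 -RintegralB//.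
rewrite (@ae_eq_Rintegral _ (fun x => `|g x - f x|)).
- by apply: Rintegral_ge0 => x _.
- exact: intgB.
- exact/intg_norm/intgB.
- by apply: filterS fg => x h Dx; rewrite ger0_norm// subr_ge0 h.
Qed.

Lemma Rintegral_dist_le f g h : intg f -> intg g -> intg h ->
  {ae mu, forall x, D x -> `|f x - g x| <= h x} ->
  `|\int[mu]_(x in D) f x - \int[mu]_(x in D) g x| <= \int[mu]_(x in D) h x.
Proof.
move=> fi gi hi fgh; rewrite -RintegralB//.
apply: le_trans (le_normr_Rintegral mD (intgB fi gi)) _.
by apply: ae_le_Rintegral => //; exact/intg_norm/intgB.
Qed.

End RealIntegral.

(** * Lebesgue measure on I and equality almost everywhere *)

Section IntervalMeasure.
Context {R : realType}.
Notation leb := (@leb R).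
Notation I_ := (@I_ R).

#[global] Instance leb_ae_filter : Filter (almost_everywhere leb).
Proof. exact: (ae_filter_ringOfSetsType (@lebesgue_measure R)). Qed.

Lemma measurable_I_ : measurable I_.
Proof. exact: measurable_itv. Qed.

Lemma I_bounds (y : R) : I_ y <-> - 2^-1 < y < 2^-1.
Proof. by rewrite /Defs.I_ /= in_itv. Qed.

Lemma Ibar_bounds (y : R) : Ibar y <-> - 2^-1 <= y <= 2^-1.
Proof. by rewrite /Ibar /= in_itv. Qed.

Lemma subset_I_Ibar : I_ `<=` Ibar.
Proof. by move=> y /I_bounds h; apply/Ibar_bounds; move: h => /andP[? ?]; rewrite !ltW. Qed.

Lemma leb_I_ : leb I_ = 1%E.
Proof.
rewrite /Defs.leb /Defs.I_ lebesgue_measure_itv/= lte_fin.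
have -> : (- 2^-1 < 2^-1 :> R) by lra.
by rewrite -EFinB; congr EFin; lra.
Qed.

Lemma leb_fin_itv (a b : R) (x y : bool) :
  (leb [set` Interval (BSide x a) (BSide y b)] < +oo)%E.
Proof.
by rewrite /Defs.leb lebesgue_measure_itv/=; case: ifP => // _; rewrite -EFinD ltry.
Qed.

Lemma L1I_cst (c : R) : L1I (fun=> c).
Proof.
apply: measurable_bounded_integrable => //.
- exact: measurable_I_.
- by rewrite [X in (X < _)%E]leb_I_ ltry.
- by exists `|c|; split => // M cM y _ /=; exact: ltW.
Qed.

Lemma L1I_bounded (f : R -> R) (C : R) : measurable_fun I_ f ->
  (forall y, I_ y -> `|f y| <= C) -> L1I f.
Proof. by move=> mf fC; exact: (@intg_le _ _ _ leb _ measurable_I_ f (fun=> C) mf (L1I_cst C) fC). Qed.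

Lemma Rint_I_cst (c : R) : \int[leb]_(y in I_) c = c.
Proof. by have -> := @Rintegral_cst _ _ _ leb _ measurable_I_ c; rewrite [X in fine X]leb_I_ mulr1. Qed.

Lemma L2I_L1I (f : R -> R) : L2I f -> L1I f.
Proof.
move=> [mf f2]; apply: (@intg_le _ _ _ leb _ measurable_I_ _ (fun y => 1 + f y ^+ 2)) => //.
- apply: intgD => //; [exact: measurable_I_|exact: L1I_cst].
- by move=> y _; rewrite ler_norml; nra.
Qed.

Lemma eqI_sym (f g : R -> R) : eqI f g -> eqI g f.
Proof. by apply: filterS => y h /h. Qed.

Lemma eqI_trans (g f h : R -> R) : eqI f g -> eqI g h -> eqI f h.
Proof. by move=> fg; apply: filterS2 fg => y h1 h2 Iy; rewrite h1// h2. Qed.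

End IntervalMeasure.
#[global] Hint Extern 0 (measurable (Defs.I_)) => exact: measurable_I_ : core.

(** * Dominated convergence for real-valued integrals *)

Section Dominated.
Context d (T : measurableType d) {R : realType} (mu : {measure set T -> \bar R}).
Variable D : set T.
Hypothesis mD : measurable D.

Lemma Rintegral_dominated_cvg (f_ : nat -> T -> R) (f g : T -> R) :
  (forall n, measurable_fun D (f_ n)) -> measurable_fun D f ->
  {ae mu, forall x, D x -> f_ n x @[n --> \oo] --> f x} ->
  mu.-integrable D (EFin \o g) ->
  (forall n x, D x -> `|f_ n x| <= g x) ->
  \int[mu]_(x in D) f_ n x @[n --> \oo] --> \int[mu]_(x in D) f x.
Proof.
move=> mf_ mf cf gi fg.
have [|||||fi _ h] := @dominated_convergence _ _ _ mu D mD
  (fun n => EFin \o f_ n) (EFin \o f) (EFin \o g).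
- by move=> n; exact/measurable_EFinP.
- exact/measurable_EFinP.
- apply: filterS cf => x h Dx /=; apply: cvg_EFin; last exact: h.
  by apply: nearW.
- exact: gi.
- by apply: aeW => x n Dx /=; rewrite lee_fin fg.
- by apply: fine_cvg; rewrite fineK// integrable_fin_num.
Qed.

End Dominated.

(** * Primitives of integrable functions *)

Section Primitive.
Context {R : realType}.
Notation leb := (@leb R).
Implicit Types (f : R -> R) (a b t : R).

Lemma continuous_primitive f a :
  (forall b, leb.-integrable `[a, b] (EFin \o f)) ->
  continuous (fun t => \int[leb]_(s in `[a, t]) f s).
Proof.
move=> fi x.
(* [[c, b]] contains [a] and [x] in its interior, and extending [f] by zero to the left of [a]
   changes no value of the primitive. *)
pose c := Num.min a x - 1; pose b := Num.max a x + 1.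
have ca : c < a by rewrite /c ltrBlDr (@le_lt_trans _ _ a)// ?ge_min ?lexx// ltrDl.
have cx : c < x by rewrite /c ltrBlDr (@le_lt_trans _ _ x)// ?ge_min ?lexx ?orbT// ltrDl.
have xb : x < b by rewrite /b (@le_lt_trans _ _ (Num.max a x))// ?le_max ?lexx ?orbT// ltrDl.
pose f' := f \_ `[a, +oo[.
have cap y : `[c, y]%classic `&` `[a, +oo[%classic = `[a, y]%classic :> set R.
  apply/seteqP; split => z /=; rewrite !in_itv/= ?andbT.
    by move=> [/andP[_ ->] ->].
  by move=> /andP[az zy]; rewrite az zy (ltW (lt_le_trans ca az)).
have fE : (fun t => \int[leb]_(s in `[a, t]) f s) =
    (fun t => parameterized_integral leb c t f').
  by apply/funext => y; rewrite /parameterized_integral /f' -Rintegral_mkcondr cap.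
have f'i : leb.-integrable `[c, b] (EFin \o f').
  rewrite /f' -restrict_EFin; apply/integrable_restrict => //.
  by rewrite cap; exact: fi.
have := @parameterized_integral_continuous R c b f' (ltW (lt_trans cx xb)) f'i.
move=> /(continuous_within_itvP _ (lt_trans cx xb))[h _ _].
by rewrite fE; apply: h; rewrite in_itv/= cx.
Qed.

Lemma is_derive_primitive f a t :
  (forall b, leb.-integrable `[a, b] (EFin \o f)) -> a < t ->
  {for t, continuous f} ->
  is_derive t 1 (fun t => \int[leb]_(s in `[a, t]) f s) (f t).
Proof.
move=> fi at_ cf.
have t1 : t < t + 1 by rewrite ltrDl.
have [h1 h2] := continuous_FTC1_closed t1 (fi (t + 1)) at_ cf.
apply: DeriveDef; first exact: h1.
by move: h2; rewrite derive1E.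
Qed.

End Primitive.

(** * A C^1 ramp and its triangular derivative *)

Section SmoothStep.
Context {R : realType}.
Implicit Types (x y h a : R).

Definition pos_part x : R := Num.max x 0.
Definition pos_prim x : R := pos_part x ^+ 2 / 2.

Lemma pos_part_cases x :
  (x <= 0 /\ pos_part x = 0) \/ (0 <= x /\ pos_part x = x).
Proof. by rewrite /pos_part; case: (leP x 0) => h; [left|right; split => //; exact: ltW]. Qed.

Lemma continuous_pos_part : continuous pos_part.
Proof. by move=> x; apply: continuous_max; [exact: cvg_id|exact: cvg_cst]. Qed.

Lemma is_derive_pos_prim x : is_derive x 1 pos_prim (pos_part x).
Proof.
have [x0|x0|->] := ltgtP x 0.
- have -> : pos_part x = 0 by case: (pos_part_cases x) => -[] //; lra.
  have hn : \forall y \near x, cst 0 y = pos_prim y.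
    have : \forall y \near x, y < 0 by exact: lt_nbhsl.
    apply: filterS => y y0; rewrite /pos_prim.
    by have [[_ ->]|[]] := pos_part_cases y; [rewrite expr0n mul0r|lra].
  exact: (near_eq_is_derive hn (is_derive_cst (0 : R) x 1)).
- have -> : pos_part x = x by case: (pos_part_cases x) => -[] //; lra.
  have hn : \forall y \near x, y ^+ 2 / 2 = pos_prim y.
    have : \forall y \near x, 0 < y by exact: lt_nbhsr.
    apply: filterS => y y0; rewrite /pos_prim.
    by have [[]|[_ ->]] := pos_part_cases y; [lra|].
  have h : is_derive x 1 (fun y : R => y ^+ 2) (x + x).
    apply: (is_derive_eq (is_deriveM (is_derive_id x 1) (is_derive_id x 1))).
    by rewrite /GRing.scale/= !mulr1.
  have h' : is_derive x 1 (fun y : R => y ^+ 2 / 2) x.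
    have -> : (fun y : R => y ^+ 2 / 2) = 2^-1 \*: (fun y : R => y ^+ 2).
      by apply/funext => y; rewrite mulrC.
    by apply: (is_derive_eq (is_deriveZ _ h)); rewrite /GRing.scale/=; field.
  exact: (near_eq_is_derive hn h').
- have pp0 : pos_part 0 = 0 by rewrite /pos_part maxxx.
  rewrite pp0.
  have lim0 : h^-1 *: ((pos_prim \o shift 0) (h *: (1:R)) - pos_prim 0) @[h --> 0^'] --> (0 : R).
    apply/cvgrPdist_le => e e0; near=> h.
    rewrite sub0r normrN /GRing.scale/= mulr1 addr0 /pos_prim pp0 expr0n mul0r subr0.
    have hn0 : h != 0 by near: h; exact: nbhs_dnbhs_neq.
    have he : `|h| <= e by near: h; apply: dnbhs0_le.
    rewrite normrM normfV ler_pdivrMl ?normr_gt0//.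
    rewrite ger0_norm ?divr_ge0 ?sqr_ge0//.
    have [[_ ->]|[h0 ->]] := pos_part_cases h.
      by rewrite expr0n mul0r mulr_ge0// ltW.
    by move: he; rewrite ger0_norm// => he; nra.
  apply: DeriveDef.
  - by apply/cvg_ex; exists 0.
  - exact/cvg_lim.
Unshelve. all: by end_near.
Qed.

(** Centered second difference of [pos_part]: a triangle of base [2 h], height [1 / h] and unit
    area. The same difference of [pos_prim] is [smooth_step], a ramp from 0 at [-h] to 1 at [h]. *)
Definition hat h x : R :=
  (pos_part (x + h) - 2 * pos_part x + pos_part (x - h)) / h ^+ 2.
Definition smooth_step h x : R :=
  (pos_prim (x + h) - 2 * pos_prim x + pos_prim (x - h)) / h ^+ 2.

Lemma continuous_hat h a : continuous (fun x => hat h (x - a)).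
Proof.
have c (k : R -> R) : continuous k -> continuous (fun x => pos_part (k x)).
  move=> ck x; apply: (@continuous_comp _ _ _ k pos_part); first exact: ck.
  exact: continuous_pos_part.
have cs b : continuous (fun x : R => x + b).
  by move=> x; apply: cvgD; [exact: cvg_id|exact: cvg_cst].
move=> x; apply: cvgMl.
apply: cvgD; first apply: cvgB.
- apply: (c (fun x => x - a + h)) => {}x.
  by apply: cvgD; [exact: cs|exact: cvg_cst].
- by apply: cvgMr; apply: (c (fun x => x - a)); exact: cs.
- apply: (c (fun x => x - a - h)) => {}x.
  by apply: cvgD; [exact: cs|exact: cvg_cst].
Qed.

Lemma is_derive_smooth_step h a x :
  is_derive x 1 (fun x => smooth_step h (x - a)) (hat h (x - a)).
Proof.
have c b : is_derive x 1 (fun x => pos_prim (x + b)) (pos_part (x + b)).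
  have d1 : is_derive x 1 (fun x : R => x + b) 1.
    by apply: (is_derive_eq (is_deriveD (is_derive_id x 1) (is_derive_cst b x 1))); rewrite addr0.
  apply: (is_derive_eq (@is_derive1_comp R pos_prim (fun x => x + b) x _ _ (is_derive_pos_prim _) d1)).
  exact: mulr1.
have -> : (fun x => smooth_step h (x - a)) = (h ^+ 2)^-1 \*:
   ((fun x => pos_prim (x + (h - a))) - 2 \*: (fun x => pos_prim (x - a)) +
    (fun x => pos_prim (x + (- h - a)))).
  apply/funext => y; rewrite /smooth_step mulrC; congr (_ * (_ - _ + _)).
    by rewrite -addrA [- a + _]addrC.
  by rewrite -addrA [- a + _]addrC.
apply: (is_derive_eq (is_deriveZ _ (is_deriveD (is_deriveB (c _) (is_deriveZ 2 (c _))) (c _)))).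
rewrite /hat /GRing.scale/= mulrC; congr ((_ - _ + _) / _).
  by rewrite -addrA [- a + _]addrC.
by rewrite -addrA [- a + _]addrC.
Qed.

Lemma hat_bounds h x : 0 < h -> 0 <= hat h x <= h^-1.
Proof.
move=> h0; rewrite /hat divr_ge0 ?sqr_ge0//=; last first.
  by have [[? ->]|[? ->]] := pos_part_cases (x + h);
    have [[? ->]|[? ->]] := pos_part_cases x;
    have [[? ->]|[? ->]] := pos_part_cases (x - h); lra.
rewrite ler_pdivrMr ?exprn_gt0// expr2 mulKf ?gt_eqF//.
by have [[? ->]|[? ->]] := pos_part_cases (x + h);
    have [[? ->]|[? ->]] := pos_part_cases x;
    have [[? ->]|[? ->]] := pos_part_cases (x - h); lra.
Qed.

Lemma hat_out h x : 0 < h -> h <= `|x| -> hat h x = 0.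
Proof.
move=> h0; rewrite /hat ler_normr => /orP hx.
suff -> : pos_part (x + h) - 2 * pos_part x + pos_part (x - h) = 0 by rewrite mul0r.
by case: hx => ?; have [[? ->]|[? ->]] := pos_part_cases (x + h);
    have [[? ->]|[? ->]] := pos_part_cases x;
    have [[? ->]|[? ->]] := pos_part_cases (x - h); lra.
Qed.

Lemma smooth_step_left h x : 0 < h -> x <= - h -> smooth_step h x = 0.
Proof.
move=> h0 hx; rewrite /smooth_step /pos_prim.
have -> : pos_part (x + h) = 0 by have [[? ->]|[? ->]] := pos_part_cases (x + h); lra.
have -> : pos_part x = 0 by have [[? ->]|[? ->]] := pos_part_cases x; lra.
have -> : pos_part (x - h) = 0 by have [[? ->]|[? ->]] := pos_part_cases (x - h); lra.
by rewrite expr0n !mul0r mulr0 subr0 addr0 mul0r.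
Qed.

Lemma smooth_step_right h x : 0 < h -> h <= x -> smooth_step h x = 1.
Proof.
move=> h0 hx; rewrite /smooth_step /pos_prim.
have -> : pos_part (x + h) = x + h by have [[? ->]|[_ ->]] := pos_part_cases (x + h); lra.
have -> : pos_part x = x by have [[? ->]|[_ ->]] := pos_part_cases x; lra.
have -> : pos_part (x - h) = x - h by have [[? ->]|[_ ->]] := pos_part_cases (x - h); lra.
by field; rewrite gt_eqF.
Qed.

Lemma smooth_step_bounds h x : 0 < h -> 0 <= smooth_step h x <= 1.
Proof.
move=> h0; rewrite /smooth_step /pos_prim.
rewrite ler_pdivlMr ?exprn_gt0// ler_pdivrMr ?exprn_gt0// mul0r mul1r.
by have [[? ->]|[? ->]] := pos_part_cases (x + h);
    have [[? ->]|[? ->]] := pos_part_cases x;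
    have [[? ->]|[? ->]] := pos_part_cases (x - h); nra.
Qed.

End SmoothStep.

(** * The du Bois-Reymond lemma on I *)

Section DuBoisReymond.
Context {R : realType}.
Notation leb := (@leb R).
Notation I_ := (@I_ R).
Implicit Types (f g : R -> R) (a b h x y : R).

Lemma L1I_restrict f : L1I f -> leb.-integrable setT (EFin \o (f \_ I_)).
Proof.
move=> fi; rewrite -restrict_EFin; apply/integrable_restrict => //; by rewrite setTI.
Qed.

Lemma L1I_measurable f : L1I f -> measurable_fun I_ f.
Proof. by move=> fi; exact: (@intg_measurable _ _ _ leb _ f fi). Qed.

Definition primI f y : R := \int[leb]_(x in `[- 2^-1, y]) (f \_ I_) x.

Lemma continuous_primI f : L1I f -> continuous (primI f).
Proof.
move=> fi; apply: continuous_primitive => b.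
by apply: integrableS (L1I_restrict fi).
Qed.

Lemma primI_left f : primI f (- 2^-1) = 0.
Proof. by rewrite /primI set_itv1 Rintegral_set1. Qed.

Lemma primI_right f : primI f (2^-1) = \int[leb]_(x in I_) f x.
Proof.
rewrite /primI -Rintegral_mkcondr; congr (Rintegral _ _ _).
by apply/setIidPr; exact: subset_I_Ibar.
Qed.

Lemma Rintegral_I_oc f a b : L1I f -> - 2^-1 < a -> a <= b -> b < 2^-1 ->
  \int[leb]_(x in I_) (f \_ `]a, b]) x = primI f b - primI f a.
Proof.
move=> fi a1 ab b1; rewrite -Rintegral_mkcondr.
rewrite /primI Rintegral_itvB; last 3 first.
- by apply: integrableS (L1I_restrict fi).
- by rewrite bnd_simp ltW.
- by rewrite bnd_simp.
rewrite -Rintegral_mkcondl; congr (Rintegral _ _ _).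
Qed.

Lemma ball_I a h y : - 2^-1 < a - h -> a + h < 2^-1 -> ball a h y -> I_ y.
Proof.
move=> h1 h2; rewrite ball_itv/= in_itv/= => /andP[y1 y2].
by apply/I_bounds; rewrite (lt_trans h1 y1) (lt_trans y2 h2).
Qed.

Lemma L1I_hat f h a : 0 < h -> L1I f -> L1I (fun x => f x * hat h (x - a)).
Proof.
move=> h0 fi.
have mh : measurable_fun I_ (fun x => hat h (x - a)).
  by apply: measurable_funTS; apply: continuous_measurable_fun; exact: continuous_hat.
apply: (@intg_le _ _ _ leb _ measurable_I_ _ (fun x => h^-1 * `|f x|)).
- by apply: measurable_funM => //; exact: L1I_measurable.
- by apply: intgZ => //; exact: intg_norm.
- move=> x _; have /andP[h1 h2] := hat_bounds (x - a) h0.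
  by rewrite normrM mulrC (ger0_norm h1) ler_wpM2r.
Qed.

Lemma Rintegral_hat h a : 0 < h -> - 2^-1 < a - h -> a + h < 2^-1 ->
  \int[leb]_(x in I_) hat h (x - a) = 1.
Proof.
move=> h0 h1 h2.
have lr : - 2^-1 < 2^-1 :> R by lra.
have lrc : {within `[- 2^-1, 2^-1], continuous (fun x : R => hat h (x - a))}.
  by apply: continuous_subspaceT; exact: continuous_hat.
have cstep : continuous (fun x => smooth_step h (x - a)).
  move=> x; apply: differentiable_continuous; apply/derivable1_diffP.
  by have [] := is_derive_smooth_step h a x.
have lro : derivable_oo_LRcontinuous (fun x => smooth_step h (x - a)) (- 2^-1) (2^-1).
  split.
  - by move=> x _; have [] := is_derive_smooth_step h a x.
  - exact/cvg_at_right_filter/cstep.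
  - exact/cvg_at_left_filter/cstep.
have lrd : {in `]- 2^-1, 2^-1[, derive1 (fun x => smooth_step h (x - a)) =1 (fun x : R => hat h (x - a))}.
  by move=> x _; rewrite derive1E; have [] := is_derive_smooth_step h a x.
have := continuous_FTC2 lr lrc lro lrd.
rewrite smooth_step_right// ?smooth_step_left//; last 2 first.
- by lra.
- by lra.
rewrite sube0 => e.
transitivity (\int[leb]_(x in `[- 2^-1, 2^-1]) hat h (x - a)); last by rewrite /Rintegral [X in fine X]e.
have -> : I_ = `]- 2^-1, 2^-1[%classic by [].
have hi : leb.-integrable `[- 2^-1, 2^-1] (EFin \o (fun x => hat h (x - a))).
  apply: continuous_compact_integrable; first exact: segment_compact.
  by apply: continuous_subspaceT; exact: continuous_hat.
rewrite Rintegral_itv_bndo_bndc; last first.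
  apply: integrableS hi => //; apply: subset_itv; by rewrite bnd_simp.
rewrite Rintegral_itv_obnd_cbnd//.
apply: integrableS hi => //; apply: subset_itv; by rewrite bnd_simp.
Qed.

(** The kernel is at most [1 / h] and vanishes outside the ball of radius [h], so the error is at
    most twice the mean deviation [davg], which tends to 0 at a Lebesgue point. *)
Lemma cvg_hat f a (h_ : nat -> R) : L1I f -> lebesgue_pt (f \_ I_) a ->
  (forall n, [/\ 0 < h_ n, - 2^-1 < a - h_ n & a + h_ n < 2^-1]) ->
  h_ n @[n --> \oo] --> 0 ->
  \int[leb]_(x in I_) (f x * hat (h_ n) (x - a)) @[n --> \oo] --> f a.
Proof.
move=> fi fa hn h0.
have Fi := L1I_restrict fi.
have Ia n y : ball a (h_ n) y -> I_ y by have [_ h1 h2] := hn n; exact: ball_I.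
have Iaa : I_ a by apply: (Ia 0%N); apply: ballxx; have [] := hn 0%N.
have Fa : (f \_ I_) a = f a by rewrite patchE mem_set.
have mB n : measurable (ball a (h_ n) : set R) by exact: measurable_ball.
have BI n : leb.-integrable (ball a (h_ n)) (EFin \o (fun y => `|(f \_ I_) y - f a|)).
  apply: intg_norm; apply: intgB; first exact: mB.
    by apply: integrableS Fi => //; exact: mB.
  apply: measurable_bounded_integrable => //; first exact: mB.
  - have [hn0 _ _] := hn n; rewrite [X in (X < _)%E](lebesgue_measure_ball _ (ltW hn0)).
    exact: ltry.
  - by exists `|f a|; split => // M cM y _ /=; exact: ltW.
have davgE n : fine (davg (f \_ I_) a (h_ n)) =
    (h_ n *+ 2)^-1 * \int[leb]_(y in ball a (h_ n)) `|(f \_ I_) y - f a|.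
  have [hn0 _ _] := hn n.
  rewrite /davg /iavg fineM.
  - congr (_ * _).
      by rewrite [X in (X^-1)%E](lebesgue_measure_ball _ (ltW hn0)) fine_invr.
    by rewrite /Rintegral Fa.
  - rewrite [X in (X^-1)%E](lebesgue_measure_ball _ (ltW hn0)) inver.
    by rewrite gt_eqF// pmulrn_lgt0.
  - rewrite Fa; exact: (@integrable_fin_num _ _ _ leb _ (mB n) _ (BI n)).
have lim0 : fine (davg (f \_ I_) a (h_ n)) @[n --> \oo] --> (0 : R).
  apply: fine_cvg; move: fa => /(cvge_at_rightP _ _ _).1; apply; split => //.
  by move=> n; have [] := hn n.
have lim1 : 2 * fine (davg (f \_ I_) a (h_ n)) @[n --> \oo] --> (0 : R).
  by rewrite -[X in _ --> X](mulr0 2); apply: cvgMr.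
apply/cvgrPdist_le => e e0.
move/cvgrPdist_le : lim1 => /(_ e e0); apply: filterS => n.
rewrite sub0r normrN => /(le_trans _); apply.
have [hn0 h1 h2] := hn n.
rewrite (le_trans _ (ler_norm _))// davgE.
have -> : 2 * ((h_ n *+ 2)^-1 * \int[leb]_(y in ball a (h_ n)) `|(f \_ I_) y - f a|) =
    \int[leb]_(y in ball a (h_ n)) ((h_ n)^-1 * `|(f \_ I_) y - f a|).
  rewrite (@RintegralZl _ _ _ leb _ _ _ (mB n) (BI n)) mulrA; congr (_ * _).
  by rewrite -mulr_natl; field; rewrite gt_eqF.
have hati : L1I (fun x => hat (h_ n) (x - a)).
  have := L1I_hat a hn0 (L1I_cst 1); rewrite (_ : (fun x => _) = (fun x => hat (h_ n) (x - a)))//.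
  by apply/funext => x; rewrite mul1r.
have fE : \int[leb]_(x in I_) (f a * hat (h_ n) (x - a)) = f a.
  by rewrite (@RintegralZl _ _ _ leb _ _ _ measurable_I_ hati) Rintegral_hat// mulr1.
rewrite -{1}fE distrC -RintegralB//; [|exact: L1I_hat|by apply: intgZ].
have -> : \int[leb]_(x in I_) (f x * hat (h_ n) (x - a) - f a * hat (h_ n) (x - a)) =
   \int[leb]_(x in ball a (h_ n)) ((f x - f a) * hat (h_ n) (x - a)).
  transitivity (\int[leb]_(x in I_) ((fun x => (f x - f a) * hat (h_ n) (x - a)) \_ (ball a (h_ n))) x).
    apply: eq_Rintegral => x _; rewrite patchE; case: ifPn => [_|]; first by rewrite mulrBl.
    rewrite notin_setE /ball/= => /negP; rewrite -leNgt distrC => hx.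
    by rewrite hat_out// !mulr0 subrr.
  rewrite -Rintegral_mkcondr; congr (Rintegral _ _ _).
  by apply/setIidPr => y; exact: Ia.
have Bi2 : leb.-integrable (ball a (h_ n)) (EFin \o (fun x => (f x - f a) * hat (h_ n) (x - a))).
  have : L1I (fun x => (f x - f a) * hat (h_ n) (x - a)).
    by apply: L1I_hat => //; apply: intgB => //; exact: L1I_cst.
  by apply: integrableS => //; [exact: mB|exact: Ia].
apply: le_trans (@le_normr_Rintegral _ _ _ leb _ _ (mB n) Bi2) _.
apply: le_Rintegral; first exact: mB.
- exact: intg_norm.
- exact: (@intgZ _ _ _ leb _ (mB n) _ _ (BI n)).
- move=> y /Ia Iy; rewrite patchE mem_set// normrM mulrC ler_wpM2r//.
  by have /andP[? ?] := hat_bounds (y - a) hn0; rewrite ger0_norm.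
Qed.

Lemma test_fun_steps a b h : 0 < h -> a < b -> - 2^-1 < a - h -> b + h < 2^-1 ->
  test_fun (fun x => smooth_step h (x - a) - smooth_step h (x - b)) /\
  derive1 (fun x => smooth_step h (x - a) - smooth_step h (x - b)) =
    (fun x => hat h (x - a) - hat h (x - b)).
Proof.
move=> h0 ab h1 h2.
have dphi x : is_derive x 1 (fun x => smooth_step h (x - a) - smooth_step h (x - b))
    (hat h (x - a) - hat h (x - b)).
  by apply: is_deriveB; exact: is_derive_smooth_step.
have e : derive1 (fun x => smooth_step h (x - a) - smooth_step h (x - b)) =
    (fun x => hat h (x - a) - hat h (x - b)).
  by apply/funext => x; rewrite derive1E; have [] := dphi x.
split => //; split.
- by move=> x; have [] := dphi x.
- by rewrite e => x; apply: cvgB; exact: continuous_hat.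
- exists (a - h), (b + h); split => // x /negP; rewrite negb_and -!ltNge => /orP[hx|hx].
    by rewrite !smooth_step_left// ?subrr//; lra.
  by rewrite !smooth_step_right// ?subrr//; lra.
Qed.

Lemma leb_ae_neq a : {ae leb, forall x : R, x <> a}.
Proof.
exists [set a]; split; [exact: measurable_set1| |].
- exact: lebesgue_measure_set1.
- by move=> x /= /contrapT.
Qed.

(* Test weak_deriv f g on a smoothed indicator of [a, b] at two Lebesgue points
   of f and shrink the smoothing. *)
Lemma weak_deriv_lebesgue_pt f g a b : L1I f -> L1I g -> weak_deriv f g ->
  - 2^-1 < a -> a < b -> b < 2^-1 ->
  lebesgue_pt (f \_ I_) a -> lebesgue_pt (f \_ I_) b ->
  f b - f a = primI g b - primI g a.
Proof.
move=> fi gi fg a1 ab b1 fa fb.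
pose d := Num.min (a + 2^-1) (2^-1 - b).
have d0 : 0 < d by rewrite lt_min; apply/andP; split; lra.
have da : d <= a + 2^-1 by rewrite ge_min lexx.
have db : d <= 2^-1 - b by rewrite ge_min lexx orbT.
clearbody d.
pose h_ n : R := d * 2^-1 * n.+1%:R^-1.
have hn0 n : 0 < h_ n by rewrite !mulr_gt0// invr_gt0.
have hnd n : h_ n < d.
  rewrite /h_ -mulrA gtr_pMr// -invfM invf_lt1 ?mulr_gt0//.
  by rewrite -natrM ltr1n mulnS.
have hcvg : h_ n @[n --> \oo] --> (0 : R).
  by rewrite -[X in _ --> X](mulr0 (d * 2^-1)); apply: cvgMr; exact: cvg_harmonic.
clearbody h_.
have h1 n : - 2^-1 < a - h_ n by have := hnd n; lra.
have h2 n : b + h_ n < 2^-1 by have := hnd n; lra.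
have h3 n : - 2^-1 < b - h_ n by have := hnd n; lra.
have h4 n : a + h_ n < 2^-1 by have := hnd n; lra.
have ha := cvg_hat fi fa (fun n => And3 (hn0 n) (h1 n) (h4 n)) hcvg.
have hb := cvg_hat fi fb (fun n => And3 (hn0 n) (h3 n) (h2 n)) hcvg.
pose phi n x := smooth_step (h_ n) (x - a) - smooth_step (h_ n) (x - b).
have phib n x : `|phi n x| <= 1.
  have := smooth_step_bounds (x - a) (hn0 n); have := smooth_step_bounds (x - b) (hn0 n).
  by rewrite ler_norml /phi => *; lra.
have cphi n : continuous (phi n).
  move=> x; apply: differentiable_continuous; apply/derivable1_diffP.
  by have [] := test_fun_steps (hn0 n) ab (h1 n) (h2 n) => -[].
have gphi : \int[leb]_(x in I_) (g x * phi n x) @[n --> \oo] --> primI g b - primI g a.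
  rewrite -Rintegral_I_oc//; last exact: ltW.
  apply: (@Rintegral_dominated_cvg _ _ _ leb _ measurable_I_ _ _ (fun x => `|g x|)).
  - move=> n; apply: measurable_funM; first exact: L1I_measurable.
    by apply: measurable_funTS; exact: continuous_measurable_fun.
  - apply/(measurable_restrict g _ _); [by []|by []|].
    by apply: measurable_funS (L1I_measurable gi) => // x [].
  - apply: filterS2 (leb_ae_neq a) (leb_ae_neq b) => x xa xb Ix.
    rewrite patchE.
    (* Once [h_ n < r], the test function takes at [x] the value of the indicator of []a, b]]. *)
    pose r := Num.min `|x - a| `|x - b|.
    have r0 : 0 < r by rewrite lt_min !normr_gt0 !subr_eq0; apply/andP; split; apply/eqP.
    have ra : r <= `|x - a| by rewrite ge_min lexx.
    have rb : r <= `|x - b| by rewrite ge_min lexx orbT.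
    have : \forall n \near \oo, h_ n < r by exact: (cvgr_lt _ hcvg _ r0).
    move=> hr; apply: cvg_near_cst; apply: filterS hr => n hnr.
    have hA := lt_le_trans hnr ra; have hB := lt_le_trans hnr rb.
    have hn := hn0 n; rewrite /phi; move: (h_ n) hn hA hB {hnr} => h hn hA hB.
    have left y : x <= y -> h < `|x - y| -> smooth_step h (x - y) = 0.
      by move=> xy; rewrite ler0_norm ?subr_le0// => ?; apply: smooth_step_left => //; lra.
    have right y : y <= x -> h < `|x - y| -> smooth_step h (x - y) = 1.
      by move=> xy; rewrite ger0_norm ?subr_ge0// => ?; apply: smooth_step_right => //; lra.
    case: ifPn; rewrite ?inE ?notin_setE/= in_itv/=.
      by move=> /andP[ax xb']; rewrite right ?(ltW ax)// left// subr0 mulr1.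
    move=> /negP; rewrite negb_and -leNgt -ltNge => /orP[xa'|xb'].
      by rewrite !left ?subrr ?mulr0//; lra.
    by rewrite !right ?subrr ?mulr0//; lra.
  - exact: intg_norm.
  - by move=> n x _; rewrite normrM ler_piMr.
have key n : \int[leb]_(x in I_) (f x * hat (h_ n) (x - a)) - \int[leb]_(x in I_) (f x * hat (h_ n) (x - b))
    = - \int[leb]_(x in I_) (g x * phi n x).
  have [tf te] := test_fun_steps (hn0 n) ab (h1 n) (h2 n).
  have := fg _ tf; rewrite te /innerI => <-.
  rewrite -RintegralB//; [|exact: L1I_hat|exact: L1I_hat].
  by apply: eq_Rintegral => x _; rewrite mulrBr.
have l1 : (- \int[leb]_(x in I_) (g x * phi n x)) @[n --> \oo] --> f a - f b.
  have -> : (fun n => - (\int[leb]_(x in I_) (g x * phi n x))) =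
     (fun n => \int[leb]_(x in I_) (f x * hat (h_ n) (x - a)) - \int[leb]_(x in I_) (f x * hat (h_ n) (x - b))).
    by apply/funext => n; rewrite key.
  exact: cvgB.
have e : f a - f b = - (primI g b - primI g a).
  exact: (cvg_unique (@Rhausdorff R) l1 (cvgN gphi)).
by rewrite -opprB e opprK.
Qed.

(** Almost every point of I is a Lebesgue point of [f]; any one of them serves as base point [a] and
    fixes the constant as [f a - primI g a]. *)
Lemma weak_deriv_primitive f g : L1I f -> L1I g -> weak_deriv f g ->
  exists c, eqI f (fun y => c + primI g y).
Proof.
move=> fi gi fg.
have lp : {ae leb, forall x, lebesgue_pt (f \_ I_) x}.
  exact: (lebesgue_differentiation (@integrable_locally R f I_ measurable_I_ fi)).
have [a [Ia la]] : exists a, I_ a /\ lebesgue_pt (f \_ I_) a.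
  apply: contrapT => /forallNP h.
  have : leb I_ = 0%E.
    apply: (@measure_negligible _ _ _ leb) => //.
    by apply: negligibleS lp => x Ix lx; apply: (h x).
  by rewrite leb_I_ => /eqP; rewrite onee_eq0.
exists (f a - primI g a); apply: filterS lp => y ly Iy.
move/I_bounds : Ia => /andP[a1 a2]; move/I_bounds : Iy => /andP[y1 y2].
have [ya|ay|->] := ltgtP y a; last by rewrite subrK.
- by have := weak_deriv_lebesgue_pt fi gi fg y1 ya a2 ly la; lra.
- by have := weak_deriv_lebesgue_pt fi gi fg a1 ay y2 la ly; lra.
Qed.

End DuBoisReymond.

(** * Boundary values and vanishing weak derivatives *)

Section BoundaryValues.
Context {R : realType}.
Notation leb := (@leb R).
Notation I_ := (@I_ R).
Implicit Types (f g : R -> R) (a b y : R).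

Lemma ae_itv_witness (Q : R -> Prop) a b : {ae leb, forall y, I_ y -> Q y} ->
  a < b -> - 2^-1 <= a -> b <= 2^-1 -> exists y, a < y < b /\ Q y.
Proof.
move=> aeQ ab a1 b1; apply: contrapT => /forallNP h.
have : leb `]a, b[ = 0%E.
  apply: (@measure_negligible _ _ _ leb) => //.
  apply: negligibleS aeQ => y /=; rewrite in_itv/= => yab Qy; apply: (h y); split => //.
  apply: Qy; apply/I_bounds; move: yab => /andP[ay yb].
  by rewrite (le_lt_trans a1 ay) (lt_le_trans yb b1).
rewrite /Defs.leb lebesgue_measure_itv/= lte_fin ab -EFinB => -[] /eqP.
by rewrite subr_eq0 gt_eqF.
Qed.

Lemma ae_eq_continuous f g : {within Ibar, continuous f} ->
  {within Ibar, continuous g} -> eqI f g -> forall y, Ibar y -> f y = g y.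
Proof.
move=> cf cg fg y Iy; apply: contrapT => /eqP fgy.
have e0 : 0 < `|f y - g y| by rewrite normr_gt0 subr_eq0.
have cfg : {within Ibar, continuous (fun x => f x - g x)}.
  by move=> x; apply: cvgB; [exact: cf|exact: cg].
have /cvgrPdist_lt /(_ _ e0) := (subspace_continuousP _ _).1 cfg y Iy.
rewrite near_withinE => -[d/= d0 hd].
have key x : `|y - x| < d -> Ibar x -> f x <> g x.
  move=> dx Ix fgx; have := hd x dx Ix.
  by rewrite /from_subspace fgx subrr subr0 ltxx.
pose m := Num.min d 2^-1.
have m0 : 0 < m by rewrite lt_min d0/= invr_gt0.
have md : m <= d by rewrite ge_min lexx.
have m2 : m <= 2^-1 by rewrite ge_min lexx orbT.
clearbody m; move/Ibar_bounds : (Iy) => /andP[y1 y2].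
(* The interval is taken on the side of [y] facing the middle of I; with [m <= 1/2] it stays in
   [Ibar] even if [y] is an endpoint. *)
have [y0|y0] := leP y 0.
- have [|||x [/andP[xa xb] Q]] := @ae_itv_witness (fun x => f x = g x) y (y + m) fg.
  all: try by lra.
  apply: (key x) Q; first by rewrite ltr0_norm; lra.
  by apply/Ibar_bounds; lra.
- have [|||x [/andP[xa xb] Q]] := @ae_itv_witness (fun x => f x = g x) (y - m) y fg.
  all: try by lra.
  apply: (key x) Q; first by rewrite gtr0_norm; lra.
  by apply/Ibar_bounds; lra.
Qed.

(** The continuous representative that carries the boundary values agrees with the primitive
    everywhere on [Ibar], so the left endpoint fixes the constant and the right one the integral.
    The integral identity is what later ties the stress to the mass of the plastic strain. *)
Lemma weak_deriv_boundary f g (a b : R) : L1I f -> L1I g -> weak_deriv f g ->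
  has_boundary_values f a b ->
  eqI f (fun y => a + primI g y) /\ \int[leb]_(y in I_) g y = b - a.
Proof.
move=> fi gi fg [k [ck fk k1 k2]].
have [c fc] := weak_deriv_primitive fi gi fg.
have kc : forall y, Ibar y -> k y = c + primI g y.
  apply: ae_eq_continuous => //; last by apply: eqI_trans fc; exact: eqI_sym.
  apply: continuous_subspaceT => y; apply: cvgD; [exact: cvg_cst|].
  exact: continuous_primI.
have ca : c = a.
  by rewrite -k1 kc ?primI_left ?addr0//; apply/Ibar_bounds; lra.
subst c; split => //.
have := kc (2^-1); rewrite k2 primI_right => -> ; first by rewrite addrC addKr.
by apply/Ibar_bounds; lra.
Qed.

Lemma weak_deriv0_cst f : L1I f -> weak_deriv f (fun=> 0) -> exists c, eqI f (fun=> c).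
Proof.
move=> fi f0; have [c fc] := weak_deriv_primitive fi (L1I_cst 0) f0.
exists c; apply: eqI_trans fc _; apply: aeW => y _.
rewrite /primI (_ : (fun=> 0) \_ I_ = (fun=> 0)).
  by rewrite Rintegral_cst//= mul0r addr0.
by apply/funext => x; rewrite patchE; case: ifP.
Qed.

End BoundaryValues.

(** * Exchange of almost-everywhere quantifiers *)

Section SlicesOfNullSets.
Context {R : realType}.
Notation leb := (@leb R).

(** Both iterated integrals of the indicator of [B] are its product measure (Tonelli). The flow rule
    is stated at almost every time for almost every point, whereas a differential equation at fixed
    [y] needs the opposite order. *)
Lemma ae_fubini_swap (B : set (R * R)) : measurable B ->
  {ae leb, forall t, leb (xsection B t) = 0%E} ->
  {ae leb, forall y, leb (ysection B y) = 0%E}.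
Proof.
move=> mB h.
have e := @indic_fubini_tonelli _ _ _ _ R (@lebesgue_measure R) (@lebesgue_measure R) B mB.
rewrite indic_fubini_tonelli_FE// indic_fubini_tonelli_GE// in e.
have mF : measurable_fun setT (leb \o xsection B).
  exact: (measurable_fun_xsection (@lebesgue_measure R) mB).
have mG : measurable_fun setT (leb \o ysection B).
  exact: (measurable_fun_ysection (@lebesgue_measure R) mB).
have F0 : (\int[leb]_x (leb \o xsection B) x = 0)%E.
  rewrite (@ae_eq_integral _ _ _ leb setT (cst 0%E))//.
    exact: integral0.
  by apply: filterS h => t ht _.
have G0 : (\int[leb]_x `|(leb \o ysection B) x| = 0)%E.
  rewrite -F0 e; apply: eq_integral => x _.
  by rewrite gee0_abs.
have /(ae_eq_integral_abs (@lebesgue_measure R) measurableT mG) := G0.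
by apply: filterS => y /(_ I).
Qed.

End SlicesOfNullSets.

(** * Joint measurability and integrability in time and space *)

Section TimePrimitive.
Context {R : realType}.
Notation leb := (@leb R).
Notation I_ := (@I_ R).
Implicit Types (w : R -> R -> R).

Lemma measurable_halfline_I : measurable (halfline `*` I_ : set (R * R)).
Proof. by apply: measurableX => //; exact: measurable_itv. Qed.

(** The variable endpoint becomes the cut-off [s <= t] in a function of three variables, whose
    integral in [s] is measurable by Tonelli. Positive and negative parts are treated separately
    because no integrability is assumed. *)
Lemma measurable_time_primitive w :
  measurable_fun (halfline `*` I_) (fun x : R * R => w x.1 x.2) ->
  measurable_fun (halfline `*` I_)
    (fun x : R * R => \int[leb]_(s in `[0, x.1]) w s x.2).
Proof.
move=> mw.
pose W := (fun x : R * R => w x.1 x.2) \_ (halfline `*` I_).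
have mW : measurable_fun setT W by apply/(measurable_restrictT _ measurable_halfline_I).
pose K : set ((R * R) * R) := [set p | 0 <= p.1.1 - p.2].
have mK : measurable K.
  rewrite /K -[X in measurable X]setTI.
  have mf : measurable_fun setT (fun p : (R * R) * R => p.1.1 - p.2).
    apply: measurable_funB => //.
    exact: (measurableT_comp measurable_fst measurable_fst).
  have := mf measurableT _ (measurable_itv `[0, +oo[); congr (measurable (_ `&` _)).
  by apply/seteqP; split => p /=; rewrite in_itv/= andbT.
pose F : (R * R) * R -> R := (fun p => W (p.2, p.1.2)) \_ K.
have mF : measurable_fun setT F.
  apply/(measurable_restrictT _ mK); apply: measurable_funTS.
  apply: (measurableT_comp mW); apply: measurable_fun_pair => //.
  exact: (measurableT_comp measurable_snd measurable_fst).
have mEF : measurable_fun setT (EFin \o F) by exact/measurable_EFinP.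
have mIp : measurable_fun setT (fun x : R * R => (\int[leb]_s (EFin \o F)^\+%E (x, s))%E).
  apply: (@measurable_fun_fubini_tonelli_F _ _ _ _ R (@lebesgue_measure R) (EFin \o F)^\+%E) => //.
  exact: measurable_funepos.
have mIm : measurable_fun setT (fun x : R * R => (\int[leb]_s (EFin \o F)^\-%E (x, s))%E).
  apply: (@measurable_fun_fubini_tonelli_F _ _ _ _ R (@lebesgue_measure R) (EFin \o F)^\-%E) => //.
  exact: measurable_funeneg.
have mI : measurable_fun setT (fun x : R * R => (\int[leb]_s (EFin \o F) (x, s))%E).
  have -> : (fun x : R * R => (\int[leb]_s (EFin \o F) (x, s))%E) =
     (fun x => (\int[leb]_s ((EFin \o F)^\+%E (x, s)) - \int[leb]_s ((EFin \o F)^\-%E (x, s)))%E).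
    apply/funext => x; rewrite [LHS]integralE; congr (_ - _)%E.
      by apply: eq_integral => s _; rewrite !funeposE.
    by apply: eq_integral => s _; rewrite !funenegE.
  exact: emeasurable_funB mIp mIm.
have mJ : measurable_fun setT (fun x : R * R => \int[leb]_s F (x, s)).
  by apply: measurableT_comp mI; exact: fine_measurable.
apply: (eq_measurable_fun _ _ (measurable_funTS mJ)).
move=> [t y] /[!inE] -[/= t0 Iy]; rewrite [RHS]Rintegral_mkcond.
apply: eq_Rintegral => s _; rewrite /F /W !patchE.
rewrite /halfline/= in_itv/= andbT in t0.
have -> : ((t, y, s) \in K) = (s <= t).
  by apply/idP/idP; rewrite inE /K/= subr_ge0.
have -> : ((s, y) \in halfline `*` I_) = (0 <= s).
  apply/idP/idP; rewrite inE /halfline/= in_itv/= andbT; first by case.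
  by move=> ->.
have -> : (s \in `[0, t]%classic) = (0 <= s) && (s <= t).
  by apply/idP/idP; rewrite inE/= in_itv.
by case: (0 <= s); case: (s <= t).
Qed.

(** On a set of finite measure [|w| <= 1 + w ^ 2] turns square integrability into the integrability
    that Fubini requires. *)
Lemma square_integrable_slab w T :
  measurable_fun (halfline `*` I_) (fun x : R * R => w x.1 x.2) ->
  (leb \x leb)%E.-integrable (([set s | 0 <= s <= T] : set R) `*` I_)
    (fun x : R * R => (w x.1 x.2 ^+ 2)%:E) ->
  (leb \x leb)%E.-integrable setT
    (EFin \o ((fun x : R * R => w x.1 x.2) \_ (`[0, T]%classic `*` I_))).
Proof.
move=> mw w2; set D := `[0, T]%classic `*` I_.
have DE : ([set s | 0 <= s <= T] : set R) `*` I_ = D.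
  by rewrite /D; congr (_ `*` _); apply/seteqP; split => s /=; rewrite in_itv.
rewrite DE in w2.
have mD : measurable D by apply: measurableX => //; exact: measurable_itv.
have DH : D `<=` halfline `*` I_.
  by move=> [s y] [/= + ?]; rewrite /halfline/= !in_itv/= andbT => /andP[? _].
have i1 : (leb \x leb)%E.-integrable D (EFin \o (fun x : R * R => 1 + w x.1 x.2 ^+ 2)).
  apply: (@intgD _ _ _ (leb \x leb)%E _ mD (fun=> 1)) => //.
  apply: measurable_bounded_integrable => //.
  - have e := @product_measure1E _ _ _ _ R (@lebesgue_measure R) (@lebesgue_measure R)
      `[0, T]%classic I_ (measurable_itv _) measurable_I_.
    rewrite [X in (X < _)%E]e.
    rewrite [X in (_ * X)%E](@leb_I_ R) mule1; exact: leb_fin_itv.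
  - by exists 1; split => // M M1 x _ /=; rewrite normr1 ltW.
rewrite -restrict_EFin.
apply: ((@integrable_restrict _ _ _ (leb \x leb)%E _ mD _ measurableT _).1); rewrite setTI.
apply: (@intg_le _ _ _ (leb \x leb)%E _ mD _ _ _ i1).
- by apply: measurable_funS mw => //; exact: measurable_halfline_I.
- by move=> x _; rewrite ler_norml; nra.
Qed.

End TimePrimitive.

Lemma Rintegral0_eq d (T : measurableType d) {R : realType}
    (mu : {measure set T -> \bar R}) (D : set T) (f : T -> R) :
  (forall x, f x = 0) -> \int[mu]_(x in D) f x = 0.
Proof.
move=> f0; rewrite /Rintegral (_ : (fun x => (f x)%:E) = cst 0%E) ?integral0//.
by apply/funext => x; rewrite f0.
Qed.

(** * Fubini for real-valued integrals *)

Section RealFubini.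
Context {R : realType}.
Notation leb := (@leb R).
Notation I_ := (@I_ R).

(** The inner integral in Fubini may be infinite on a null set, where [fine] assigns 0. *)
Lemma integrable_fine_cvt (F : R -> \bar R) : leb.-integrable setT F ->
  leb.-integrable setT (EFin \o (fun x => fine (F x))) /\
  \int[leb]_x (fine (F x)) = fine (\int[leb]_x F x)%E.
Proof.
move=> Fi.
have Fae : {ae leb, forall x, setT x -> F x = (fine (F x))%:E}.
  have := @integrable_ae _ _ _ leb _ measurableT _ Fi.
  by apply: filterS => x h /h /fineK.
have mF : measurable_fun setT F by exact: measurable_int Fi.
have mfF : measurable_fun setT (EFin \o (fun x => fine (F x))).
  by apply/measurable_EFinP; apply: measurableT_comp mF; exact: fine_measurable.
split.
- apply: le_integrable Fi => // x _ /=.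
  by case: (F x) => //= [|]; rewrite ?normr0 ?leey.
- congr fine; apply: (@ae_eq_integral _ _ _ leb) => //.
  by apply: filterS Fae => x h /h ->.
Qed.

Lemma Rfubini (f : R * R -> R) : (leb \x leb)%E.-integrable setT (EFin \o f) ->
  [/\ leb.-integrable setT (EFin \o (fun x => \int[leb]_y f (x, y))),
      leb.-integrable setT (EFin \o (fun y => \int[leb]_x f (x, y))) &
      \int[leb]_x \int[leb]_y f (x, y) = \int[leb]_y \int[leb]_x f (x, y)].
Proof.
move=> fi.
have F1 := @integrable_fubini_F _ _ _ _ R (@lebesgue_measure R) (@lebesgue_measure R) _ fi.
have mf : measurable_fun setT (EFin \o f) by exact: measurable_int fi.
have mfa : measurable_fun setT (abse \o (EFin \o f)) by exact: measurableT_comp.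
have G1 : leb.-integrable setT (fubini_G leb (EFin \o f)).
  apply/integrableP; split.
    exact: (@measurable_fubini_G _ _ _ _ R (@lebesgue_measure R) (@lebesgue_measure R) _ fi).
  apply: le_lt_trans ((@integrable21ltyP _ _ _ _ R (@lebesgue_measure R) (@lebesgue_measure R) _ mf).1 fi).
  apply: (@ge0_le_integral _ _ _ leb) => //.
  - apply: measurableT_comp => //.
    exact: (@measurable_fubini_G _ _ _ _ R (@lebesgue_measure R) (@lebesgue_measure R) _ fi).
  - apply: (@measurable_fun_fubini_tonelli_G _ _ _ _ R (@lebesgue_measure R) _ mfa).
    by move=> z; exact: abse_ge0.
  - move=> y _; apply: (@le_abse_integral _ _ _ leb) => //.
    exact: (measurableT_comp mf (pair2_measurable y)).
have FG := @Fubini _ _ _ _ R (@lebesgue_measure R) (@lebesgue_measure R) _ fi.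
have [F2 F3] := integrable_fine_cvt F1.
have [G2 G3] := integrable_fine_cvt G1.
split => //.
by rewrite -[LHS]/(\int[leb]_x fine (fubini_F leb (EFin \o f) x)) F3
  -[RHS]/(\int[leb]_y fine (fubini_G leb (EFin \o f) y)) G3; congr fine.
Qed.

End RealFubini.

(** * Representatives of H^1 paths in time *)

Section H1Paths.
Context {R : realType}.
Notation leb := (@leb R).
Notation I_ := (@I_ R).
Variables (v vdot : R -> R -> R).
Hypothesis hv : H1loc_L2 v vdot.

(** For each [t], [v t] is known up to a null set of [y] that depends on [t]; this representative
    has a meaning along a fixed [y], as a function of time. *)
Definition path_rep t y : R := v 0 y + \int[leb]_(s in `[0, t]) vdot s y.

Lemma path_rep_eqI t : 0 <= t -> eqI (v t) (path_rep t).
Proof. by move=> t0; case: hv => _ _ _; apply. Qed.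

Lemma path_L1I t : 0 <= t -> L1I (v t).
Proof. by move=> t0; apply: L2I_L1I; case: hv => h _ _ _; exact: h. Qed.

Lemma path_rep0 y : path_rep 0 y = v 0 y.
Proof. by rewrite /path_rep set_itv1 Rintegral_set1 addr0. Qed.

Let slab T := (fun x : R * R => vdot x.1 x.2) \_ (`[0, T]%classic `*` I_).

Let slab_integrable T : 0 < T -> (leb \x leb)%E.-integrable setT (EFin \o slab T).
Proof.
move=> T0; case: hv => _ m sq _.
exact: square_integrable_slab m (sq T T0).
Qed.

(** Fubini on the slabs with integer horizon gives countably many null sets, hence a single one that
    serves every [b]. *)
Lemma path_slice_integrable :
  {ae leb, forall y, I_ y -> forall b, leb.-integrable `[0, b] (EFin \o (vdot^~ y))}.
Proof.
have h : {ae leb, forall y, forall n : nat,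
    leb.-integrable setT (fun x => (EFin \o slab n.+1%:R) (x, y))}.
  apply/ae_foralln => n.
  apply: (@ae_integrable2 _ _ _ _ R (@lebesgue_measure R) (@lebesgue_measure R)).
  by apply: slab_integrable; rewrite ltr0n.
apply: filterS h => y hy Iy b.
have := hy (Num.trunc `|b|).
set N := (Num.trunc `|b|).+1%:R : R.
have bN : b <= N by rewrite (le_trans (ler_norm b))// ltW// truncnS_gt.
move=> hN.
have : leb.-integrable `[0, N] (EFin \o (vdot^~ y)).
  rewrite -(setTI `[0, N]%classic).
  apply: ((@integrable_restrict _ _ _ leb _ (measurable_itv _) _ measurableT _).2).
  rewrite restrict_EFin; apply: eq_integrable hN => // x _ /=.
  rewrite /slab !patchE; congr EFin.
  have -> : ((x, y) \in `[0, N]%classic `*` I_) = (x \in `[0, N]%classic).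
    by apply/idP/idP; rewrite !inE; [case|split].
  by [].
by apply: integrableS => //; apply: subset_itv; rewrite bnd_simp.
Qed.

Let slab1 T x : x \in `[0, T] -> \int[leb]_y slab T (x, y) = \int[leb]_(y in I_) vdot x y.
Proof.
move=> xT; rewrite [RHS]Rintegral_mkcond; apply: eq_Rintegral => y _.
rewrite /slab !patchE.
have -> // : ((x, y) \in `[0, T]%classic `*` I_) = (y \in I_).
by apply/idP/idP; rewrite !inE; [case|split].
Qed.

Let slab2 T y : I_ y -> \int[leb]_x slab T (x, y) = \int[leb]_(x in `[0, T]) vdot x y.
Proof.
move=> Iy; rewrite [RHS]Rintegral_mkcond; apply: eq_Rintegral => x _.
rewrite /slab !patchE.
have -> // : ((x, y) \in `[0, T]%classic `*` I_) = (x \in `[0, T]%classic).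
by apply/idP/idP; rewrite !inE; [case|split].
Qed.

Let mean_integrable b : leb.-integrable `[0, b] (EFin \o (fun s => \int[leb]_(y in I_) vdot s y)).
Proof.
pose T := Num.max b 1.
have T0 : 0 < T by rewrite lt_max ltr01 orbT.
have bT : b <= T by rewrite le_max lexx.
have [h _ _] := Rfubini (slab_integrable T0).
suff : leb.-integrable `[0, T] (EFin \o (fun s => \int[leb]_(y in I_) vdot s y)).
  by apply: integrableS => //; apply: subset_itv; rewrite bnd_simp.
have : leb.-integrable `[0, T] (EFin \o (fun x => \int[leb]_y slab T (x, y))).
  by apply: integrableS h.
by apply: eq_integrable => // s /[!inE] sT /=; rewrite slab1.
Qed.

(** By Fubini the mean is a constant plus the primitive of the mean velocity. Applied to the plastic
    strain, it makes the stress a continuous function of time. *)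
Lemma path_mean : exists2 q : R -> R, continuous q &
  forall t, 0 <= t -> q t = \int[leb]_(y in I_) v t y.
Proof.
pose h s := \int[leb]_(y in I_) vdot s y.
exists (fun t => \int[leb]_(y in I_) v 0 y + \int[leb]_(s in `[0, t]) h s).
  move=> t; apply: cvgD; first exact: cvg_cst.
  exact: continuous_primitive mean_integrable _.
move=> t; rewrite le_eqVlt => /predU1P[<-|t0].
  by rewrite set_itv1 Rintegral_set1 addr0.
have [h1 h2 h3] := Rfubini (slab_integrable t0).
have gi : L1I (fun y => \int[leb]_x slab t (x, y)) by apply: integrableS h2.
rewrite (@ae_eq_Rintegral _ _ _ leb _ measurable_I_ (v t) (fun y => v 0 y + \int[leb]_x slab t (x, y))).
- rewrite RintegralD//; last exact: path_L1I.
  congr (_ + _).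
  transitivity (\int[leb]_y \int[leb]_x slab t (x, y)); last first.
    rewrite [RHS]Rintegral_mkcond; apply: eq_Rintegral => y _; rewrite patchE.
    case: ifPn => // /negP yI; apply: Rintegral0_eq => x.
    by rewrite /slab patchE; case: ifPn => //; rewrite inE => -[_ /= Iy]; case: yI; rewrite inE.
  rewrite -h3 [LHS]Rintegral_mkcond; apply: eq_Rintegral => x _; rewrite patchE.
  case: ifPn => [xt|/negP xt]; first by rewrite slab1// -in_setE.
  apply/esym/Rintegral0_eq => y.
  by rewrite /slab patchE; case: ifPn => //; rewrite inE => -[/= xt' _]; case: xt; rewrite inE.
- exact: path_L1I (ltW t0).
- by apply: intgD => //; exact: path_L1I.
- apply: filterS (path_rep_eqI (ltW t0)) => y hy Iy.
  by rewrite hy// slab2.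
Qed.

End H1Paths.

(** * The force -V' *)

Section DrivingForce.
Context {R : realType}.
Variables (V : R -> R) (M : R).
Hypothesis hV1 : forall x, derivable V x 1.
Hypothesis hV2 : forall x, derivable (derive1 V) x 1.
Hypothesis hV2b : forall x, - M <= derive1 (derive1 V) x <= 0.
Hypothesis hVeven : forall x, V x = V (- x).
Hypothesis hVlin : forall x, derive1 V x = -1 <-> 1 <= x.

Definition force (x : R) : R := - derive1 V x.

Lemma is_derive_potential (x : R) : is_derive x 1 V (- force x).
Proof.
have h := (derivableP (@hV1 x)).
by apply: (is_derive_eq h); rewrite /force opprK derive1E.
Qed.

Lemma is_derive_dpotential (x : R) : is_derive x 1 (derive1 V) (derive1 (derive1 V) x).
Proof. by have h := (derivableP (@hV2 x)); apply: (is_derive_eq h); rewrite derive1E. Qed.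

Lemma continuous_dpotential : continuous (derive1 V).
Proof.
by move=> x; apply: differentiable_continuous; apply/derivable1_diffP; exact: hV2.
Qed.

Lemma continuous_potential : continuous V.
Proof.
by move=> x; apply: differentiable_continuous; apply/derivable1_diffP; exact: hV1.
Qed.

Lemma continuous_force : continuous force.
Proof. by move=> x; apply: cvgN; exact: continuous_dpotential. Qed.

Lemma force_increment x y : x <= y -> 0 <= force y - force x <= M * (y - x).
Proof.
move=> xy; rewrite /force.
have h1 : derive1 V y - derive1 V x <= 0 * (y - x).
  apply: (derive_le_increment xy continuous_dpotential (df := derive1 (derive1 V))).
  - by move=> z _; exact: is_derive_dpotential.
  - by move=> z _; have /andP[] := hV2b z.
have h2 : - M * (y - x) <= derive1 V y - derive1 V x.
  apply: (derive_ge_increment xy continuous_dpotential (df := derive1 (derive1 V))).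
  - by move=> z _; exact: is_derive_dpotential.
  - by move=> z _; have /andP[] := hV2b z.
by lra.
Qed.

Lemma force_homo x y : x <= y -> force x <= force y.
Proof. by move=> /force_increment; lra. Qed.

Lemma force_lip x y : `|force x - force y| <= M * `|x - y|.
Proof.
wlog xy : x y / x <= y.
  move=> h; have [|/ltW] := leP x y; first exact: h.
  by rewrite distrC (distrC x); exact: h.
rewrite !ler0_norm ?subr_le0// ?force_homo//.
by have := force_increment xy; lra.
Qed.

Lemma forceN x : force (- x) = - force x.
Proof.
have d1 : is_derive x 1 (fun y : R => - y) (-1).
  exact: (is_deriveN (is_derive_id x 1)).
have d2 := @is_derive1_comp R V (fun y => - y) x _ _ (is_derive_potential (- x)) d1.
have VE : V \o (fun y => - y) = V by apply/funext => y /=; rewrite -hVeven.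
rewrite VE in d2.
have e1 := @derive_val _ _ _ _ _ _ _ d2.
have e2 := @derive_val _ _ _ _ _ _ _ (is_derive_potential x).
by rewrite e2 in e1; lra.
Qed.

Lemma force1 x : force x = 1 <-> 1 <= x.
Proof. by rewrite -hVlin /force; split => h; lra. Qed.

Lemma force_le1 x : force x <= 1.
Proof.
have [/ltW x1|x1] := ltP x 1; last by rewrite (force1 x).2.
by rewrite -(force1 1).2 ?lexx// force_homo.
Qed.

Lemma force_geN1 x : -1 <= force x.
Proof. by have := force_le1 (- x); rewrite forceN; lra. Qed.

Lemma force_lt1 x : x < 1 -> force x < 1.
Proof.
move=> x1; rewrite lt_neqAle force_le1 andbT; apply/eqP => /force1.
by rewrite leNgt x1.
Qed.

End DrivingForce.

(** * Trajectories of the flow rule at a point *)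

Section FlowSolution.
Context {R : realType}.
Notation leb := (@leb R).
Notation I_ := (@I_ R).

(** The flow rule at one point of I, with [s] treated as a given function of time and the
    derivatives classical at every positive time. *)
Definition flow_sol (g : R -> R) (eps : R) (s P Z : R -> R) : Prop :=
  [/\ continuous P, continuous Z, P 0 = 0,
    forall t : R, 0 < t -> is_derive t 1 P (rate1 eps (s t) (g (Z t))) &
    forall t : R, 0 < t -> is_derive t 1 Z (rate2 eps (s t) (g (Z t)))].

Lemma continuous_excess : continuous (@excess R).
Proof.
move=> x; apply: cvgD.
  apply: (@continuous_max R R (fun x => x - 2) (fun=> 0)); last exact: cvg_cst.
  by apply: cvgB; [exact: cvg_id|exact: cvg_cst].
apply: (@continuous_min R R (fun x => x + 2) (fun=> 0)); last exact: cvg_cst.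
by apply: cvgD; [exact: cvg_id|exact: cvg_cst].
Qed.

Lemma continuous_rate1 eps (a b : R -> R) : continuous a -> continuous b ->
  continuous (fun t => rate1 eps (a t) (b t)).
Proof.
move=> ca cb t; apply: cvgMl; apply: cvgD.
  apply: (@continuous_comp _ _ _ (fun t => a t + b t) excess).
    by apply: cvgD; [exact: ca|exact: cb].
  exact: continuous_excess.
apply: (@continuous_comp _ _ _ (fun t => a t - b t) excess).
  by apply: cvgB; [exact: ca|exact: cb].
exact: continuous_excess.
Qed.

Lemma continuous_rate2 eps (a b : R -> R) : continuous a -> continuous b ->
  continuous (fun t => rate2 eps (a t) (b t)).
Proof.
move=> ca cb t; apply: cvgMl; apply: cvgB.
  apply: (@continuous_comp _ _ _ (fun t => a t + b t) excess).
    by apply: cvgD; [exact: ca|exact: cb].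
  exact: continuous_excess.
apply: (@continuous_comp _ _ _ (fun t => a t - b t) excess).
  by apply: cvgB; [exact: ca|exact: cb].
exact: continuous_excess.
Qed.

Lemma measurable_rate1 d (T : measurableType d) (D : set T) eps (a b : T -> R) :
  measurable_fun D a -> measurable_fun D b ->
  measurable_fun D (fun t => rate1 eps (a t) (b t)).
Proof.
move=> ma mb.
have me : measurable_fun setT (@excess R) by apply: continuous_measurable_fun; exact: continuous_excess.
apply: measurable_funM => //; apply: measurable_funD.
  by apply: measurableT_comp => //; exact: measurable_funD.
by apply: measurableT_comp => //; exact: measurable_funB.
Qed.

Lemma measurable_rate2 d (T : measurableType d) (D : set T) eps (a b : T -> R) :
  measurable_fun D a -> measurable_fun D b ->
  measurable_fun D (fun t => rate2 eps (a t) (b t)).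
Proof.
move=> ma mb.
have me : measurable_fun setT (@excess R) by apply: continuous_measurable_fun; exact: continuous_excess.
apply: measurable_funM => //; apply: measurable_funB.
  by apply: measurableT_comp => //; exact: measurable_funD.
by apply: measurableT_comp => //; exact: measurable_funB.
Qed.

Lemma primI_eqI (f g : R -> R) y : L1I f -> L1I g -> eqI f g -> primI f y = primI g y.
Proof.
move=> fi gi fg; apply: (@ae_eq_Rintegral _ _ _ leb).
- exact: measurable_itv.
- by apply: integrableS (L1I_restrict fi).
- by apply: integrableS (L1I_restrict gi).
- apply: filterS fg => x h _; rewrite !patchE; case: ifPn => //.
  by rewrite inE => /h.
Qed.

Lemma measurable_path_rep (v vdot : R -> R -> R) : H1loc_L2 v vdot ->
  measurable_fun (halfline `*` I_) (fun x : R * R => path_rep v vdot x.1 x.2).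
Proof.
move=> hv; have [L m _ _] := hv.
apply: measurable_funD; last exact: measurable_time_primitive.
have m0 : measurable_fun I_ (v 0) by have [] := L 0 (lexx _).
have mr : measurable_fun setT (v 0 \_ I_).
  by apply/(measurable_restrictT _ measurable_I_).
apply: (eq_measurable_fun (fun x : R * R => (v 0 \_ I_) x.2)).
  by move=> x /[!inE] -[_ Ix]; rewrite patchE mem_set.
exact: (measurable_funTS (measurableT_comp mr measurable_snd)).
Qed.

Lemma L1I_path_rep (v vdot : R -> R -> R) t : H1loc_L2 v vdot -> 0 <= t ->
  L1I (path_rep v vdot t).
Proof.
move=> hv t0; have h := path_rep_eqI hv t0.
apply: (@intg_ae_eq _ _ _ leb _ measurable_I_ _ _ (path_L1I hv t0) _ h).
have := measurable_path_rep hv.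
move=> m; apply: (@measurable_comp _ _ _ _ _ _ (halfline `*` I_) _ I_ (pair t) measurable_halfline_I _ m).
  by move=> _ [y Iy <-]; split => //=; rewrite /halfline/= in_itv/= t0.
exact: measurable_funTS.
Qed.

Lemma continuous_path_slice (v vdot : R -> R -> R) y :
  (forall b, leb.-integrable `[0, b] (EFin \o (vdot^~ y))) ->
  continuous (fun t => path_rep v vdot t y).
Proof.
move=> hi t; apply: cvgD; first exact: cvg_cst.
exact: continuous_primitive hi t.
Qed.

Lemma continuous_itv_integrable (f : R -> R) a b : continuous f ->
  leb.-integrable `[a, b] (EFin \o f).
Proof.
move=> cf; apply: continuous_compact_integrable; first exact: segment_compact.
exact: continuous_subspaceT.
Qed.

(** Replacing [vdot] by the continuous [f] under the integral does not change the primitive, so the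
    derivative exists at every positive time and not merely at almost every one. *)
Lemma path_slice_derive (v vdot : R -> R -> R) y (f : R -> R) :
  (forall b, leb.-integrable `[0, b] (EFin \o (vdot^~ y))) ->
  continuous f -> {ae leb, forall t, 0 <= t -> vdot t y = f t} ->
  forall t : R, 0 < t -> is_derive t 1 (fun t => path_rep v vdot t y) (f t).
Proof.
move=> hi cf hf t t0.
have -> : (fun t => path_rep v vdot t y) = (cst (v 0 y) + (fun t => \int[leb]_(s in `[0, t]) f s)).
  apply/funext => b; congr (_ + _).
  apply: (@ae_eq_Rintegral _ _ _ leb) => //.
    exact: continuous_itv_integrable.
  by apply: filterS hf => s hs; rewrite /= in_itv/= => /andP[/hs].
apply: (is_derive_eq (is_deriveD (is_derive_cst _ _ _) (is_derive_primitive _ t0 (cf t)))).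
  by move=> b; exact: continuous_itv_integrable.
exact: add0r.
Qed.

End FlowSolution.

(** * From the regularized problem to trajectories *)

Section Regularized.
Context {R : realType}.
Notation leb := (@leb R).
Notation I_ := (@I_ R).

(* The solution is pinned down by pointwise representatives: the stress is a
   function s of time only, and almost every y carries a C^1 trajectory. *)
Definition pointwise_solution (V z0 : R -> R) (eps : R)
    (u e p z : R -> R -> R) (s : R -> R) (P Z : R -> R -> R) : Prop :=
  [/\ continuous s, s 0 = 0,
      forall t, 0 <= t -> [/\ eqI (e t) (fun=> s t), eqI (p t) (P t), eqI (z t) (Z t),
        L1I (P t) & L1I (Z t)] &
      forall t, 0 <= t -> s t = t - \int[leb]_(y in I_) P t y] /\
  (forall t, 0 <= t -> eqI (u t) (fun y => - (t / 2) + primI (fun x => s t + P t x) y)) /\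
  {ae leb, forall y, I_ y -> Z 0 y = z0 y /\ flow_sol (force V) eps s (P^~ y) (Z^~ y)}.

Lemma regularized_pointwise (V z0 : R -> R) (eps : R) (u e p z : R -> R -> R) :
  continuous (force V) -> 0 < eps ->
  regularized_solution V (fun t y => t * y) (fun=> 0) (fun=> 0) (fun=> 0) z0 eps u e p z ->
  exists s P Z, pointwise_solution V z0 eps u e p z s P Z.
Proof.
move=> cF eps0 [[udot [Du [Dudot [hu hDu hDuw]]]]].
move=> [edot [pdot [zdot [[he hp hz] [[u0E e0E p0E z0E] [uw ub ew flow]]]]]].
have [q cq qE] := path_mean hp.
pose s t := t - q t.
pose P := path_rep p pdot; pose Z := path_rep z zdot.
have cs : continuous s by move=> t; apply: cvgB; [exact: cvg_id|exact: cq].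
have PL t : 0 <= t -> L1I (P t) by move=> t0; exact: L1I_path_rep.
have ZL t : 0 <= t -> L1I (Z t) by move=> t0; exact: L1I_path_rep.
have pP t : 0 <= t -> eqI (p t) (P t) by move=> t0; exact: path_rep_eqI.
have zZ t : 0 <= t -> eqI (z t) (Z t) by move=> t0; exact: path_rep_eqI.
have qP t : 0 <= t -> q t = \int[leb]_(y in I_) P t y.
  move=> t0; rewrite qE//; apply: (@ae_eq_Rintegral _ _ _ leb) => //.
  - exact: path_L1I hp _ t0.
  - exact: PL.
  - exact: pP.
have q0 : q 0 = 0.
  rewrite qE// (@ae_eq_Rintegral _ _ _ leb _ measurable_I_ _ (fun=> 0) _ (L1I_cst 0) p0E).
    by rewrite Rint_I_cst.
  exact: path_L1I hp _ (lexx _).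
have epL t : 0 <= t -> L1I (fun y => e t y + p t y).
  by move=> t0; apply: intgD => //; [exact: path_L1I he _ t0|exact: path_L1I hp _ t0].
have eu t : 0 < t -> eqI (e t) (fun=> s t) /\
    eqI (u t) (fun y => - (t / 2) + primI (fun x => e t x + p t x) y).
  move=> t0; have t0' := ltW t0.
  have [c ec] := weak_deriv0_cst (path_L1I he t0') (ew t t0).
  have [uE intE] := weak_deriv_boundary (path_L1I hu t0') (epL t t0') (uw t t0) (ub t t0).
  (* Compatibility: the boundary values [- (t / 2)] and [t / 2] force the total strain to have
     integral [t]. *)
  have cst : c + q t = t.
    move: intE; rewrite RintegralD//; [|exact: path_L1I he _ t0'|exact: path_L1I hp _ t0'].
    rewrite -qE// (@ae_eq_Rintegral _ _ _ leb _ measurable_I_ _ (fun=> c) _ (L1I_cst c) ec).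
      by rewrite Rint_I_cst => ->; lra.
    exact: path_L1I he _ t0'.
  have -> : s t = c by rewrite /s; lra.
  by split => //; rewrite -mulrN.
(* The equations are imposed for [t > 0] only; at [t = 0] the zero initial data give the same
   conclusion. *)
have eE t : 0 <= t -> eqI (e t) (fun=> s t).
  rewrite le_eqVlt => /predU1P[<-|/eu[]//].
  by rewrite /s q0 subrr.
have uE t : 0 <= t -> eqI (u t) (fun y => - (t / 2) + primI (fun x => s t + P t x) y).
  move=> t0.
  have sPL : L1I (fun x => s t + P t x) by apply: intgD => //; [exact: L1I_cst|exact: PL].
  move: (t0); rewrite le_eqVlt => /predU1P[<-|t0'].
  - have h0 : L1I (fun x => s 0 + P 0 x) by apply: intgD => //; [exact: L1I_cst|exact: PL].
    apply: filterS u0E => y hy Iy; rewrite hy//.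
    rewrite (@primI_eqI _ _ (fun=> 0) _ h0 (L1I_cst 0)).
      rewrite mul0r oppr0 add0r /primI Rintegral0_eq// => x.
      by rewrite patchE; case: ifP.
    by apply: filterS p0E => x hx Ix; rewrite /s q0 subrr add0r /P path_rep0 hx.
  - have [_ h] := eu t t0'; apply: eqI_trans h _; apply: aeW => y _.
    congr (_ + _); apply: primI_eqI => //; first exact: epL.
    by apply: filterS2 (eE t t0) (pP t t0) => x h1 h2 Ix; rewrite h1// h2.
exists s, P, Z; split; last split => //.
  by split => //; [rewrite /s q0 subrr|move=> t t0; split; auto|move=> t t0; rewrite /s qP].
pose m1 (x : R * R) := rate1 eps (s x.1) (force V (Z x.1 x.2)).
pose m2 (x : R * R) := rate2 eps (s x.1) (force V (Z x.1 x.2)).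
pose D := halfline `*` I_ : set (R * R).
have mD : measurable D := measurable_halfline_I.
have mS : measurable_fun D (fun x : R * R => s x.1).
  apply: measurable_funTS; apply: (measurableT_comp _ measurable_fst).
  exact: continuous_measurable_fun.
have mG : measurable_fun D (fun x : R * R => force V (Z x.1 x.2)).
  apply: (measurableT_comp (continuous_measurable_fun cF)).
  exact: measurable_path_rep hz.
have mm1 : measurable_fun D m1 by exact: measurable_rate1.
have mm2 : measurable_fun D m2 by exact: measurable_rate2.
(* [df] vanishes exactly where both flow equations hold for the chosen representatives. The set [B]
   where it does not has null slices at almost every time, hence at almost every point. *)
pose df (x : R * R) := `|pdot x.1 x.2 - m1 x| + `|zdot x.1 x.2 - m2 x|.
have mdf : measurable_fun D df.
  have [_ mp _ _] := hp; have [_ mz _ _] := hz.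
  apply: measurable_funD.
    by apply: measurableT_comp => //; exact: measurable_funB.
  by apply: measurableT_comp => //; exact: measurable_funB.
pose B := D `&` df @^-1` (~` [set 0]).
have mB : measurable B.
  by apply: mdf => //; apply: measurableC; exact: measurable_set1.
have Bt : {ae leb, forall t, leb (xsection B t) = 0%E}.
  apply: filterS2 flow (leb_ae_neq 0) => t ft tn0.
  have [t0|t0] := leP t 0.
    rewrite (_ : xsection B t = set0); first exact: measure0.
    apply/seteqP; split => // y; rewrite xsectionP => -[[/=]].
    rewrite /halfline/= in_itv/= andbT => t1.
    by exfalso; apply: tn0; apply/eqP; rewrite eq_le t0.
  apply: (@measure_negligible _ _ _ (@lebesgue_measure R)); first exact: measurable_xsection.
  suff h : {ae leb, forall y, ~ xsection B t y}.
    by move: h; apply: negligibleS => y yB /=; apply.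
  move: (ft t0) (eE t (ltW t0)) (zZ t (ltW t0)).
  apply: filterS3 => y f1 f2 f3; rewrite xsectionP => -[[/= _ Iy]]; apply.
  have := f1 Iy; rewrite f2// f3// NKRE ?gt_eqF//= => -[e1 e2].
  by rewrite /df/= /m1 /m2/= e1 e2 !subrr normr0 addr0.
have By := ae_fubini_swap mB Bt.
have slp := path_slice_integrable hp; have slz := path_slice_integrable hz.
have all5 : {ae leb, forall y, I_ y ->
   [/\ leb (ysection B y) = 0%E,
       (forall b, leb.-integrable `[0, b] (EFin \o (pdot^~ y))) &
       (forall b, leb.-integrable `[0, b] (EFin \o (zdot^~ y)))]}.
  by move: By slp slz; apply: filterS3 => y h1 h2 h3 Iy; split; auto.
move: all5 p0E z0E; apply: filterS3 => y h hp0 hz0 Iy.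
have [B0 ip iz] := h Iy.
split; first by rewrite /Z path_rep0 hz0.
have cZ : continuous (Z^~ y) by exact: continuous_path_slice.
have cFZ : continuous (fun t => force V (Z t y)).
  by move=> t; apply: (@continuous_comp _ _ _ (Z^~ y) (force V)); [exact: cZ|exact: cF].
have aeB : {ae leb, forall t, 0 <= t -> pdot t y = m1 (t, y) /\ zdot t y = m2 (t, y)}.
  exists (ysection B y); split => //; first exact: measurable_ysection.
  move=> t /= /not_implyP[t0 hn]; rewrite ysectionP; split => /=.
    by split => //=; rewrite /halfline/= in_itv/= t0.
  move=> df0; apply: hn; move/eqP: df0; rewrite /df/=.
  by rewrite paddr_eq0// !normr_eq0 !subr_eq0 => /andP[/eqP -> /eqP ->].
split.
- exact: continuous_path_slice.
- exact: cZ.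
- by rewrite /P path_rep0 hp0.
- have a1 : {ae leb, forall t, 0 <= t -> pdot t y = rate1 eps (s t) (force V (Z t y))}.
    by apply: filterS aeB => t ht /ht[].
  exact: (@path_slice_derive _ p pdot y _ ip (continuous_rate1 cs cFZ) a1).
- have a2 : {ae leb, forall t, 0 <= t -> zdot t y = rate2 eps (s t) (force V (Z t y))}.
    by apply: filterS aeB => t ht /ht[].
  exact: (@path_slice_derive _ z zdot y _ iz (continuous_rate2 cs cFZ) a2).
Qed.

End Regularized.

(** * Qualitative behaviour of a single trajectory *)

Section ScalarFlow.
Context {R : realType}.
Implicit Types (eps M zeta : R).

Definition driving (g : R -> R) M : Prop :=
  [/\ forall x y, `|g x - g y| <= M * `|x - y|, forall x, g (- x) = - g x,
      {homo g : x y / x <= y} & forall x, -1 <= g x <= 1].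

Lemma rate1_ge0 eps a zeta : 0 < eps -> 0 <= a -> -1 <= zeta <= 1 ->
  0 <= rate1 eps a zeta.
Proof.
move=> e0 a0 h; apply: divr_ge0; last by lra.
have h1 : excess (-1) = 0 :> R by apply: excess_mid; lra.
have h2 : excess (-1) <= excess (a + zeta) by apply: excess_homo; lra.
have h3 : excess (-1) <= excess (a - zeta) by apply: excess_homo; lra.
by lra.
Qed.

Lemma rate1_le0 eps a zeta : 0 < eps -> a <= 1 -> -1 <= zeta <= 1 ->
  rate1 eps a zeta <= 0.
Proof.
move=> e0 a1 h; rewrite /rate1 -oppr_ge0 -mulNr; apply: divr_ge0; last by lra.
have h1 : excess 2 = 0 :> R by apply: excess_mid; lra.
have h2 : excess (a + zeta) <= excess 2 by apply: excess_homo; lra.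
have h3 : excess (a - zeta) <= excess 2 by apply: excess_homo; lra.
by lra.
Qed.

Lemma rate1N eps a zeta : rate1 eps a (- zeta) = rate1 eps a zeta.
Proof. by rewrite /rate1 opprK [in LHS]addrC. Qed.

Lemma rate2N eps a zeta : rate2 eps a (- zeta) = - rate2 eps a zeta.
Proof. by rewrite /rate2 opprK -mulNr opprB. Qed.

Lemma rate2_lip eps a zeta zeta' : 0 < eps ->
  `|rate2 eps a zeta - rate2 eps a zeta'| <= eps^-1 * `|zeta - zeta'|.
Proof.
move=> e0; rewrite /rate2 -mulrBl normrM mulrC.
have -> : `|(2 * eps)^-1| = eps^-1 / 2 by rewrite invfM mulrC ger0_norm// divr_ge0// invr_ge0 ltW.
rewrite -mulrA ler_pM2l ?invr_gt0// mulrC ler_pdivrMr//.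
have h1 := excess_lip (a + zeta) (a + zeta'); have h2 := excess_lip (a - zeta) (a - zeta').
have e1 : a + zeta - (a + zeta') = zeta - zeta' by ring.
have e2 : a - zeta - (a - zeta') = - (zeta - zeta') by ring.
rewrite e1 in h1; rewrite e2 normrN in h2.
have -> : excess (a + zeta) - excess (a - zeta) - (excess (a + zeta') - excess (a - zeta')) =
   excess (a + zeta) - excess (a + zeta') - (excess (a - zeta) - excess (a - zeta')) by ring.
by apply: (le_trans (ler_normB _ _)); lra.
Qed.

(** [a + zeta] and [a - zeta] stay in [[-2, 2]] because [(1 + d) + (1 - d) = 2]: the force does not
    leave the elastic domain. *)
Lemma rates_stuck eps a zeta d : 0 <= a -> a <= 1 + d -> d < 1 -> `|zeta| <= 1 - d ->
  0 <= d -> rate1 eps a zeta = 0 /\ rate2 eps a zeta = 0.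
Proof.
rewrite ler_norml => a0 a1 d1 h d0; rewrite /rate1 /rate2 !excess_mid ?addr0 ?subr0 ?mul0r//; lra.
Qed.

(** [a - zeta] lies in [[-1, 2]], so only [a + zeta] can yield, and it drives both variables alike.
    This is the source of the relation [z = z0 + p]. *)
Lemma rates_eq eps a zeta : 0 <= a <= 2 -> 0 <= zeta <= 1 ->
  rate1 eps a zeta = rate2 eps a zeta.
Proof.
by move=> h1 h2; rewrite /rate1 /rate2 [excess (a - zeta)]excess_mid ?addr0 ?subr0//; lra.
Qed.

(** By parity [zeta] may be taken nonnegative; then [a + zeta >= 2 + 3 d / 4] contributes at least
    [3 d / 4], while [a - zeta >= 0] contributes nothing negative. *)
Lemma rate1_overloaded eps a zeta d : 0 < eps -> 0 < d < 1 -> 1 + d <= a ->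
  1 - d / 4 <= `|zeta| -> `|zeta| <= 1 -> 3 * d / (8 * eps) <= rate1 eps a zeta.
Proof.
move=> e0 d01 a1 h1 h2.
have pos : forall z : R, 1 - d / 4 <= z -> z <= 1 -> 3 * d / (8 * eps) <= rate1 eps a z.
  move=> z z1 z2; rewrite /rate1.
  have -> : 3 * d / (8 * eps) = (3 * d / 4) / (2 * eps) by field; lra.
  rewrite ler_pM2r ?invr_gt0; last lra.
  have k1 : excess (2 + 3 * d / 4) <= excess (a + z) by apply: excess_homo; lra.
  have k2 : excess 0 <= excess (a - z) by apply: excess_homo; lra.
  have k3 : excess 0 = 0 :> R by apply: excess_mid; lra.
  have k4 : excess (2 + 3 * d / 4) = 3 * d / 4.
    by have [] := excess_cases (2 + 3 * d / 4) => -[? ->]; lra.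
  by lra.
move: h1 h2; have [z0|z0] := ger0P zeta => h1 h2.
  exact: pos.
by rewrite -rate1N; exact: pos.
Qed.

Variables (g : R -> R) (M eps : R) (s P Z : R -> R).
Hypotheses (hg : driving g M) (e0 : 0 < eps) (hf : flow_sol g eps s P Z).

Let gb x : -1 <= g x <= 1. Proof. by case: hg. Qed.

Lemma driving0 : g 0 = 0.
Proof. by case: hg => _ gN _ _; have := gN 0; rewrite oppr0; lra. Qed.

Lemma driving_norm x : g `|x| = `|g x|.
Proof.
case: hg => _ gN gh _; have g0 := driving0.
have [x0|x0] := ger0P x.
  by rewrite ger0_norm// -g0 gh.
rewrite gN ler0_norm// -[X in _ <= X]g0; apply: gh; exact: ltW.
Qed.

Lemma flow_plastic_nonincr a b : 0 <= a -> a <= b ->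
  (forall r, a < r < b -> s r <= 1) -> P b - P a <= 0.
Proof.
case: hf => cP _ _ dP _ a0 ab sr; rewrite -(mul0r (b - a)).
apply: (derive_le_increment ab cP) => x /andP[ax xb].
  by apply: dP; exact: le_lt_trans a0 ax.
by apply: rate1_le0 => //; apply: sr; rewrite ax.
Qed.

Lemma flow_plastic_increment c a b : 0 <= a -> a <= b ->
  (forall r, a < r < b -> c <= rate1 eps (s r) (g (Z r))) -> c * (b - a) <= P b - P a.
Proof.
case: hf => cP _ _ dP _ a0 ab sr.
apply: (derive_ge_increment ab cP) => x /andP[ax xb].
  by apply: dP; exact: le_lt_trans a0 ax.
by apply: sr; rewrite ax.
Qed.

Hypothesis s0 : forall t, 0 <= t -> 0 <= s t.

Lemma flow_plastic_homo a b : 0 <= a -> a <= b -> P a <= P b.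
Proof.
move=> a0 ab; rewrite -subr_ge0 -(mul0r (b - a)).
apply: flow_plastic_increment => // r /andP[ar _].
by apply: rate1_ge0 => //; apply: s0; rewrite (le_trans a0)// ltW.
Qed.

Lemma flow_plastic_ge0 t : 0 <= t -> 0 <= P t.
Proof. by move=> t0; have := flow_plastic_homo (lexx 0) t0; case: hf => _ _ ->. Qed.

(** The speed [rate2] never opposes the sign of [g (Z t)], hence not that of [Z t], so [Z ^ 2] does
    not decrease. A force that starts close to 1 in absolute value therefore remains so. *)
Lemma flow_internal_expands t : 0 <= t -> `|Z 0| <= `|Z t|.
Proof.
case: hf => _ cZ _ _ dZ t0.
rewrite -ler_sqr ?nnegrE// !real_normK ?num_real// -subr_ge0.
suff : 0 * (t - 0) <= Z t ^+ 2 - Z 0 ^+ 2 by rewrite mul0r.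
have c2 : continuous (fun t => Z t ^+ 2).
  by move=> x; apply: cvgM; exact: cZ.
apply: (@derive_ge_increment R (fun t => Z t ^+ 2)
  (fun r => 2 * (Z r * rate2 eps (s r) (g (Z r)))) 0 t 0 t0 c2) => x /andP[x0 _].
  apply: (is_derive_eq (is_deriveM (dZ _ x0) (dZ _ x0))).
  by rewrite /GRing.scale/=; ring.
rewrite mulr_ge0// /rate2 mulrA; apply: divr_ge0; last by rewrite mulr_ge0// ltW.
case: hg => _ gN gh _; have g0 := driving0.
have [Z0|/ltW Z0] := leP 0 (Z x).
  rewrite mulr_ge0// subr_ge0 excess_homo//.
  by have := gh _ _ Z0; rewrite g0; lra.
rewrite mulr_le0// subr_le0 excess_homo//.
by have := gh _ _ Z0; rewrite g0; lra.
Qed.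

(** At the force [g (Z 0)] both rates vanish for every admissible stress, so the constant trajectory
    solves the same equation and uniqueness applies. *)
Lemma flow_stuck d : 0 <= d < 1 -> (forall t, 0 <= t -> s t <= 1 + d) ->
  `|g (Z 0)| <= 1 - d -> forall t, 0 <= t -> P t = 0 /\ Z t = Z 0.
Proof.
move=> d01 s1 gZ0.
have [cP cZ P0 dP dZ] := hf; have [glip _ _ _] := hg.
have stuck t : 0 <= t -> rate1 eps (s t) (g (Z 0)) = 0 /\ rate2 eps (s t) (g (Z 0)) = 0.
  by move=> t0; apply: (@rates_stuck _ _ _ d) => //; [exact: s0|exact: s1|lra|lra].
have Zc t : 0 <= t -> Z t = Z 0.
  apply: (@ode_unique _ (eps^-1 * M) Z (fun=> Z 0) _ (fun t => rate2 eps (s t) (g (Z 0))) cZ _ _ dZ) => //.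
  - by move=> x; exact: cvg_cst.
  - move=> r r0; have [_ ->] := stuck r (ltW r0); exact: is_derive_cst.
  - move=> r r0; apply: le_trans (rate2_lip _ _ _ e0) _.
    by rewrite -mulrA; apply: ler_wpM2l; [rewrite invr_ge0 ltW|exact: glip].
move=> t t0; split; last exact: Zc.
apply: (@ode_unique _ 0 P (fun=> 0) _ (fun=> 0) cP _ _ dP) => //.
- by move=> x; exact: cvg_cst.
- move=> r r0; rewrite Zc ?(ltW r0)//; have [-> _] := stuck r (ltW r0).
  by rewrite subrr normr0 mul0r.
Qed.

(** If [Z 0 = 0] the force is 0 and nothing moves. If [Z 0 > 0], a zero of [Z] is excluded since
    [|Z|] stays above [|Z 0|]; the force is then in [[0, 1]], and the two rates are equal. *)
Lemma flow_internal d : 0 <= d < 1 -> (forall t, 0 <= t -> s t <= 1 + d) ->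
  0 <= Z 0 -> forall t, 0 <= t -> Z t = Z 0 + P t.
Proof.
move=> d01 s1; have [cP cZ P0 dP dZ] := hf.
rewrite le_eqVlt => /predU1P[Z0|Z0] t t0.
  have [|-> ->] := flow_stuck d01 s1 _ t0; first by rewrite -Z0 driving0 normr0; lra.
  by rewrite addr0.
have Zpos r : 0 <= r -> 0 < Z r.
  move=> r0; rewrite ltNge; apply/negP => Zr.
  have cw : {within `[0, r], continuous Z} by exact: continuous_subspaceT.
  have [|c] := @IVT R Z 0 r 0 r0 cw.
    by rewrite ge_min le_max Zr (ltW Z0) orbT.
  rewrite in_itv/= => /andP[c0 _] Zc.
  have := flow_internal_expands c0; rewrite Zc normr0 normr_le0 => /eqP ZZ.
  by rewrite ZZ ltxx in Z0.
apply: (@ode_unique _ 0 Z (fun t => Z 0 + P t) _ (fun t => rate1 eps (s t) (g (Z t))) cZ _ _ dZ) => //.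
- by move=> x; apply: cvgD; [exact: cvg_cst|exact: cP].
- by rewrite P0 addr0.
- move=> r r0.
  apply: (is_derive_eq (is_deriveD (is_derive_cst (Z 0) r 1) (dP r r0))).
  exact: add0r.
- move=> r r0; rewrite rates_eq ?subrr ?normr0 ?mul0r//.
    by have := s0 (ltW r0); have := s1 _ (ltW r0); lra.
  case: hg => _ _ gh _; have := gh _ _ (ltW (Zpos r (ltW r0))); rewrite driving0.
  by have := gb (Z r); lra.
Qed.

End ScalarFlow.

(** * Symmetry of trajectories under change of sign *)

Section ReflectedFlow.
Context {R : realType}.

(** [rate1] is even and [rate2] odd in the force, and [g] is odd: [- Z] solves the equation of [Z'],
    and uniqueness identifies them. With an odd initial datum this makes the plastic strain even in
    [y]. *)
Lemma flow_reflect (g : R -> R) M eps s P Z P' Z' : driving g M -> 0 < eps ->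
  flow_sol g eps s P Z -> flow_sol g eps s P' Z' -> Z' 0 = - Z 0 ->
  forall t, 0 <= t -> Z' t = - Z t /\ P' t = P t.
Proof.
move=> [glip gN _ _] e0 [cP cZ P0 dP dZ] [cP' cZ' P0' dP' dZ'] Z0.
have ZN t : 0 <= t -> Z' t = - Z t.
  apply: (@ode_unique _ (eps^-1 * M) Z' (fun t => - Z t) _ (fun t => - rate2 eps (s t) (g (Z t))) cZ' _ _ dZ') => //.
  - by move=> x; apply: cvgN; exact: cZ.
  - by move=> r r0; exact: is_deriveN (dZ r r0).
  - move=> r r0; rewrite -rate2N -gN; apply: le_trans (rate2_lip _ _ _ e0) _.
    by rewrite -mulrA; apply: ler_wpM2l; [rewrite invr_ge0 ltW|exact: glip].
move=> t t0; split; first exact: ZN.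
apply: (@ode_unique _ 0 P' P _ _ cP' cP _ dP' dP) => //; first by rewrite P0 P0'.
by move=> r r0; rewrite ZN ?(ltW r0)// gN rate1N subrr normr0 mul0r.
Qed.

End ReflectedFlow.

(** * The reflection of I about 0 *)

Section Reflection.
Context {R : realType}.
Notation leb := (@leb R).
Notation I_ := (@I_ R).

Lemma I_opp (y : R) : I_ (- y) <-> I_ y.
Proof. by rewrite !I_bounds; split; lra. Qed.

Lemma ae_opp (Q : R -> Prop) : {ae leb, forall y, Q y} -> {ae leb, forall y, Q (- y)}.
Proof.
move=> [A [mA A0 sA]]; exists ((-%R : R -> measurableTypeR R) @^-1` A); split.
- by rewrite -[X in measurable X]setTI; exact: (oppr_measurable measurableT).
- by rewrite -[RHS]A0 -[RHS](lebesgue_measureN mA).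
- by move=> y /= nQ; exact: sA.
Qed.

Lemma Rintegral_I_opp (f : R -> R) : L1I f ->
  L1I (fun y => f (- y)) /\ \int[leb]_(y in I_) f (- y) = \int[leb]_(y in I_) f y.
Proof.
move=> fi.
pose F := f \_ I_.
have Fi : leb.-integrable setT (EFin \o F) := L1I_restrict fi.
have mF : measurable_fun setT F by apply/(measurable_restrictT _ measurable_I_); exact: L1I_measurable.
have mN : measurable_fun setT (-%R : measurableTypeR R -> measurableTypeR R) by exact: oppr_measurable.
have FNE y : F (- y) = ((fun y => f (- y)) \_ I_) y.
  rewrite /F !patchE; have -> // : (- y \in I_) = (y \in I_).
  by apply/idP/idP; rewrite !inE => /I_opp.
have absE (g : R -> \bar R) : measurable_fun setT g -> (forall x, 0 <= g x)%E ->
    (\int[leb]_x g x = \int[leb]_x g (- x)%R)%E.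
  move=> mg g0.
  rewrite -(@ge0_integral_pushforward _ _ (measurableTypeR R) (measurableTypeR R) R _ mN (@lebesgue_measure R) setT g)//.
  by apply: eq_measure_integral => A mA _; exact/esym/lebesgue_measureN.
have FNi : leb.-integrable setT (EFin \o (fun y => F (- y))).
  apply/integrableP; split.
    by apply/measurable_EFinP; exact: (measurableT_comp mF mN).
  have /integrableP[_] := Fi; rewrite absE//.
  by apply: measurableT_comp => //; exact/measurable_EFinP.
split.
- have : L1I (fun y => F (- y)) by apply: integrableS FNi.
  by apply: eq_integrable => // y /[!inE] Iy /=; rewrite FNE patchE mem_set.
- rewrite [LHS]Rintegral_mkcond [RHS]Rintegral_mkcond.
  transitivity (\int[leb]_y F (- y)); first by apply: eq_Rintegral => y _; rewrite FNE.
  congr fine.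
  rewrite -(@integral_pushforward _ _ (measurableTypeR R) (measurableTypeR R) R _ mN (@lebesgue_measure R) setT (EFin \o F))//.
    by apply: eq_measure_integral => A mA _; exact: lebesgue_measureN.
  exact/measurable_EFinP.
Qed.

Lemma Rint_I_patch (c a b : R) : - 2^-1 <= a -> a < b -> b <= 2^-1 ->
  L1I ((fun=> c) \_ `]a, b[) /\ \int[leb]_(y in I_) ((fun=> c) \_ `]a, b[) y = c * (b - a).
Proof.
move=> a1 ab b1.
have sub : I_ `&` `]a, b[%classic = `]a, b[%classic.
  apply/setIidPr => y /=; rewrite in_itv/= => /andP[ay yb]; apply/I_bounds.
  by rewrite (le_lt_trans a1 ay) (lt_le_trans yb b1).
split.
- rewrite /L1I -restrict_EFin.
  apply: ((@integrable_restrict _ _ _ leb _ (measurable_itv _) _ measurable_I_ _).1).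
  rewrite sub; apply: (@integrableS _ _ _ leb I_) => //; last exact: L1I_cst.
  by rewrite -sub; exact: subIsetl.
- rewrite -Rintegral_mkcondr sub.
  have -> := @Rintegral_cst _ _ _ leb _ (measurable_itv `]a, b[) c.
  congr (_ * _); rewrite [X in fine X](lebesgue_measure_itv `]a, b[)/= lte_fin ab.
  by rewrite -EFinB.
Qed.

End Reflection.

(** * Two-sided bounds on the stress *)

Section StressBounds.
Context {R : realType}.
Notation leb := (@leb R).
Notation I_ := (@I_ R).
Variables (V : R -> R) (M : R) (z0 : R -> R).
Hypothesis hg : driving (force V) M.
Variables (eps : R) (u e p z : R -> R -> R) (s : R -> R) (P Z : R -> R -> R).
Hypothesis e0 : 0 < eps.
Hypothesis sol : pointwise_solution V z0 eps u e p z s P Z.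

Lemma sol_L1I t : 0 <= t -> L1I (P t).
Proof. by move=> t0; case: sol => -[_ _ h _] _; case: (h t t0). Qed.

Lemma sol_flow : {ae leb, forall y, I_ y ->
  Z 0 y = z0 y /\ flow_sol (force V) eps s (P^~ y) (Z^~ y)}.
Proof. by case: sol => _ []. Qed.

Lemma stress_increment a b : 0 <= a -> 0 <= b ->
  s b - s a = (b - a) - \int[leb]_(y in I_) (P b y - P a y).
Proof.
move=> a0 b0; case: sol => -[_ _ _ sE] _.
by rewrite !sE// RintegralB//; [lra|exact: sol_L1I|exact: sol_L1I].
Qed.

(** After the last time at which [min t 1 <= s] the stress is below 1, so the plastic strain cannot
    grow there and the stress rises at least as fast as the load; it then cannot fall behind
    [min t 1]. *)
Lemma stress_lower t : 0 <= t -> Num.min t 1 <= s t.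
Proof.
move=> t0; rewrite leNgt; apply/negP => st.
have [[cs s00 _ _] _] := sol.
pose f r := Num.min r 1 - s r.
have cf : continuous f.
  move=> r; apply: cvgB; last exact: cs.
  by apply: (@continuous_min R R (fun r => r) (fun=> 1)); [exact: cvg_id|exact: cvg_cst].
have f0 : f 0 <= 0 by rewrite /f s00 subr0 ge_min lexx.
have ft : 0 < f t by rewrite /f subr_gt0.
have [a [/andP[a0 at_] fa fr]] := last_exit t0 cf f0 ft.
have : \int[leb]_(y in I_) (P t y - P a y) <= 0.
  rewrite -(Rint_I_cst 0); apply: (@ae_le_Rintegral _ _ _ leb) => //.
  - by apply: intgB => //; exact: sol_L1I.
  - exact: L1I_cst.
  - apply: filterS sol_flow => y h Iy; have [_ hf] := h Iy.
    apply: (flow_plastic_nonincr hg e0 hf a0 at_) => r /andP[ar rt].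
    have := fr r; rewrite ar (ltW rt) => /(_ isT); rewrite /f subr_gt0 => /ltW h1.
    by rewrite (le_trans h1)// ge_min lexx orbT.
have := stress_increment a0 t0.
move: fa; rewrite /f subr_le0 => fa.
move: st; rewrite lt_min => /andP[st1 st2].
move: fa; rewrite ge_min => /orP[fa|fa]; lra.
Qed.

Lemma stress_ge0 t : 0 <= t -> 0 <= s t.
Proof.
by move=> t0; rewrite (le_trans _ (stress_lower t0))// le_min t0 ler01.
Qed.

Lemma stress_le_time t : 0 <= t -> s t <= t.
Proof.
move=> t0; have [[_ _ _ ->//] _] := sol.
rewrite gerBl -(Rint_I_cst 0); apply: (@ae_le_Rintegral _ _ _ leb) => //.
- exact: L1I_cst.
- exact: sol_L1I.
- apply: filterS sol_flow => y h Iy; have [_ hf] := h Iy.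
  exact: (flow_plastic_ge0 hg e0 hf stress_ge0).
Qed.

(* While the stress exceeds 1 + d the region where the driving force is close
   to 1 flows at a rate of order d / eps, which outweighs the unit loading rate. *)
Lemma stress_upper d rho : 0 < d < 1 -> 0 < rho <= 2^-1 ->
  (forall y, 0 < y < rho -> 1 - d / 4 <= `|force V (z0 y)|) ->
  eps <= 3 * d * rho / 8 -> forall t, 0 <= t -> s t <= 1 + d.
Proof.
move=> d01 /andP[rho0 rho1] hz eps_le t t0; rewrite leNgt; apply/negP => st.
have [[cs s00 _ _] _] := sol.
have sa0 : s 0 <= 1 + d by rewrite s00; lra.
have [a [/andP[a0 at_] sa sr]] := last_exit t0 cs sa0 st.
have [] := @Rint_I_patch R (3 * d / (8 * eps) * (t - a)) 0 rho; [lra|lra|lra|].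
rewrite subr0 => ki kE.
have : \int[leb]_(y in I_) (((fun=> 3 * d / (8 * eps) * (t - a)) \_ `]0, rho[) y)
    <= \int[leb]_(y in I_) (P t y - P a y).
  apply: (@ae_le_Rintegral _ _ _ leb) => //.
  - by apply: intgB => //; exact: sol_L1I.
  - apply: filterS sol_flow => y h Iy; have [Z0 hf] := h Iy.
    rewrite patchE; case: ifPn; last first.
      by move=> _; rewrite subr_ge0; exact: (flow_plastic_homo hg e0 hf stress_ge0).
    rewrite inE/= in_itv/= => /hz hzy.
    apply: (flow_plastic_increment hf a0 at_) => r /andP[ar rt].
    have r0 : 0 <= r by rewrite (le_trans a0)// ltW.
    have [_ _ gh gb] := hg.
    apply: rate1_overloaded => //.
    + by apply: ltW; apply: sr; rewrite ar ltW.
    (* [|Z|] never decreases and [g] is odd and monotone, so the initial lower bound on the force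
       persists. *)
    + apply: (le_trans hzy); rewrite -Z0 -!(driving_norm hg); apply: gh.
      exact: (flow_internal_expands hg e0 hf).
    + by rewrite ler_norml.
rewrite kE => k1.
have := stress_increment a0 t0.
(* Here [eps <= 3 d rho / 8] enters: over the width [rho] the mass grows at least as fast as the
   load, so the stress cannot rise above its value at [a]. *)
have : (t - a) <= 3 * d / (8 * eps) * (t - a) * rho.
  have -> : 3 * d / (8 * eps) * (t - a) * rho = (3 * d * rho / 8) / eps * (t - a).
    by field; rewrite gt_eqF.
  rewrite ler_peMl ?subr_ge0// ler_pdivlMr// mul1r//.
by lra.
Qed.

End StressBounds.

(** * Concentration of the plastic strain near 0 *)

Section Concentration.
Context {R : realType}.
Notation leb := (@leb R).
Notation I_ := (@I_ R).

(** What the passage to the limit retains of a regularized solution. The same tolerance [eta]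
    measures the error on the stress and the width of the plastic zone, and [eps] no longer
    appears. *)
Definition concentrated (z0 : R -> R) (eta : R) (s : R -> R) (P Z : R -> R -> R) : Prop :=
  [/\ forall t, 0 <= t -> Num.min t 1 <= s t <= Num.min t 1 + eta,
    {ae leb, forall y, I_ y -> forall t, 0 <= t ->
      [/\ 0 <= P t y, eta <= `|y| -> P t y = 0, 0 < y -> Z t y = z0 y + P t y,
          y < 0 -> Z t y = z0 y - P t y & P t (- y) = P t y]} &
    {ae leb, forall y, I_ y -> forall a b, 0 <= a -> a <= b -> P a y <= P b y}].

Variables (V : R -> R) (M : R) (z0 : R -> R).
Hypothesis hg : driving (force V) M.
Hypothesis cF : continuous (force V).
Hypothesis F1 : force V 1 = 1.
Hypothesis Flt1 : forall x, x < 1 -> force V x < 1.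
Hypothesis hz0odd : forall y, Ibar y -> z0 (- y) = - z0 y.
Hypothesis hz0cont : {within (`[- (2^-1), 0[ `|` `]0, 2^-1] : set R), continuous z0}.
Hypothesis hz0lim : z0 y @[y --> 0^'+] --> (1 : R).
Hypothesis hz0bnd : forall y, 0 < y <= 2^-1 -> 0 <= z0 y < 1.

Let F0 : force V 0 = 0. Proof. exact: driving0 hg. Qed.

(** [z0] attains on a compact segment away from 0 a maximum below 1, where the force is below 1;
    monotonicity and oddness extend the bound to all points at distance at least [eta] from 0. *)
Lemma force_far_from_one eta : 0 < eta -> exists2 d, 0 < d < 1 & d <= eta /\
  forall y, I_ y -> eta <= `|y| -> `|force V (z0 y)| <= 1 - d.
Proof.
move=> eta0; pose h := Num.min eta 4^-1.
have h0 : 0 < h by rewrite lt_min eta0/= invr_gt0 ltr0n.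
have h4 : h <= 4^-1 by rewrite ge_min lexx orbT.
have he : h <= eta by rewrite ge_min lexx.
clearbody h.
have hh : h <= 2^-1 by lra.
have ch : {within `[h, 2^-1], continuous z0}.
  apply: continuous_subspaceW hz0cont => y /=; rewrite !in_itv/= => /andP[y1 y2].
  by right; rewrite (lt_le_trans h0 y1).
have [c] := EVT_max hh ch; rewrite in_itv/= => /andP[c1 c2] cmax.
have c0 : 0 < c <= 2^-1 by rewrite c2 (lt_le_trans h0 c1).
have /andP[zc0 zc1] := hz0bnd c0.
have g1 := Flt1 zc1.
have [_ gN gh _] := hg.
pose d := Num.min (Num.min eta (1 - force V (z0 c))) 2^-1.
have d0 : 0 < d by rewrite !lt_min eta0 subr_gt0 g1/= invr_gt0.
have d2 : d <= 2^-1 by rewrite ge_min lexx orbT.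
have dg : d <= 1 - force V (z0 c) by rewrite !ge_min lexx orbT.
have de : d <= eta by rewrite !ge_min lexx.
exists d; first by rewrite d0/=; lra.
split => // y Iy ey; clearbody d.
have pos x : 0 < x -> x < 2^-1 -> eta <= x -> `|force V (z0 x)| <= 1 - d.
  move=> x0 x1 ex; have xx : 0 < x <= 2^-1 by rewrite x0 ltW.
  have /andP[zx0 _] := hz0bnd xx.
  have zxc : z0 x <= z0 c by apply: cmax; rewrite in_itv/= (le_trans he ex) ltW.
  rewrite ger0_norm; first by have := gh _ _ zxc; lra.
  by rewrite -F0; exact: gh.
have /I_bounds/andP[y1 y2] := Iy.
move: ey; have [y0|y0] := ler0P y => ey; last exact: pos.
have [yy|yy] := eqVneq y 0; first by move: ey; rewrite yy oppr0; lra.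
have -> : z0 y = - z0 (- y).
  by rewrite hz0odd ?opprK//; apply: subset_I_Ibar.
rewrite gN normrN; apply: pos => //; first by rewrite oppr_gt0 lt_neqAle yy.
by lra.
Qed.

Lemma force_near_one d : 0 < d -> exists2 rho, 0 < rho <= 2^-1 &
  forall y, 0 < y < rho -> 1 - d <= `|force V (z0 y)|.
Proof.
move=> d0.
have cv : force V (z0 y) @[y --> 0^'+] --> (1 : R).
  have h := @cvg_comp _ _ _ z0 (force V) _ _ _ hz0lim (@cF 1).
  by rewrite F1 in h; exact: h.
have /cvgrPdist_le /(_ d d0) [r/= r0 hr] := cv.
exists (Num.min r 2^-1); first by rewrite lt_min r0/= invr_gt0 ltr0n ge_min lexx orbT.
move=> y /andP[y0]; rewrite lt_min => /andP[yr _].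
have := hr y; rewrite /ball/= sub0r normrN gtr0_norm// => /(_ yr y0).
rewrite ler_norml => h; apply: le_trans (ler_norm _); lra.
Qed.

(** Order of choice: [d] from [eta], so that the force is below yield at distance [eta] from 0;
    [rho] from [d], so that the force is within [d / 4] of 1 on []0, rho[]; then
    [eps0 = 3 d rho / 8]. The relation for [y < 0] and the evenness of [P t] come from comparing the
    trajectories at [y] and [- y]. *)
Lemma concentration eta : 0 < eta -> exists2 eps0, 0 < eps0 &
  forall eps u e p z s P Z, 0 < eps <= eps0 ->
    pointwise_solution V z0 eps u e p z s P Z -> concentrated z0 eta s P Z.
Proof.
move=> eta0.
have [d d01 [deta far]] := force_far_from_one eta0.
have d4 : 0 < d / 4 by lra.
have [rho /andP[rho0 rho1] near1] := force_near_one d4.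
exists (3 * d * rho / 8).
  by rewrite divr_gt0// !mulr_gt0//; lra.
move=> eps u e p z s P Z /andP[e0 eps1] sol.
have rr : 0 < rho <= 2^-1 by rewrite rho0.
have s0 := stress_ge0 hg e0 sol.
have sup := stress_upper hg e0 sol d01 rr near1 eps1.
have d01' : 0 <= d < 1 by lra.
have good := sol_flow sol.
split.
- move=> t t0; rewrite (stress_lower hg e0 sol t0)/=.
  have h1 := sup t t0; have h2 := stress_le_time hg e0 sol t0.
  by have [t1|t1] := leP t 1; lra.
- move: good (ae_opp good); apply: filterS2 => y h h' Iy t t0.
  have [Z0 hf] := h Iy; have [Z0' hf'] := h' ((I_opp y).2 Iy).
  have ZZ : Z 0 (- y) = - Z 0 y.
    by rewrite Z0 Z0' hz0odd//; exact: subset_I_Ibar.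
  have [ZN PN] := flow_reflect hg e0 hf hf' ZZ t0.
  have /I_bounds/andP[y1 y2] := Iy.
  split.
  + exact: flow_plastic_ge0 hg e0 hf s0 _ t0.
  + move=> ey; have := far y Iy ey; rewrite -Z0 => gZ.
    by have [] := flow_stuck hg e0 hf s0 d01' sup gZ t0.
  + move=> y0; rewrite -Z0; apply: (flow_internal hg e0 hf s0 d01' sup) => //.
    have yb : 0 < y <= 2^-1 by lra.
    by have /andP[zy _] := hz0bnd yb; rewrite Z0.
  + move=> y0.
    have hz : 0 <= Z 0 (- y).
      have yb : 0 < - y <= 2^-1 by lra.
      by have /andP[zy _] := hz0bnd yb; rewrite Z0'.
    have := flow_internal hg e0 hf' s0 d01' sup hz t0.
    by rewrite ZN PN ZZ Z0; lra.
  + exact: PN.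
- apply: filterS good => y h Iy a b; have [_ hf] := h Iy.
  exact: (flow_plastic_homo hg e0 hf s0).
Qed.

End Concentration.

(** * Growth and measurability of homogeneous integrands *)

Section ContinuousIntegrands.
Context {R : realType}.
Notation leb := (@leb R).
Notation I_ := (@I_ R).
Variables (n : nat) (f : @Xpt R n -> R).
Hypothesis hf : Chom f.

Lemma Chom_hom y (xi : 'M[R]_(n, 2)) eta c : Ibar y -> 0 <= c ->
  f (y, c *: xi, c * eta) = c * f (y, xi, eta).
Proof. by case: hf => _; apply. Qed.

Lemma Chom_continuous y (xi : 'M[R]_(n, 2)) eta (e : R) : Ibar y -> 0 < e ->
  exists2 d, 0 < d & forall y' (xi' : 'M[R]_(n, 2)) eta', Ibar y' -> `|y - y'| < d ->
    (forall i j, `|xi i j - xi' i j| < d) -> `|eta - eta'| < d ->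
    `|f (y, xi, eta) - f (y', xi', eta')| < e.
Proof.
move=> Iy e0; case: hf => cf _.
have /cvgrPdist_lt /(_ _ e0) := (subspace_continuousP _ _).1 cf (y, xi, eta) Iy.
rewrite near_withinE => /nbhs_ballP[d/= d0 hd].
exists d => // y' xi' eta' Iy' hy hxi heta.
by apply: (hd (y', xi', eta')).
Qed.

Lemma Chom0 y : Ibar y -> f (y, 0, 0) = 0.
Proof. by move=> Iy; have := Chom_hom 0 0 Iy (lexx 0); rewrite scale0r !mul0r. Qed.

(** [f] vanishes at each [(y, 0, 0)] and is small nearby; compactness of [Ibar] makes the radius
    uniform in [y]. *)
Lemma Chom_unit_bound : exists2 r, 0 < r & forall y (xi : 'M[R]_(n, 2)) eta, Ibar y ->
  (forall i j, `|xi i j| <= r) -> `|eta| <= r -> `|f (y, xi, eta)| <= 1.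
Proof.
have cI : compact (Ibar : set R) by exact: segment_compact.
pose Q (r y : R) := Ibar y -> forall (xi : 'M[R]_(n, 2)) eta,
   (forall i j, `|xi i j| <= r) -> `|eta| <= r -> `|f (y, xi, eta)| <= 1.
have cover x : Ibar x -> \forall x' \near x & r \near (0:R)^'+, Q r x'.
  move=> Ix; have [d d0 hd] := Chom_continuous 0 0 Ix ltr01.
  exists (ball x d, [set r | r < d]) => /=.
    split; first exact: nbhsx_ballx.
    exact: nbhs_right_lt.
  move=> [y r] [/= yd rd] Iy xi eta hxi heta.
  have -> : `|f (y, xi, eta)| = `|f (x, 0, 0) - f (y, xi, eta)|.
    by rewrite Chom0// sub0r normrN.
  apply: ltW; apply: hd => //.
  - by move=> i j; rewrite mxE sub0r normrN (le_lt_trans (hxi i j)).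
  - by rewrite sub0r normrN (le_lt_trans heta).
have := (compact_near_coveringP _).1 cI _ _ Q _ cover.
move=> [d /= d0 hd]; exists (d / 2); first by rewrite divr_gt0.
move=> y xi eta Iy; apply: (hd (d / 2)) => //=; last by rewrite divr_gt0.
by rewrite /ball/= sub0r normrN gtr0_norm ?divr_gt0// ltr_pdivrMr// ltr_pMr// ltr1n.
Qed.

(** Homogeneity rescales an argument of size [m] to size at most [r], where [|f| <= 1]; hence linear
    growth with constant [1 / r]. *)
Lemma Chom_bound : exists2 C, 0 <= C & forall y (xi : 'M[R]_(n, 2)) eta, Ibar y ->
  `|f (y, xi, eta)| <= C * (\sum_i \sum_j `|xi i j| + `|eta|).
Proof.
have [r r0 hr] := Chom_unit_bound.
exists r^-1; first by rewrite invr_ge0 ltW.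
move=> y xi eta Iy; set m := \sum_i \sum_j `|xi i j| + `|eta|.
have s0 i : 0 <= \sum_j `|xi i j| by apply: sumr_ge0.
have m1 i j : `|xi i j| <= m.
  have h1 : `|xi i j| <= \sum_j `|xi i j|.
    by rewrite (bigD1 j)//= lerDl sumr_ge0.
  have h2 : \sum_j `|xi i j| <= \sum_i \sum_j `|xi i j|.
    by rewrite (bigD1 i)//= lerDl sumr_ge0.
  by rewrite (le_trans h1)// (le_trans h2)// lerDl.
have m2 : `|eta| <= m by rewrite lerDr sumr_ge0.
have : 0 <= m by exact: le_trans m2.
rewrite le_eqVlt => /predU1P[m0|m0].
  have -> : xi = 0.
    by apply/matrixP => i j; rewrite mxE; apply/eqP; rewrite -normr_le0 m0.
  have -> : eta = 0 by apply/eqP; rewrite -normr_le0 m0.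
  by rewrite Chom0// normr0 -m0 mulr0.
have c0 : 0 < m / r by rewrite divr_gt0.
have -> : f (y, xi, eta) = m / r * f (y, (r / m) *: xi, r / m * eta).
  have e1 : m / r * (r / m) = 1 by field; rewrite !gt_eqF.
  by rewrite -Chom_hom ?(ltW c0)// scalerA e1 scale1r [m / r * _]mulrA e1 mul1r.
rewrite normrM gtr0_norm// mulrC [in leRHS]mulrC ler_piMl ?(ltW c0)//.
have rm0 : 0 <= r / m by rewrite divr_ge0// ltW.
apply: hr => //.
- by move=> i j; rewrite mxE normrM ger0_norm// mulrAC ler_pdivrMr// ler_pM2l.
- by rewrite normrM ger0_norm// mulrAC ler_pdivrMr// ler_pM2l.
Qed.

Lemma measurable_Chom_section (D : set R) (xi : 'M[R]_(n, 2)) eta :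
  measurable D -> D `<=` Ibar -> measurable_fun D (fun y => f (y, xi, eta)).
Proof.
move=> mD DI; apply: subspace_continuous_measurable_fun => //.
apply: (continuous_subspaceW DI).
apply/subspace_continuousP => y Iy; apply/cvgrPdist_lt => e e0.
have [d d0 hd] := Chom_continuous xi eta Iy e0.
rewrite near_withinE; exists d => //= y' yd Iy'.
by apply: hd => // [i j|]; rewrite subrr normr0.
Qed.

Lemma measurable_floor_piece (D : set R) (a : R -> R) (k : R) (m : int) :
  measurable D -> measurable_fun D a -> measurable (D `&` [set y | Num.floor (k * a y) = m]).
Proof.
move=> mD ma.
have mka : measurable_fun D (fun y => k * a y) by exact: measurable_funM.
have -> : D `&` [set y | Num.floor (k * a y) = m] =
    D `&` (fun y => k * a y) @^-1` `[m%:~R, (m + 1)%:~R[.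
  apply/seteqP; split => y [Dy h]; split => //; move: h; rewrite /= in_itv/=.
  - by move=> <-; exact: floor_itv.
  - exact: floor_def.
exact: mka.
Qed.

(* Replacing the arguments by k^-1 * floor (k * _) gives countably many values,
   so each approximation is measurable; the limit in k is the composition. *)
Lemma measurable_Chom_comp (D : set R) (a : 'I_n -> 'I_2 -> R -> R) (b : R -> R) :
  measurable D -> D `<=` Ibar -> (forall i j, measurable_fun D (a i j)) ->
  measurable_fun D b -> measurable_fun D (fun y => f (y, \matrix_(i, j) a i j y, b y)).
Proof.
move=> mD DI ma mb.
pose fl (k : nat) (x : R) : R := k.+1%:R^-1 * (Num.floor (k.+1%:R * x))%:~R.
pose h (k : nat) (y : R) := f (y, \matrix_(i, j) fl k (a i j y), fl k (b y)).
have flx k x : `|x - fl k x| <= k.+1%:R^-1.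
  have k0 : 0 < k.+1%:R :> R by rewrite ltr0n.
  have /andP[h1 h2] := floor_itv (k.+1%:R * x).
  rewrite intrD in h2; set F := (Num.floor (k.+1%:R * x))%:~R : R in h1 h2.
  have -> : x - fl k x = k.+1%:R^-1 * (k.+1%:R * x - F).
    by rewrite mulrBr mulKf// gt_eqF.
  rewrite normrM gtr0_norm ?invr_gt0// ger_pMr ?invr_gt0//.
  by rewrite ger0_norm ?subr_ge0// lerBlDl ltW.
apply: (measurable_fun_cvg (h := h)).
- move=> k.
  (* The tuples of integer values are countably many, and on each piece the integrand depends on [y]
     alone. *)
  pose U := ({ffun 'I_n * 'I_2 -> int} * int)%type.
  pose piece (v : U) := D `&`
     ((\bigcap_(ij : 'I_n * 'I_2) (D `&` [set y | Num.floor (k.+1%:R * a ij.1 ij.2 y) = v.1 ij]))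
      `&` (D `&` [set y | Num.floor (k.+1%:R * b y) = v.2])).
  have mpiece v : measurable (piece v).
    apply: measurableI => //; apply: measurableI.
      by apply: fin_bigcap_measurable => // ij _; exact: measurable_floor_piece.
    exact: measurable_floor_piece.
  move=> _ Y mY.
  have -> : D `&` h k @^-1` Y = \bigcup_v (piece v `&`
     (fun y => f (y, \matrix_(i, j) (k.+1%:R^-1 * (v.1 (i, j))%:~R), k.+1%:R^-1 * v.2%:~R)) @^-1` Y).
    apply/seteqP; split => y.
    - move=> [Dy hY].
      exists ([ffun ij => Num.floor (k.+1%:R * a ij.1 ij.2 y)], Num.floor (k.+1%:R * b y)) => //.
      split.
        by split => //; split => // ij _; split => //=; rewrite ffunE.
      move: hY; rewrite /preimage/= /h; congr (Y (f (_, _, _))).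
      by apply/matrixP => i j; rewrite !mxE ffunE.
    - move=> [v _ [[Dy [h1 [_ h2]]] hY]]; split => //.
      move: hY; rewrite /preimage/= /h; congr (Y (f (_, _, _))).
        by apply/matrixP => i j; rewrite !mxE /fl; have [_ /= ->] := h1 (i, j) I.
      by rewrite /fl h2.
  apply: countable_bigcupT_measurable => [|v]; first exact: countableP.
  apply: (measurable_Chom_section (D := piece v)) => //.
  by move=> y [Dy _]; exact: DI.
- move=> y Dy; apply/cvgrPdist_lt => e e0.
  have [d d0 hd] := Chom_continuous (\matrix_(i, j) a i j y) (b y) (DI _ Dy) e0.
  have : \forall k \near \oo, k.+1%:R^-1 < d.
    exact: (cvgr_lt _ (@cvg_harmonic R) _ d0).
  apply: filterS => k kd; apply: hd => //.
  - exact: DI.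
  - by rewrite subrr normr0.
  - by move=> i j; rewrite !mxE (le_lt_trans (flx k _)).
  - by rewrite (le_lt_trans (flx k _)).
Qed.

End ContinuousIntegrands.

(** * Dominating measures and the density of Lebesgue measure *)

Section DominatingMeasure.
Context {R : realType}.
Notation leb := (@leb R).
Notation I_ := (@I_ R).
Local Open Scope ereal_scope.

Let mI : measurable (I_ : set (measurableTypeR R)). Proof. exact: measurable_I_. Qed.

Lemma lebesgue_I_fin : @lebesgue_measure R I_ < +oo.
Proof. by rewrite [X in X < _]leb_I_ ltry. Qed.

Definition lebI : {finite_measure set (measurableTypeR R) -> \bar R} :=
  mfrestr mI lebesgue_I_fin.

(** A finite measure dominating every charge with a density on I plus an atom at 0; it witnesses
    that the set of values in [delta] is not empty. *)
Definition lebI_dirac0 : set (measurableTypeR R) -> \bar R :=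
  measure_add lebI (@dirac _ (measurableTypeR R) 0%R R).
HB.instance Definition _ := Measure.on lebI_dirac0.

Lemma lebI_dirac0E A : lebI_dirac0 A = lebI A + \d_(0%R : measurableTypeR R) A.
Proof. exact: measure_addE. Qed.

Lemma lebI_dirac0_fin : fin_num_fun lebI_dirac0.
Proof.
by move=> A mA; rewrite lebI_dirac0E fin_numD diracE fin_num_measure//=.
Qed.
HB.instance Definition _ := @Measure_isFinite.Build _ _ _ lebI_dirac0 lebI_dirac0_fin.

Lemma lebIE A : lebI A = leb (A `&` I_).
Proof. by []. Qed.

Lemma integral_lebI (A : set R) (h : R -> \bar R) : measurable A ->
  measurable_fun A h -> \int[lebI]_(x in A) h x = \int[leb]_(x in A `&` I_) h x.
Proof.
move=> mA mh.
have mAI : measurable (A `&` I_) by exact: measurableI.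
transitivity (\int[lebI]_(x in A) (h \_ I_) x).
  apply: ae_eq_integral => //.
    apply/(measurable_restrict h measurable_I_ mA).
    by apply: measurable_funS mh => // x [].
  exists (~` I_); split; first exact: measurableC.
    rewrite -[LHS]/(leb (~` I_ `&` I_)) setICl.
    exact: (measure0 (@lebesgue_measure R)).
  move=> x /= hx Ix; apply: hx => _; rewrite patchE mem_set//.
rewrite -integral_mkcondr.
apply: eq_measure_integral => S mS SI.
have e : S `&` I_ = S by apply/setIidPl => x /SI[].
by rewrite -[in RHS]e.
Qed.

Lemma lebI_integrable (A : set R) (h : R -> R) : measurable A ->
  measurable_fun A h -> leb.-integrable (A `&` I_) (EFin \o h) ->
  lebI.-integrable A (EFin \o h).
Proof.
move=> mA mh /integrableP[_ hi]; apply/integrableP; split; first exact/measurable_EFinP.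
rewrite integral_lebI//.
by do 2 apply: measurableT_comp => //; exact/measurable_EFinP.
Qed.

Variable lam : {finite_measure set (measurableTypeR R) -> \bar R}.
Hypothesis dom : lebI `<< lam.

(** An everywhere finite and nonnegative version of the density, so that it can be used pointwise as
    the factor in the homogeneity of [f]. *)
Definition lebI_density (y : R) : R := fine (Radon_Nikodym_SigmaFinite.f lebI lam y).

Lemma lebI_density_ge0 y : (0 <= lebI_density y)%R.
Proof. by apply: fine_ge0; exact: Radon_Nikodym_SigmaFinite.f_ge0. Qed.

Lemma lebI_densityE y : (lebI_density y)%:E = Radon_Nikodym_SigmaFinite.f lebI lam y.
Proof. by rewrite fineK//; exact: Radon_Nikodym_SigmaFinite.f_fin_num. Qed.

Lemma measurable_lebI_density : measurable_fun setT lebI_density.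
Proof.
have := Radon_Nikodym_SigmaFinite.f_integrable dom => /measurable_int mf.
by apply: measurableT_comp mf; exact: fine_measurable.
Qed.

Lemma lebI_density_change (A : set R) (h : R -> R) : measurable A ->
  lebI.-integrable A (EFin \o h) ->
  lam.-integrable A (EFin \o (fun x => h x * lebI_density x)%R) /\
  \int[lam]_(x in A) (h x * lebI_density x)%:E = \int[lebI]_(x in A) (h x)%:E.
Proof.
move=> mA hi.
have mh : measurable_fun A h by exact: intg_measurable hi.
have md : measurable_fun A lebI_density by apply: measurable_funTS; exact: measurable_lebI_density.
have mhd : measurable_fun A (fun x => h x * lebI_density x)%R by exact: measurable_funM.
split.
- have hi' := intg_norm hi.
  have := Radon_Nikodym_SigmaFinite.integrableM dom (f := EFin \o (fun x => `|h x|%R))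
    (fun x => ltac:(by rewrite /= lee_fin)) mA hi'.
  move=> hl; apply: (@le_integrable _ _ _ lam _ mA _ _ _ _ hl); first exact/measurable_EFinP.
  move=> x Ax /=; rewrite -lebI_densityE -EFinM/= lee_fin !normrM normr_id.
  exact: lexx.
- rewrite -(Radon_Nikodym_change_of_variables dom mA hi).
  apply: ae_eq_integral => //; first exact/measurable_EFinP.
    apply: emeasurable_funM; first exact/measurable_EFinP.
    by apply: measurable_funTS; apply: (measurable_int lam); exact: Radon_Nikodym_integrable.
  have := ae_eq_Radon_Nikodym_SigmaFinite dom mA.
  apply: filterS => x hx Ax; rewrite EFinM lebI_densityE /=.
  by rewrite -(hx Ax).
Qed.

End DominatingMeasure.

(** * Value of [delta] on a density plus an atom at 0 *)

Section DeltaFormula.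
Context {R : realType}.
Notation leb := (@leb R).
Notation I_ := (@I_ R).
Variables (n : nat) (q : 'I_n -> 'I_2 -> @signed_measure R).
Variables (a : 'I_n -> 'I_2 -> R -> R) (c : 'I_n -> 'I_2 -> R).
Hypothesis ai : forall i j, L1I (a i j).
Hypothesis qE : forall i j (A : set (measurableTypeR R)), measurable A ->
  q i j A = (\int[leb]_(y in A `&` I_) (a i j y)%:E + (c i j * \1_A 0)%:E)%E.
Variable f : @Xpt R n -> R.
Hypothesis hf : Chom f.

Let ar i j : R -> R := a i j \_ I_.

Let mar i j : measurable_fun setT (ar i j).
Proof. by apply/(measurable_restrictT _ measurable_I_); exact: L1I_measurable. Qed.

Let ari (A : set R) i j : measurable A -> (@lebI R).-integrable A (EFin \o ar i j).
Proof.
move=> mA; apply: lebI_integrable => //; first exact: measurable_funTS.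
apply: integrableS (L1I_restrict (ai i j)) => //; exact: measurableI.
Qed.

Let int_ar (A : set R) i j : measurable A ->
  (\int[lebI]_(y in A) (ar i j y)%:E = \int[leb]_(y in A `&` I_) (a i j y)%:E)%E.
Proof.
move=> mA; rewrite integral_lebI//; last by apply/measurable_EFinP; exact: measurable_funTS.
by apply: eq_integral => y /[!inE] -[_ Iy]; rewrite /ar patchE mem_set.
Qed.

Let L1E (A : set (measurableTypeR R)) : measurable A -> L1_charge (fun=> 1 : R) A = lebI A.
Proof.
move=> mA; rewrite /L1_charge; case: pselect => [h|]; last first.
  by case; exact: L1I_restrict (L1I_cst 1).
rewrite /= /induced_charge.
have -> : (\int[leb]_(x in A) ((fun=> 1 : R) \_ I_ x)%:E = \int[leb]_(x in A `&` I_) (cst 1%E) x)%E.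
  rewrite integral_mkcondr; apply: eq_integral => x _; rewrite !patchE; by case: ifP.
rewrite integral_cst ?mul1e//; exact: measurableI.
Qed.

Section Value.
Variable lam : {finite_measure set (measurableTypeR R) -> \bar R}.
Hypothesis domq : forall i j, q i j `<< lam.
Hypothesis domL : L1_charge (fun=> 1 : R) `<< lam.

Let dom : lebI `<< lam.
Proof.
apply/null_content_dominatesP => A mA A0; rewrite -L1E//.
by move/null_content_dominatesP : domL => /(_ A mA A0).
Qed.

Let m0 : R := fine (lam [set 0]).
Let m0_ge0 : 0 <= m0. Proof. exact: fine_ge0. Qed.
Let m0E : m0%:E = lam [set 0].
Proof. by rewrite fineK//; apply: fin_num_measure; exact: measurable_set1. Qed.

(** If [lam] has no atom at 0, domination forbids one in [q i j]. *)
Let c0 i j : m0 = 0 -> c i j = 0.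
Proof.
move=> m00.
have m1 : measurable ([set 0] : set (measurableTypeR R)) by exact: measurable_set1.
have l0 : lam [set 0] = 0%E by rewrite -m0E m00.
move/null_content_dominatesP : (@domq i j) => /(_ _ m1 l0).
rewrite qE// -int_ar//.
have -> : (\int[lebI]_(y in [set 0%R]) (ar i j y)%:E)%E = 0%E.
  rewrite integral_lebI//; last by apply/measurable_EFinP; exact: measurable_funTS.
  apply: (@null_set_integral _ _ _ leb) => //.
  - exact: measurableI.
  - by apply/measurable_EFinP; apply: (measurable_funTS (mar i j)).
  - apply/eqP; rewrite eq_le measure_ge0 andbT.
    rewrite -(lebesgue_measure_set1 (0 : R)); apply: le_measure; rewrite ?inE//.
    exact: measurableI.
by rewrite add0e indicE mem_set// mulr1 => -[].
Qed.

Let L := lebI_density lam.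

(** Lebesgue measure does not charge 0, so its density vanishes there as soon as [lam] has an
    atom. *)
Let L0 : m0 != 0 -> L 0 = 0.
Proof.
move=> m00.
have m1 : measurable ([set 0] : set (measurableTypeR R)) by exact: measurable_set1.
have := Radon_Nikodym_SigmaFinite.f_integral dom m1.
have -> : lebI [set 0 : R] = 0%E.
  apply/eqP; rewrite eq_le measure_ge0 andbT lebIE.
  rewrite -(lebesgue_measure_set1 (0 : R)); apply: (@le_measure _ _ _ leb); rewrite ?inE//.
  exact: measurableI.
rewrite (eq_integral (fun=> (L 0)%:E)); last first.
  by move=> x /[!inE] -> ; rewrite lebI_densityE.
rewrite integral_cst// -[X in (_ * X)%E]m0E -EFinM => -[] /esym/eqP.
by rewrite mulf_eq0 (negbTE m00) orbF => /eqP.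
Qed.

(** Density of the atom with respect to [lam]. For [m0 = 0] the quotient is 0 by convention, in
    agreement with [c i j = 0]. *)
Let D i j (y : R) : R := c i j / m0 * \1_[set 0] y.

Let Di (A : set R) k : measurable A ->
  lam.-integrable A (EFin \o (fun y : R => k * \1_[set 0] y)) /\
  (\int[lam]_(y in A) (k * \1_[set (0 : R)%R] y)%:E = (k * (m0 * \1_A 0%R))%:E)%E.
Proof.
move=> mA.
have m1 : measurable ([set 0] : set (measurableTypeR R)) by exact: measurable_set1.
have ii : lam.-integrable A (EFin \o (\1_[set 0] : R -> R)).
  apply: (@intg_le _ _ _ lam _ mA _ (fun=> 1)).
  - exact: measurable_indic.
  - exact: finite_measure_integrable_cst.
  - by move=> x _; rewrite indicE; case: (_ \in _); rewrite ?normr1 ?normr0.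
split; first exact: intgZ.
under eq_integral do rewrite EFinM.
rewrite integralZl// integral_indic// EFinM; congr (_ * _)%E.
rewrite indicE; have [A0|A0] := boolP ((0 : R) \in A).
  rewrite mulr1 m0E; congr (lam _); apply/setIidPl => x ->.
  by rewrite inE in A0.
rewrite mulr0 (_ : _ `&` _ = set0) ?measure0//.
apply/seteqP; split => // x [/= -> ]; by rewrite notin_setE in A0.
Qed.

Let densities i j : {ae lam, forall y, setT y ->
  fine (Radon_Nikodym (q i j) lam y) = ar i j y * L y + D i j y}.
Proof.
have mL : measurable_fun setT L by exact: measurable_lebI_density.
have h : ae_eq lam setT (Radon_Nikodym (q i j) lam) (EFin \o (fun y => ar i j y * L y + D i j y)).
  apply: integral_ae_eq => //.
  - exact: Radon_Nikodym_integrable.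
  - apply/measurable_EFinP; apply: measurable_funD; first exact: (measurable_funM (mar i j) mL).
    apply: measurable_funM => //; apply: measurable_indic; exact: measurable_set1.
  - move=> A _ mA; rewrite -Radon_Nikodym_integral// qE// -int_ar//.
    have [i1 e1] := lebI_density_change dom mA (ari i j mA).
    have [i2 e2] := Di (c i j / m0) mA.
    transitivity (\int[lam]_(y in A) ((ar i j y * L y)%:E + (D i j y)%:E))%E; last first.
      by apply: eq_integral => y _; rewrite -EFinD.
    rewrite integralD//; congr (_ + _)%E; first by rewrite -e1.
    rewrite [RHS]e2; congr EFin; rewrite mulrA.
    have [m00|m00] := eqVneq m0 0; first by rewrite c0// mul0r !mul0r.
    by rewrite divfK.
by apply: filterS h => y hy Ty; rewrite hy.
Qed.

Let density1 : {ae lam, forall y, setT y ->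
  fine (Radon_Nikodym (L1_charge (fun=> 1 : R)) lam y) = L y}.
Proof.
have h : ae_eq lam setT (Radon_Nikodym (L1_charge (fun=> 1 : R)) lam) (EFin \o L).
  apply: integral_ae_eq => //.
  - exact: Radon_Nikodym_integrable.
  - by apply/measurable_EFinP; exact: measurable_lebI_density.
  - move=> A _ mA; rewrite -Radon_Nikodym_integral// L1E//.
    rewrite (Radon_Nikodym_SigmaFinite.f_integral dom mA).
    by apply: eq_integral => y _; rewrite /= lebI_densityE.
by apply: filterS h => y hy Ty; rewrite hy.
Qed.

Let h (y : R) := f (y, \matrix_(i, j) ar i j y, 1).

Let mIb : measurable (Ibar : set R). Proof. exact: measurable_itv. Qed.

Let mh : measurable_fun Ibar h.
Proof.
apply: (measurable_Chom_comp hf (b := fun=> 1)) => // i j; exact: measurable_funTS.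
Qed.

Let hi : (@lebI R).-integrable Ibar (EFin \o h).
Proof.
have [C C0 hC] := Chom_bound hf.
apply: (@intg_le _ _ _ lebI _ mIb h (fun y => C * (\sum_i \sum_j `|ar i j y| + 1))) => //.
- apply: intgZ => //; apply: intgD => //; last first.
    exact: finite_measure_integrable_cst.
  have -> : (EFin \o (fun y => \sum_i \sum_j `|ar i j y|)) =
     (fun y => \sum_i \sum_j (`|ar i j y|%:E))%E.
    by apply/funext => y /=; rewrite -sumEFin; apply: eq_bigr => i _; rewrite sumEFin.
  apply: integrable_sum => // i _; apply: integrable_sum => // j _.
  by apply: intg_norm; exact: ari.
- move=> y Iy; apply: (le_trans (hC _ _ _ Iy)); rewrite normr1.
  by apply: ler_wpM2l => //; rewrite lerD2r; apply: ler_sum => i _; apply: ler_sum => j _; rewrite mxE.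
Qed.

(** Away from 0, homogeneity pulls the factor [L y] out of [f], which restores the Lebesgue
    integral. At an atom of [lam] at 0, [L 0 = 0] leaves only [f (0, c, 0) / m0], and integration
    multiplies it by [m0]. The result does not depend on [lam]. *)
Lemma delta_value : \int[lam]_(y in Ibar)
    f (y, \matrix_(i, j) fine (Radon_Nikodym (q i j) lam y),
       fine (Radon_Nikodym (L1_charge (fun=> 1 : R)) lam y)) =
  \int[leb]_(y in I_) f (y, \matrix_(i, j) a i j y, 1) + f (0, \matrix_(i, j) c i j, 0).
Proof.
have I0 : Ibar (0 : R) by apply/Ibar_bounds; lra.
pose k := f (0, \matrix_(i, j) c i j, 0) / m0.
have [i1 e1] := lebI_density_change dom mIb hi.
have [i2 e2] := Di k mIb.
have i12 : lam.-integrable Ibar (EFin \o (fun y => h y * L y + k * \1_[set 0] y)).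
  by apply: intgD.
have point (y : R) : Ibar y ->
    f (y, \matrix_(i, j) (ar i j y * L y + D i j y), L y) = h y * L y + k * \1_[set 0] y.
  move=> Iy; rewrite /D indicE.
  have Lh : f (y, \matrix_(i, j) (ar i j y * L y), L y) = h y * L y.
    rewrite mulrC -(Chom_hom hf _ _ Iy (lebI_density_ge0 dom y)) mulr1; congr (f (_, _, _)).
    by apply/matrixP => i j; rewrite !mxE mulrC.
  have [y0|y0] := eqVneq y 0; last first.
    have -> : (y \in [set 0]) = false by apply/negbTE; rewrite notin_setE => /= y00; rewrite y00 eqxx in y0.
    rewrite mulr0 addr0 -Lh; congr (f (_, _, _)).
    by apply/matrixP => i j; rewrite !mxE mulr0 addr0.
  rewrite mem_set// mulr1; have [m00|m00] := eqVneq m0 0.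
    rewrite /k m00 invr0 mulr0 addr0 -Lh; congr (f (_, _, _)).
    by apply/matrixP => i j; rewrite !mxE mulr0 mul0r addr0.
  rewrite y0 L0// mulr0 add0r /k mulrC -(Chom_hom hf _ _ I0) ?invr_ge0// mulr0.
  congr (f (_, _, _)); apply/matrixP => i j; rewrite !mxE mulr0 add0r mulr1; exact: mulrC.
have aeE : {ae lam, forall y, Ibar y ->
   h y * L y + k * \1_[set 0] y =
   f (y, \matrix_(i, j) fine (Radon_Nikodym (q i j) lam y),
       fine (Radon_Nikodym (L1_charge (fun=> 1 : R)) lam y))}.
  have hall : {ae lam, forall y, forall ij : 'I_n * 'I_2,
     fine (Radon_Nikodym (q ij.1 ij.2) lam y) = ar ij.1 ij.2 y * L y + D ij.1 ij.2 y}.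
    have H (ij : 'I_n * 'I_2) : {ae lam, forall y,
       fine (Radon_Nikodym (q ij.1 ij.2) lam y) = ar ij.1 ij.2 y * L y + D ij.1 ij.2 y}.
      by apply: filterS (densities ij.1 ij.2) => y; apply.
    have := @filter_forall _ _ _ _ (ae_filter_ringOfSetsType lam) H.
    by [].
  move: hall density1; apply: filterS2 => y h1 h2 Iy.
  rewrite -point// h2//; congr (f (_, _, _)).
  by apply/matrixP => i j; rewrite !mxE (h1 (i, j)).
rewrite -(@ae_eq_Rintegral _ _ _ lam _ mIb _ _ i12 _ aeE); last first.
  apply: (@intg_ae_eq _ _ _ lam _ mIb _ _ i12 _ aeE).
  apply: (measurable_Chom_comp hf) => // [i j|]; apply: measurable_funTS.
    by apply: measurableT_comp; [exact: fine_measurable|apply: (measurable_int lam); exact: Radon_Nikodym_integrable].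
  by apply: measurableT_comp; [exact: fine_measurable|apply: (measurable_int lam); exact: Radon_Nikodym_integrable].
rewrite RintegralD//; congr (_ + _).
- rewrite /Rintegral e1 integral_lebI//; last exact/measurable_EFinP.
  rewrite setIC (_ : I_ `&` Ibar = I_); last by apply/setIidPl; exact: subset_I_Ibar.
  congr fine; apply: eq_integral => y /[!inE] Iy; rewrite /h; congr (f (_, _, _))%:E.
  by apply/matrixP => i j; rewrite !mxE /ar patchE mem_set.
- rewrite /Rintegral e2 /= indicE mem_set// mulr1 /k.
  have [m00|m00] := eqVneq m0 0; last by rewrite divfK.
  rewrite m00 mulr0 (_ : (\matrix_(i, j) c i j) = 0) ?Chom0//.
  by apply/matrixP => i j; rewrite !mxE c0.
Qed.

End Value.

(** All admissible [lam] give the same value and at least one exists, so the choice made by [xget]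
    is determined. *)
Lemma delta_formula : delta q f =
  \int[leb]_(y in I_) f (y, \matrix_(i, j) a i j y, 1) + f (0, \matrix_(i, j) c i j, 0).
Proof.
have domq i j : q i j `<< lebI_dirac0.
  apply/null_content_dominatesP => A mA A0'.
  have A0 : (lebI A + \d_(0%R : measurableTypeR R) A = 0)%E by rewrite -lebI_dirac0E; exact: A0'.
  have [l0 d0] : lebI A = 0%E /\ (\d_(0%R : measurableTypeR R) A = 0 :> \bar R)%E.
    by move/eqP : A0; rewrite padde_eq0// => /andP[/eqP ? /eqP ?].
  rewrite qE//.
  have -> : (c i j * \1_A 0 = 0)%R.
    by move: d0; rewrite diracE indicE => -[] ->; rewrite mulr0.
  rewrite adde0; apply: (@null_set_integral _ _ _ leb) => //.
  - exact: measurableI.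
  - apply/measurable_EFinP; apply: measurable_funS (L1I_measurable (ai i j)) => //.
have domL : L1_charge (fun=> 1 : R) `<< lebI_dirac0.
  apply/null_content_dominatesP => A mA A0'; rewrite L1E//.
  have : (lebI A + \d_(0%R : measurableTypeR R) A = 0)%E by rewrite -lebI_dirac0E; exact: A0'.
  by move/eqP; rewrite padde_eq0// => /andP[/eqP ? _].
rewrite /delta; set S := [set r | _].
have vS : S (\int[leb]_(y in I_) f (y, \matrix_(i, j) a i j y, 1) + f (0, \matrix_(i, j) c i j, 0)).
  by exists lebI_dirac0; split => //; rewrite delta_value.
have uS r : S r -> r = \int[leb]_(y in I_) f (y, \matrix_(i, j) a i j y, 1) + f (0, \matrix_(i, j) c i j, 0).
  by move=> [lam [h1 h2 ->]]; exact: delta_value.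
have := @xgetPex _ 0 S; move=> /(_ (ex_intro _ _ vS)); exact: uS.
Qed.

End DeltaFormula.

(** * Integrands on pairs and their recession at the origin *)

Section PairIntegrands.
Context {R : realType}.
Notation leb := (@leb R).
Notation I_ := (@I_ R).

Definition pair_mx n (b th : 'I_n -> R) : 'M[R]_(n, 2) :=
  \matrix_(i, j) (if j == 0 then b i else th i).

Definition pair_mx1 (b th : R) : 'M[R]_(1, 2) := pair_mx (fun=> b) (fun=> th).

Lemma pair_mx_sum n (b th : 'I_n -> R) :
  \sum_i \sum_j `|pair_mx b th i j| = \sum_i (`|b i| + `|th i|).
Proof.
by apply: eq_bigr => i _; rewrite !big_ord_recl big_ord0 !mxE/= addr0.
Qed.

Lemma measurable_pair_integrand n (f : @Xpt R n -> R) (b th : 'I_n -> R -> R) :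
  Chom f -> (forall i, measurable_fun I_ (b i)) -> (forall i, measurable_fun I_ (th i)) ->
  measurable_fun I_ (fun y => f (y, pair_mx (fun i => b i y) (fun i => th i y), 1)).
Proof.
move=> hf mb mth.
pose a (i : 'I_n) (j : 'I_2) := if j == 0 then b i else th i.
have -> : (fun y => f (y, pair_mx (fun i => b i y) (fun i => th i y), 1)) =
   (fun y => f (y, \matrix_(i, j) a i j y, 1)).
  apply/funext => y; congr (f (_, _, _)).
  by apply/matrixP => i j; rewrite !mxE /a; case: ifP.
apply: (measurable_Chom_comp hf (b := fun=> 1)) => //; first exact: subset_I_Ibar.
by move=> i j; rewrite /a; case: ifP.
Qed.

Lemma L1I_pair_integrand n (f : @Xpt R n -> R) (b th : 'I_n -> R -> R) :
  Chom f -> (forall i, L1I (b i)) -> (forall i, L1I (th i)) ->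
  L1I (fun y => f (y, pair_mx (fun i => b i y) (fun i => th i y), 1)).
Proof.
move=> hf bi thi; have [C C0 hC] := Chom_bound hf.
apply: (@intg_le _ _ _ leb _ measurable_I_ _
  (fun y => C * (\sum_i (`|b i y| + `|th i y|) + 1))).
- by apply: measurable_pair_integrand => // i; exact: L1I_measurable.
- apply: intgZ => //; apply: intgD => //; last exact: L1I_cst.
  have -> : (EFin \o (fun y => \sum_i (`|b i y| + `|th i y|))) =
     (fun y => \sum_i (EFin \o (fun y => (`|b i y| + `|th i y|)%R)) y)%E.
    by apply/funext => y /=; rewrite sumEFin.
  apply: integrable_sum => // i _.
  by apply: intgD => //; apply: intg_norm; [exact: bi|exact: thi].
- move=> y Iy; apply: (le_trans (hC _ _ _ (subset_I_Ibar Iy))).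
  by rewrite pair_mx_sum normr1.
Qed.

Lemma L1_charge_lebI (g : R -> R) (A : set (measurableTypeR R)) : L1I g -> measurable A ->
  L1_charge g A = (\int[leb]_(y in A `&` I_) (g y)%:E)%E.
Proof.
move=> gi mA; rewrite /L1_charge; case: pselect => [h|]; last first.
  by case; exact: L1I_restrict.
rewrite /= /induced_charge integral_mkcondr.
by apply: eq_integral => y _; rewrite -restrict_EFin.
Qed.

Lemma delta_L1 n (b th : 'I_n -> R -> R) (f : @Xpt R n -> R) :
  (forall i, L1I (b i)) -> (forall i, L1I (th i)) -> Chom f ->
  delta (pair_charges (fun i => L1_charge (b i)) (fun i => L1_charge (th i))) f =
  \int[leb]_(y in I_) f (y, pair_mx (fun i => b i y) (fun i => th i y), 1).
Proof.
move=> bi thi hf.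
rewrite (@delta_formula _ _ _ (fun i j => if j == 0 then b i else th i) (fun _ _ => 0)) //.
- rewrite (_ : \matrix_(i, j) 0 = 0); last by apply/matrixP => i j; rewrite !mxE.
  rewrite Chom0 ?addr0//; last by apply/Ibar_bounds; lra.
  apply: eq_Rintegral => y _; congr (f (_, _, _)).
  by apply/matrixP => i j; rewrite !mxE; case: ifP.
- by move=> i j; case: ifP.
- move=> i j A mA; rewrite mul0r adde0 /pair_charges.
  by case: ifP => _; rewrite L1_charge_lebI.
Qed.

Lemma pair_mx1_scale c b th : c *: pair_mx1 b th = pair_mx1 (c * b) (c * th).
Proof. by apply/matrixP => i j; rewrite !mxE; case: ifP. Qed.

Lemma pair_mx1_dist b th b' th' (d : R) : `|b - b'| < d -> `|th - th'| < d ->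
  forall i j, `|pair_mx1 b th i j - pair_mx1 b' th' i j| < d.
Proof. by move=> h1 h2 i j; rewrite !mxE; case: ifP. Qed.

Variable f : @Xpt R 1 -> R.
Hypothesis hf : Chom f.

(* Large plastic strains see only the recession function of f at the origin;
   bounded ones contribute at most a constant. *)
Lemma recession_error (sg e : R) : `|sg| = 1 -> 0 < e ->
  exists r C, [/\ 0 < r, 0 <= C & forall y P zt, Ibar y -> `|y| < r -> 0 <= P -> `|zt| <= 1 ->
    `|f (y, pair_mx1 P (zt + sg * P), 1) - f (y, pair_mx1 0 zt, 1) - P * f (0, pair_mx1 1 sg, 0)|
      <= e * P + C].
Proof.
move=> sg1 e0.
have I0 : Ibar (0 : R) by apply/Ibar_bounds; lra.
have [d d0 hd] := Chom_continuous hf (pair_mx1 1 sg) 0 I0 e0.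
have [C C0 hC] := Chom_bound hf.
have bd y b th eta : Ibar y -> `|f (y, pair_mx1 b th, eta)| <= C * (`|b| + `|th| + `|eta|).
  by move=> Iy; have := hC y (pair_mx1 b th) eta Iy; rewrite pair_mx_sum big_ord1.
set k := f (0, pair_mx1 1 sg, 0).
(* Threshold for a large strain: if [P > N] then [1 / P < d], and after division by [P] the argument
   is within [d] of [(1, sg, 0)]. For [P <= N] the growth bound on [f] gives the constant below. *)
pose N := d^-1.
have N0 : 0 < N by rewrite invr_gt0.
exists d, (C * 2 + C * (2 * N + 2) + N * `|k|); split => //.
  by rewrite !addr_ge0// ?mulr_ge0// ?addr_ge0// ?mulr_ge0// ltW.
move=> y P zt Iy yd P0 zt1.
have b0 : `|f (y, pair_mx1 0 zt, 1)| <= C * 2.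
  apply: (le_trans (bd _ _ _ _ Iy)); apply: ler_wpM2l => //.
  by rewrite normr0 normr1; lra.
have k0 : 0 <= N * `|k| by rewrite mulr_ge0// ltW.
have c0 : 0 <= C * (2 * N + 2) by rewrite mulr_ge0// addr_ge0// mulr_ge0// ltW.
have eP : 0 <= e * P by rewrite mulr_ge0// ltW.
have [NP|PN] := ltP N P.
- have Pp : 0 < P by exact: lt_trans NP.
  have Pinv : P^-1 < d by rewrite -[d]invrK ltf_pV2.
  have e1 : f (y, pair_mx1 P (zt + sg * P), 1) = P * f (y, pair_mx1 1 (sg + zt / P), P^-1).
    rewrite -(Chom_hom hf _ _ Iy P0) pair_mx1_scale mulr1 divff ?gt_eqF//; congr (f (_, pair_mx1 _ _, _)).
    by field; rewrite gt_eqF.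
  have : `|k - f (y, pair_mx1 1 (sg + zt / P), P^-1)| < e.
    apply: hd => //.
    + by rewrite sub0r normrN.
    + apply: pair_mx1_dist; first by rewrite subrr normr0.
      rewrite opprD addNKr normrN normrM normfV (gtr0_norm Pp).
      by apply: le_lt_trans Pinv; rewrite ler_piMl// invr_ge0.
    + by rewrite sub0r normrN gtr0_norm ?invr_gt0.
  rewrite e1; set F := f (y, pair_mx1 1 _, _) => kF.
  have -> : P * F - f (y, pair_mx1 0 zt, 1) - P * k = - (P * (k - F)) - f (y, pair_mx1 0 zt, 1).
    by ring.
  apply: (le_trans (ler_normB _ _)); rewrite normrN normrM (gtr0_norm Pp).
  have : P * `|k - F| <= P * e by rewrite ler_wpM2l// ltW.
  by move: kF b0; move: (C * 2) (C * (2 * N + 2)) (N * `|k|) k0 c0 => *; lra.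
- apply: (le_trans (ler_normB _ _)); rewrite normrM (ger0_norm P0).
  have h1 : P * `|k| <= N * `|k| by rewrite ler_wpM2r.
  have h2 : `|f (y, pair_mx1 P (zt + sg * P), 1)| <= C * (2 * N + 2).
    apply: (le_trans (bd _ _ _ _ Iy)); apply: ler_wpM2l => //.
    have : `|zt + sg * P| <= `|zt| + P.
      by apply: (le_trans (ler_normD _ _)); rewrite normrM sg1 mul1r (ger0_norm P0).
    by rewrite normr1 (ger0_norm P0); lra.
  have h3 := ler_normB (f (y, pair_mx1 P (zt + sg * P), 1)) (f (y, pair_mx1 0 zt, 1)).
  by lra.
Qed.

End PairIntegrands.

(** * One-time limits of concentrated solutions *)

Section ConcentratedLimits.
Context {R : realType}.
Notation leb := (@leb R).
Notation I_ := (@I_ R).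

Definition admissible (z0 : R -> R) (eta : R) (s : R -> R) (P Z : R -> R -> R) : Prop :=
  concentrated z0 eta s P Z /\
  forall t, 0 <= t -> [/\ L1I (P t), L1I (Z t) & s t = t - \int[leb]_(y in I_) P t y].

Lemma L1I_patch (g : R -> R) (A : set R) : measurable A -> L1I g -> L1I (g \_ A).
Proof.
move=> mA gi; rewrite /L1I -restrict_EFin.
apply: ((@integrable_restrict _ _ _ leb _ mA _ measurable_I_ _).1).
by apply: (@integrableS _ _ _ leb I_) => //; exact: measurableI.
Qed.

Lemma ae_I_sign (Q : R -> Prop) : {ae leb, forall y, I_ y -> 0 < y -> Q y} ->
  {ae leb, forall y, I_ y -> y < 0 -> Q y} -> {ae leb, forall y, I_ y -> Q y}.
Proof.
move=> h1 h2; move: h1 h2 (leb_ae_neq (0 : R)).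
apply: filterS3 => y h1 h2 y0 Iy.
by have [yn|yp|//] := ltgtP y 0; [exact: h2|exact: h1].
Qed.

Section OneTime.
Variables (z0 : R -> R) (eta : R) (s : R -> R) (P Z : R -> R -> R).
Hypothesis h : admissible z0 eta s P Z.
Variable t : R.
Hypothesis t0 : 0 <= t.

Let Pi : L1I (P t). Proof. by have [_ /(_ t t0)[]] := h. Qed.
Let Zi : L1I (Z t). Proof. by have [_ /(_ t t0)[]] := h. Qed.

Let props : {ae leb, forall y, I_ y ->
  [/\ 0 <= P t y, eta <= `|y| -> P t y = 0, 0 < y -> Z t y = z0 y + P t y,
      y < 0 -> Z t y = z0 y - P t y & P t (- y) = P t y]}.
Proof. by have [[_ h1 _] _] := h; apply: filterS h1 => y hy Iy; exact: hy. Qed.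

Lemma mass_bounds : 0 <= \int[leb]_(y in I_) P t y <= t.
Proof.
have [[hs _ _] /(_ t t0)[_ _ sE]] := h.
have /andP[s1 _] := hs t t0.
apply/andP; split.
  rewrite -(Rint_I_cst 0); apply: (@ae_le_Rintegral _ _ _ leb) => //; first exact: L1I_cst.
  by apply: filterS props => y hy Iy; case: (hy Iy).
have : 0 <= Num.min t 1 by rewrite le_min t0 ler01.
by lra.
Qed.

(** The mass is [t - s t], and [t - min t 1 = (t - 1)^+]. *)
Lemma mass_limit : `|\int[leb]_(y in I_) P t y - Num.max (t - 1) 0| <= eta.
Proof.
have [[hs _ _] /(_ t t0)[_ _ sE]] := h.
have := hs t t0; rewrite ler_norml.
by have [t1|t1] := leP t 1; have [t2|t2] := leP (t - 1) 0; lra.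
Qed.

Lemma mass_half :
  \int[leb]_(y in I_) (P t \_ `]0, +oo[) y = (\int[leb]_(y in I_) P t y) / 2 /\
  \int[leb]_(y in I_) (P t \_ `]-oo, 0[) y = (\int[leb]_(y in I_) P t y) / 2.
Proof.
have i1 : L1I (P t \_ `]0, +oo[) by apply: L1I_patch.
have i2 : L1I (P t \_ `]-oo, 0[) by apply: L1I_patch.
have [i3 e] := Rintegral_I_opp i1.
have e1 : \int[leb]_(y in I_) (P t \_ `]0, +oo[) y = \int[leb]_(y in I_) (P t \_ `]-oo, 0[) y.
  rewrite -e; apply: (@ae_eq_Rintegral _ _ _ leb) => //.
  apply: filterS props => y hy Iy; have [_ _ _ _ PN] := hy Iy.
  rewrite !patchE PN.
  have -> // : (- y \in `]0, +oo[%classic) = (y \in `]-oo, 0[%classic).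
  by apply/idP/idP; rewrite !inE/= !in_itv/= ?andbT oppr_gt0.
have e2 : \int[leb]_(y in I_) P t y =
    \int[leb]_(y in I_) ((P t \_ `]0, +oo[) y + (P t \_ `]-oo, 0[) y).
  apply: (@ae_eq_Rintegral _ _ _ leb) => //; first exact: intgD.
  apply: filterS (leb_ae_neq 0) => y y0 Iy; rewrite !patchE.
  have [yn|yp|//] := ltgtP y 0.
    rewrite memNset ?mem_set ?add0r//= in_itv//=.
    by rewrite andbT; apply/negP; rewrite -leNgt ltW.
  rewrite mem_set ?memNset ?addr0//= in_itv/= ?andbT//.
  by apply/negP; rewrite -leNgt ltW.
move: e2; rewrite RintegralD// -e1 => e2; split; lra.
Qed.

Variable f : @Xpt R 1 -> R.
Hypothesis hf : Chom f.
Hypothesis z0i : L1I z0.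
Hypothesis z0b : forall y, I_ y -> `|z0 y| <= 1.

Let f0 y := f (y, pair_mx1 0 (z0 y), 1).
Let kp := f (0, pair_mx1 1 1, 0).
Let kn := f (0, pair_mx1 1 (-1), 0).

(** The integrand is compared with its value at zero plastic strain plus [P t y] times the recession
    value of the side of [y]. For [|y| >= r] the two agree, since [eta <= r] forces [P t y = 0]; for
    [|y| < r] they differ by at most [e * P t y + C]. The last error term replaces the mass by
    [(t - 1)^+]. *)
Lemma single_time_error (e r C : R) : 0 <= e -> 0 <= C -> eta <= r -> 0 < r <= 2^-1 ->
  (forall sg, sg = 1 \/ sg = -1 ->
    forall y p zt, Ibar y -> `|y| < r -> 0 <= p -> `|zt| <= 1 ->
    `|f (y, pair_mx1 p (zt + sg * p), 1) - f (y, pair_mx1 0 zt, 1) - p * f (0, pair_mx1 1 sg, 0)|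
      <= e * p + C) ->
  `|\int[leb]_(y in I_) f (y, pair_mx1 (P t y) (Z t y), 1) -
    (\int[leb]_(y in I_) f0 y + Num.max (t - 1) 0 / 2 * (kp + kn))|
    <= e * t + C * (2 * r) + eta * (`|kp| + `|kn|).
Proof.
move=> e0 C0 er /andP[r0 r1] hrec.
have Fi : L1I (fun y => f (y, pair_mx1 (P t y) (Z t y), 1)).
  by apply: (@L1I_pair_integrand _ 1 f (fun=> P t) (fun=> Z t)).
have f0i : L1I f0.
  apply: (@L1I_pair_integrand _ 1 f (fun _ _ => 0) (fun=> z0)) => // _.
  exact: L1I_cst.
have i1 : L1I (P t \_ `]0, +oo[) by apply: L1I_patch.
have i2 : L1I (P t \_ `]-oo, 0[) by apply: L1I_patch.
pose G y := f0 y + (kp * (P t \_ `]0, +oo[) y + kn * (P t \_ `]-oo, 0[) y).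
have Gi1 : L1I (fun y => kp * (P t \_ `]0, +oo[) y + kn * (P t \_ `]-oo, 0[) y).
  by apply: intgD => //; apply: intgZ.
have Gi : L1I G by apply: intgD.
have [m1 m2] := mass_half; have /andP[ma mb] := mass_bounds.
have GE : \int[leb]_(y in I_) G y = \int[leb]_(y in I_) f0 y + (\int[leb]_(y in I_) P t y) / 2 * (kp + kn).
  rewrite RintegralD//; congr (_ + _).
  rewrite RintegralD//; [|exact: intgZ|exact: intgZ].
  by rewrite RintegralZl// RintegralZl// m1 m2; ring.
have rr : - 2^-1 <= - r by lra.
have rlt : - r < r by lra.
have [pi pE] := Rint_I_patch C rr rlt r1.
have Hi : L1I (fun y => e * P t y + ((fun=> C) \_ `]- r, r[) y).
  by apply: intgD => //; exact: intgZ.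
have FG : `|\int[leb]_(y in I_) f (y, pair_mx1 (P t y) (Z t y), 1) - \int[leb]_(y in I_) G y| <=
    \int[leb]_(y in I_) (e * P t y + ((fun=> C) \_ `]- r, r[) y).
  apply: (@Rintegral_dist_le _ _ _ leb) => //.
  apply: filterS2 props (leb_ae_neq 0) => y hy y0 Iy.
  have [P0 Psupp Zp Zn _] := hy Iy.
  rewrite /G !patchE.
  have [yr|yr] := ltP `|y| r; last first.
    have Py : P t y = 0 by apply: Psupp; exact: le_trans yr.
    have Zy : Z t y = z0 y.
      by have [/Zn|/Zp|//] := ltgtP y 0 => ->; rewrite Py ?subr0 ?addr0.
    rewrite Py Zy /f0 !if_same !mulr0 !addr0 subrr normr0 add0r.
    by case: ifP.
  have -> : (y \in `]- r, r[%classic).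
    by apply/mem_set; rewrite /= in_itv/= -ltr_norml.
  have Ib := subset_I_Ibar Iy.
  have [yn|yp|//] := ltgtP y 0.
  - rewrite memNset; last by rewrite /= in_itv/= andbT; apply/negP; rewrite -leNgt ltW.
    rewrite mem_set; last by rewrite /= in_itv.
    have := hrec (-1) (or_intror erefl) y (P t y) (z0 y) Ib yr P0 (z0b Iy).
    rewrite Zn// mulN1r mulr0 add0r opprD addrA [kn * _]mulrC.
    exact.
  - rewrite mem_set; last by rewrite /= in_itv/= andbT.
    rewrite memNset; last by rewrite /= in_itv/=; apply/negP; rewrite -leNgt ltW.
    have := hrec 1 (or_introl erefl) y (P t y) (z0 y) Ib yr P0 (z0b Iy).
    rewrite Zp// mul1r mulr0 addr0 opprD addrA [kp * _]mulrC.
    exact.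
have HE : \int[leb]_(y in I_) (e * P t y + ((fun=> C) \_ `]- r, r[) y) <= e * t + C * (2 * r).
  rewrite RintegralD//; last exact: intgZ.
  rewrite RintegralZl// pE opprK; apply: lerD; first exact: ler_wpM2l.
  by rewrite mulr_natl.
have m3 := mass_limit.
have d2 : `|(\int[leb]_(y in I_) P t y) / 2 * (kp + kn) - Num.max (t - 1) 0 / 2 * (kp + kn)|
    <= eta * (`|kp| + `|kn|).
  rewrite -mulrBl -mulrBl normrM; apply: ler_pM => //; last exact: ler_normD.
  rewrite normrM [`|2^-1|]ger0_norm ?invr_ge0//.
  apply: le_trans m3; rewrite ler_pdivrMr// ler_peMr// ler1n//.
move: GE d2; set X := \int[leb]_(y in I_) f (y, _, 1); set Y := \int[leb]_(y in I_) f0 y.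
rewrite -/X in FG.
set p1 := _ / 2 * (kp + kn); set p2 := _ / 2 * (kp + kn) => GE d2.
have -> : X - (Y + p2) = (X - \int[leb]_(y in I_) G y) + (p1 - p2) by rewrite GE; ring.
apply: (le_trans (ler_normD _ _)); apply: lerD => //.
exact: le_trans HE.
Qed.

End OneTime.

(** [C1] and [C2] depend on [e1], so the radius [r] is chosen after them, and [eta] last; each of
    the three error terms is then at most [e / 3]. *)
Lemma single_time (f : @Xpt R 1 -> R) (z0 : R -> R) (t e : R) : Chom f -> L1I z0 ->
  (forall y, I_ y -> `|z0 y| <= 1) -> 0 <= t -> 0 < e ->
  exists2 eta, 0 < eta & forall s P Z, admissible z0 eta s P Z ->
  `|\int[leb]_(y in I_) f (y, pair_mx1 (P t y) (Z t y), 1) -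
    (\int[leb]_(y in I_) f (y, pair_mx1 0 (z0 y), 1) +
     Num.max (t - 1) 0 / 2 * (f (0, pair_mx1 1 1, 0) + f (0, pair_mx1 1 (-1), 0)))| <= e.
Proof.
move=> hf z0i z0b t0 e0.
pose e1 := e / (3 * (t + 1)).
have tp : 0 < t + 1 by lra.
have e10 : 0 < e1 by rewrite divr_gt0// mulr_gt0.
have [r1 [C1 [r10 C10 h1]]] := recession_error hf (normr1 R) e10.
have [r2 [C2 [r20 C20 h2]]] := recession_error hf (normrN1 R) e10.
pose C := C1 + C2; have C0 : 0 <= C by rewrite addr_ge0.
pose r := Num.min (Num.min r1 r2) (Num.min 2^-1 (e / (6 * (C + 1)))).
have Cp : 0 < C + 1 by lra.
have r0 : 0 < r.
  by rewrite !lt_min r10 r20/= invr_gt0 ltr0n/= divr_gt0// mulr_gt0.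
have rr1 : r <= r1 by rewrite !ge_min lexx.
have rr2 : r <= r2 by rewrite !ge_min lexx orbT.
have rh : r <= 2^-1 by rewrite !ge_min lexx !orbT.
have rC : r <= e / (6 * (C + 1)) by rewrite !ge_min lexx !orbT.
set k := `|f (0, pair_mx1 1 1, 0)| + `|f (0, pair_mx1 1 (-1), 0)|.
have k0 : 0 <= k by rewrite addr_ge0.
have kp : 0 < k + 1 by lra.
exists (Num.min r (e / (3 * (k + 1)))); first by rewrite lt_min r0 divr_gt0// mulr_gt0.
move=> s P Z adm; set eta := Num.min r _ in adm.
have er : eta <= r by rewrite ge_min lexx.
have ek : eta <= e / (3 * (k + 1)) by rewrite ge_min lexx orbT.
have rr : 0 < r <= 2^-1 by rewrite r0.
have hrec : (forall sg, sg = 1 \/ sg = -1 ->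
    forall y p zt, Ibar y -> `|y| < r -> 0 <= p -> `|zt| <= 1 ->
    `|f (y, pair_mx1 p (zt + sg * p), 1) - f (y, pair_mx1 0 zt, 1) - p * f (0, pair_mx1 1 sg, 0)|
      <= e1 * p + C).
  move=> sg [->|->] y p zt Iy yr p0 zt1.
  - by apply: (le_trans (h1 y p zt Iy (lt_le_trans yr rr1) p0 zt1)); rewrite lerD2l lerDl.
  - by apply: (le_trans (h2 y p zt Iy (lt_le_trans yr rr2) p0 zt1)); rewrite lerD2l lerDr.
apply: (le_trans (single_time_error adm t0 hf z0i z0b (ltW e10) C0 er rr hrec)).
rewrite -/k; clearbody eta r k C.
have a1 : e1 * t <= e / 3.
  have -> : e1 * t = (e / 3) * (t / (t + 1)) by rewrite /e1; field; lra.
  apply: ler_piMr; first by rewrite divr_ge0// ltW.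
  by rewrite ler_pdivrMr// mul1r; lra.
have a2 : C * (2 * r) <= e / 3.
  have : C * (2 * r) <= (C + 1) * (2 * (e / (6 * (C + 1)))).
    apply: ler_pM => //; [by rewrite mulr_ge0// ltW|lra|by rewrite ler_pM2l].
  have -> : (C + 1) * (2 * (e / (6 * (C + 1)))) = e / 3 by field; lra.
  by [].
have a3 : eta * k <= e / 3.
  have : eta * k <= e / (3 * (k + 1)) * (k + 1).
    apply: (le_trans (ler_wpM2r k0 ek)); apply: ler_wpM2l; last lra.
    by rewrite divr_ge0 ?(ltW e0)// mulr_ge0// ltW.
  have -> : e / (3 * (k + 1)) * (k + 1) = e / 3 by field; lra.
  by [].
by lra.
Qed.

End ConcentratedLimits.

(** * Two-time increments and the displacement *)

Section TwoTimesAndDisplacement.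
Context {R : realType}.
Notation leb := (@leb R).
Notation I_ := (@I_ R).

Lemma primI_patch (g : R -> R) y : primI g y = \int[leb]_(x in I_) (g \_ `[- 2^-1, y]) x.
Proof. by rewrite /primI -!Rintegral_mkcondr setIC. Qed.

Lemma primI_shift (c : R) (g : R -> R) y : L1I g -> I_ y ->
  primI (fun x => c + g x) y = c * (y + 2^-1) + primI g y.
Proof.
move=> gi Iy; rewrite !primI_patch.
have i1 : L1I ((fun=> c) \_ `[- 2^-1, y]) by apply: L1I_patch => //; exact: L1I_cst.
have i2 : L1I (g \_ `[- 2^-1, y]) by exact: L1I_patch.
transitivity (\int[leb]_(x in I_) (((fun=> c) \_ `[- 2^-1, y]) x + (g \_ `[- 2^-1, y]) x)).
  by apply: eq_Rintegral => x _; rewrite !patchE; case: ifP; rewrite ?addr0.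
rewrite RintegralD//; congr (_ + _).
move/I_bounds : Iy => /andP[y1 y2].
have [_] := Rint_I_patch c (lexx _) y1 (ltW y2).
rewrite opprK => <-; apply: (@ae_eq_Rintegral _ _ _ leb) => //.
  by apply: L1I_patch => //; exact: L1I_cst.
apply: filterS (leb_ae_neq y) => x xy /I_bounds/andP[x1 x2]; rewrite !patchE.
have -> // : (x \in `[- 2^-1, y]%classic) = (x \in `]- 2^-1, y[%classic).
apply/idP/idP; rewrite !inE/= !in_itv/= => /andP[h1 h2]; rewrite ?x1 ?(ltW x1)//= ?(ltW h2)//.
by rewrite lt_neqAle h2 andbT; apply/eqP.
Qed.

Variables (z0 : R -> R) (eta : R) (s : R -> R) (P Z : R -> R -> R).
Hypothesis adm : admissible z0 eta s P Z.

(** [P] is nondecreasing in time and [Z] moves by the same amount up to sign, so both arguments of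
    [HR] have equal modulus. The identity is exact: the dissipation is twice the increment of the
    mass. *)
Lemma two_times a b : 0 <= a -> a <= b ->
  \int[leb]_(y in I_) HR (P b y - P a y) (Z b y - Z a y) =
  2 * (\int[leb]_(y in I_) P b y - \int[leb]_(y in I_) P a y).
Proof.
move=> a0 ab; have b0 := le_trans a0 ab.
have [[_ h1 h2] h3] := adm.
have [Pa Za _] := h3 a a0; have [Pb Zb _] := h3 b b0.
have Pi : L1I (fun y => 2 * (P b y - P a y)) by apply: intgZ => //; exact: intgB.
have Hae : {ae leb, forall y, I_ y -> 2 * (P b y - P a y) = HR (P b y - P a y) (Z b y - Z a y)}.
  apply: ae_I_sign; move: h1 h2; apply: filterS2 => y hp hm Iy y0; rewrite HRE;
    have Pab := hm Iy a b a0 ab;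
    have [_ _ Zp Zn _] := hp Iy a a0; have [_ _ Zp' Zn' _] := hp Iy b b0.
  - rewrite Zp// Zp'// (_ : z0 y + P b y - (z0 y + P a y) = P b y - P a y); last by ring.
    by rewrite maxxx ger0_norm// subr_ge0.
  - rewrite Zn// Zn'// (_ : z0 y - P b y - (z0 y - P a y) = - (P b y - P a y)); last by ring.
    by rewrite normrN maxxx ger0_norm// subr_ge0.
have mH : measurable_fun I_ (fun y => HR (P b y - P a y) (Z b y - Z a y)).
  rewrite (_ : (fun y => _) = (fun y => 2 * Num.max `|P b y - P a y| `|Z b y - Z a y|)).
    apply: measurable_funM => //; apply: measurable_maxr.
      by apply: measurableT_comp => //; apply: measurable_funB; exact: L1I_measurable.
    by apply: measurableT_comp => //; apply: measurable_funB; exact: L1I_measurable.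
  by apply/funext => y; rewrite HRE.
have Hi := @intg_ae_eq _ _ _ leb _ measurable_I_ _ _ Pi mH Hae.
rewrite -(@ae_eq_Rintegral _ _ _ leb _ measurable_I_ _ _ Pi Hi Hae).
by rewrite RintegralZl//; [rewrite RintegralB|exact: intgB].
Qed.

(** Primitive, with value [- (t / 2)] at the left endpoint, of the limit strain: the constant
    density [min t 1] plus a mass [(t - 1)^+] at 0. *)
Definition limit_displacement (t y : R) : R :=
  - (t / 2) + Num.min t 1 * (y + 2^-1) + (if 0 < y then Num.max (t - 1) 0 else 0).

(** Outside []- eta, eta[] the primitive of [P t] is 0 or the whole mass, so the error is at most
    [eta] from the stress plus [eta] from the mass. Inside, the primitive is off by at most [t]
    more, on a set of measure [2 * eta]. *)
Lemma displacement_error (u : R -> R) t : 0 <= t -> 0 < eta <= 2^-1 -> L1I u ->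
  eqI u (fun y => - (t / 2) + primI (fun x => s t + P t x) y) ->
  L1I (limit_displacement t) ->
  \int[leb]_(y in I_) `|u y - limit_displacement t y| <= 2 * eta + t * (2 * eta).
Proof.
move=> t0 /andP[eta0 eta1] ui uE Ui.
have [[hs h1 _] h3] := adm.
have [Pi _ sE] := h3 t t0.
have /andP[m0 mt] := mass_bounds adm t0.
have ml := mass_limit adm t0.
set m := \int[leb]_(y in I_) P t y in m0 mt ml sE.
have props : {ae leb, forall y, I_ y -> 0 <= P t y /\ (eta <= `|y| -> P t y = 0)}.
  by apply: filterS h1 => y hy Iy; have [? ? _ _ _] := hy Iy t t0.
have Ppi y : L1I (P t \_ `[- 2^-1, y]) by exact: L1I_patch.
have pb y : I_ y -> 0 <= primI (P t) y <= m.
  move=> Iy; rewrite primI_patch; apply/andP; split.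
    rewrite -(Rint_I_cst 0); apply: (@ae_le_Rintegral _ _ _ leb) => //; [exact: L1I_cst|exact: Ppi|].
    by apply: filterS props => x hx Ix; rewrite patchE; case: ifP => // _; case: (hx Ix).
  apply: (@ae_le_Rintegral _ _ _ leb) => //; first exact: Ppi.
  by apply: filterS props => x hx Ix; rewrite patchE; case: ifP => // _; case: (hx Ix).
have pleft y : I_ y -> y <= - eta -> primI (P t) y = 0.
  move=> Iy ye; rewrite primI_patch -[RHS](Rint_I_cst 0).
  apply: (@ae_eq_Rintegral _ _ _ leb) => //; [exact: Ppi|exact: L1I_cst|].
  apply: filterS props => x hx Ix; rewrite patchE; case: ifP => //.
  rewrite inE/= in_itv/= => /andP[_ xy]; have [_] := hx Ix; apply.
  by rewrite ler0_norm; lra.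
have pright y : I_ y -> eta <= y -> primI (P t) y = m.
  move=> Iy ye; rewrite primI_patch /m.
  apply: (@ae_eq_Rintegral _ _ _ leb) => //; first exact: Ppi.
  apply: filterS props => x hx Ix; rewrite patchE; case: ifPn => //.
  rewrite notin_setE/= in_itv/= => /negP; rewrite negb_and -!ltNge.
  move: (Ix) => /I_bounds/andP[x1 x2] /orP[|xy]; first by lra.
  by have [_ ->//] := hx Ix; rewrite ger0_norm; lra.
have e1 : - eta < eta by lra.
have e2 : - 2^-1 <= - eta by lra.
have [ki kE] := Rint_I_patch t e2 e1 eta1.
have Bi : L1I (fun y => 2 * eta + ((fun=> t) \_ `]- eta, eta[) y).
  by apply: intgD => //; exact: L1I_cst.
have uUi : L1I (fun y => `|u y - limit_displacement t y|).
  by apply: intg_norm; exact: intgB.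
have key : \int[leb]_(y in I_) `|u y - limit_displacement t y| <=
   \int[leb]_(y in I_) (2 * eta + ((fun=> t) \_ `]- eta, eta[) y).
  apply: (@ae_le_Rintegral _ _ _ leb) => //.
  apply: filterS uE => y uy Iy; rewrite uy// primI_shift//.
  have /I_bounds/andP[y1 y2] := Iy.
  rewrite /limit_displacement.
  set d := if 0 < y then _ else _.
  have -> : - (t / 2) + (s t * (y + 2^-1) + primI (P t) y) -
      (- (t / 2) + Num.min t 1 * (y + 2^-1) + d) =
      (s t - Num.min t 1) * (y + 2^-1) + (primI (P t) y - d) by ring.
  have hst := hs t t0.
  have h4 : `|(s t - Num.min t 1) * (y + 2^-1)| <= eta.
    by rewrite normrM !ger0_norm; [nra|lra|lra].
  have d3 : `|(if 0 < y then m else 0) - d| <= eta.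
    by rewrite /d; case: ifP => _ //; rewrite subrr normr0 ltW.
  rewrite patchE; case: ifPn => [|yout].
  - rewrite inE/= in_itv/= => yin.
    have h5 : `|primI (P t) y - (if 0 < y then m else 0)| <= t.
      have := pb y Iy; rewrite ler_norml; case: ifP => _; lra.
    have -> : (s t - Num.min t 1) * (y + 2^-1) + (primI (P t) y - d) =
      (s t - Num.min t 1) * (y + 2^-1) + (primI (P t) y - (if 0 < y then m else 0))
      + ((if 0 < y then m else 0) - d) by ring.
    apply: (le_trans (ler_normD _ _)).
    by have := ler_normD ((s t - Num.min t 1) * (y + 2^-1)) (primI (P t) y - (if 0 < y then m else 0)); lra.
  - have -> : primI (P t) y = (if 0 < y then m else 0).
      move: yout; rewrite notin_setE/= in_itv/= => /negP; rewrite negb_and -!leNgt.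
      move=> /orP[ye|ye]; first by rewrite pleft// ifF//; apply/negbTE; rewrite -leNgt; lra.
      by rewrite pright// ifT//; lra.
    by apply: (le_trans (ler_normD _ _)); rewrite addr0; lra.
apply: (le_trans key); rewrite RintegralD//; last exact: L1I_cst.
by rewrite Rint_I_cst kE; lra.
Qed.

End TwoTimesAndDisplacement.

(** * Dissipation and potential as homogeneous integrands *)

Section ConcreteIntegrands.
Context {R : realType}.
Notation leb := (@leb R).
Notation I_ := (@I_ R).

Lemma continuous_Xpt_coord n (i : 'I_n) (j : 'I_2) : continuous (fun x : @Xpt R n => x.1.2 i j).
Proof.
move=> x; apply/cvgrPdist_lt => e e0.
have h : nbhs x (ball x e) by exact: nbhsx_ballx.
by apply: filterS h => x' [[_ [_ h]] _]; exact: (h i j).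
Qed.

Lemma continuous_Xpt_eta n : continuous (fun x : @Xpt R n => x.2).
Proof.
move=> x; apply/cvgrPdist_lt => e e0.
have h : nbhs x (ball x e) by exact: nbhsx_ballx.
by apply: filterS h => x' [_ h].
Qed.

Definition HR_diff n (i j : 'I_n) (x : @Xpt R n) : R :=
  HR (x.1.2 i 0 - x.1.2 j 0) (x.1.2 i 1 - x.1.2 j 1).

Lemma Chom_HR_diff n (i j : 'I_n) : Chom (HR_diff i j).
Proof.
split.
- apply: continuous_subspaceT => x.
  have -> : HR_diff i j = (fun x : Xpt n =>
     2 * Num.max `|x.1.2 i 0 - x.1.2 j 0| `|x.1.2 i 1 - x.1.2 j 1|).
    by apply/funext => x'; rewrite /HR_diff HRE.
  have c k : continuous (fun x : @Xpt R n => `|x.1.2 i k - x.1.2 j k|).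
    by move=> x'; apply: cvg_norm; apply: cvgB; exact: continuous_Xpt_coord.
  apply: cvgMr.
  exact: (@continuous_max R _ (fun x : Xpt n => `|x.1.2 i 0 - x.1.2 j 0|)
    (fun x : Xpt n => `|x.1.2 i 1 - x.1.2 j 1|) x (c 0 x) (c 1 x)).
- move=> y xi eta c _ c0; rewrite /HR_diff !HRE/= !mxE -!mulrBr !normrM (ger0_norm c0).
  by rewrite -maxr_pMr// mulrCA.
Qed.

Variables (V : R -> R) (M : R).
Hypothesis hV1 : forall x, derivable V x 1.
Hypothesis hg : driving (force V) M.
Hypothesis hVeven : forall x, V x = V (- x).
Hypothesis force1E : forall x, 1 <= x -> force V x = 1.

(** [V] is even, has slope [-1] beyond 1 and slope of modulus at most 1 elsewhere, so it stays at
    bounded distance from its recession function. *)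
Lemma potential_linear : exists2 B, 0 <= B & forall x, `|V x + `|x| | <= B.
Proof.
have [_ _ _ gb] := hg.
have cV := continuous_potential hV1.
have incr x y : x <= y -> V y - V x <= y - x /\ - (y - x) <= V y - V x.
  move=> xy; split.
  - rewrite -[leRHS]mul1r; apply: (derive_le_increment xy cV (df := fun x => - force V x)).
      by move=> z _; exact: is_derive_potential.
    by move=> z _; have := gb z; lra.
  - rewrite -mulN1r; apply: (derive_ge_increment xy cV (df := fun x => - force V x)).
      by move=> z _; exact: is_derive_potential.
    by move=> z _; have := gb z; lra.
have lin x : 1 <= x -> V x = V 1 - (x - 1).
  move=> x1.
  have h1 : V x - V 1 <= -1 * (x - 1).
    apply: (derive_le_increment x1 cV (df := fun x => - force V x)).
      by move=> z _; exact: is_derive_potential.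
    by move=> z /andP[/ltW z1 _]; rewrite force1E.
  by have [_] := incr _ _ x1; lra.
exists (`|V 1| + 2); first by rewrite addr_ge0.
have pos x : 0 <= x -> `|V x + x| <= `|V 1| + 2.
  move=> x0; have n1 := ler_norm (V 1); have n2 := ler_norm (- V 1); rewrite normrN in n2.
  have [/ltW x1|x1] := ltP x 1; last by rewrite lin// ler_norml; lra.
  by have [] := incr _ _ x1; rewrite ler_norml; lra.
move=> x; have [x0|x0] := ger0P x; first exact: pos.
by rewrite hVeven; apply: pos; rewrite oppr_ge0 ltW.
Qed.

Lemma VinftyE th : Vinfty V th = - `|th|.
Proof.
have [B B0 hB] := potential_linear.
apply/cvg_lim => //; apply/cvgrPdist_le => e e0.
exists (Num.max 1 (B / e)); split; first exact: num_real.
move=> t; rewrite gt_max => /andP[t1 tB].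
have t0 : 0 < t by lra.
have -> : - `|th| - V (t * th) / t = - ((V (t * th) + `|t * th|) / t).
  by rewrite normrM (gtr0_norm t0); field; rewrite gt_eqF.
rewrite normrN normrM normfV (gtr0_norm t0) ler_pdivrMr//.
apply: (le_trans (hB _)); move: tB; rewrite ltr_pdivrMr// mulrC => /ltW; exact.
Qed.

(** The bound is uniform in [th]; this gives the continuity of [{V}] across [eta = 0]. *)
Lemma Vbrace_error : exists2 B, 0 <= B & forall th eta,
  `|Vbrace V th eta + `|th| | <= B * `|eta|.
Proof.
have [B B0 hB] := potential_linear.
exists B => // th eta; rewrite /Vbrace; case: ifPn => eta0.
  have -> : eta * V (th / eta) + `|th| = eta * (V (th / eta) + `|th / eta|).
    by rewrite normrM normfV (gtr0_norm eta0); field; rewrite gt_eqF.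
  by rewrite normrM mulrC ler_wpM2r.
by rewrite VinftyE addNr normr0 mulr_ge0.
Qed.

Lemma Chom_Vbrace n (i : 'I_n) : Chom (fun x : @Xpt R n => Vbrace V (x.1.2 i 1) x.2).
Proof.
split.
- apply: continuous_subspaceT => x.
  have ct := @continuous_Xpt_coord n i 1.
  have ce := @continuous_Xpt_eta n.
  have FF := nbhs_filter x.
  have [eta0|eta0|eta0] := ltgtP 0 x.2.
  + have hn : \forall x' \near x, 0 < x'.2 by exact: (cvgr_gt _ (ce x) _ eta0).
    have e0 : x.2 != 0 by rewrite gt_eqF.
    apply: (@cvg_trans _ ((fun x' : Xpt n => x'.2 * V (x'.1.2 i 1 / x'.2)) @ x)).
      by apply: near_eq_cvg; apply: filterS hn => x' h; rewrite /Vbrace h.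
    have c1 : (fun x' : @Xpt R n => x'.1.2 i 1) \* (fun x' : @Xpt R n => x'.2^-1) @ nbhs x --> x.1.2 i 1 / x.2.
      apply: cvgM; first exact: ct.
      by apply: (cvgV e0); exact: ce.
    have c2 := @cvg_comp _ _ _ (fun x' : Xpt n => x'.1.2 i 1 / x'.2) V _ _ _ c1
      (@continuous_potential _ _ hV1 (x.1.2 i 1 / x.2)).
    by rewrite /Vbrace eta0; exact: (cvgM (ce x) c2).
  + have hn : \forall x' \near x, x'.2 < 0 by exact: (cvgr_lt _ (ce x) _ eta0).
    apply: (@cvg_trans _ ((fun x' : Xpt n => - `|x'.1.2 i 1|) @ x)).
      apply: near_eq_cvg; apply: filterS hn => x' h; rewrite /Vbrace ltNge (ltW h)/=.
      by rewrite VinftyE.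
    have c : (fun x' : @Xpt R n => - `|x'.1.2 i 1|) @ nbhs x --> - `|x.1.2 i 1|.
      by apply: cvgN; apply: cvg_norm; exact: ct.
    by rewrite /Vbrace ltNge (ltW eta0)/= VinftyE; exact: c.
  + have [B B0 hB] := Vbrace_error.
    apply/cvgrPdist_le => e e_gt0.
    have e2 : 0 < e / 2 by rewrite divr_gt0.
    have eB : 0 < e / (2 * (B + 1)) by rewrite divr_gt0// mulr_gt0//; lra.
    have /cvgrPdist_le /(_ _ e2) h1 := ct x.
    have /cvgrPdist_le /(_ _ eB) h2 := ce x.
    move: h1 h2; apply: filterS2 => x' h1; rewrite -eta0 sub0r normrN => h2.
    have -> : Vbrace V (x.1.2 i 1) 0 = - `|x.1.2 i 1| by rewrite /Vbrace ltxx VinftyE.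
    have h3 := hB (x'.1.2 i 1) x'.2.
    have h4 := ler_dist_dist (x.1.2 i 1) (x'.1.2 i 1).
    have h5 : B * `|x'.2| <= e / 2.
      have : B * `|x'.2| <= (B + 1) * (e / (2 * (B + 1))).
        by apply: ler_pM => //; lra.
      have -> : (B + 1) * (e / (2 * (B + 1))) = e / 2 by field; lra.
      by [].
    have -> : - `|x.1.2 i 1| - Vbrace V (x'.1.2 i 1) x'.2 =
      - (`|x.1.2 i 1| - `|x'.1.2 i 1|) - (Vbrace V (x'.1.2 i 1) x'.2 + `|x'.1.2 i 1|) by ring.
    apply: (le_trans (ler_normB _ _)); rewrite normrN; lra.
- move=> y xi eta c _; rewrite le_eqVlt => /predU1P[<-|c0].
    by rewrite /= mxE !mul0r /Vbrace ltxx VinftyE normr0 oppr0.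
  rewrite /= mxE /Vbrace pmulr_rgt0//; case: ifPn => eta0.
    rewrite -mulrA; congr (c * (eta * V _)); field.
    by rewrite !gt_eqF.
  by rewrite !VinftyE normrM (gtr0_norm c0) mulrN.
Qed.

(** The sign [sg] will be 1 and -1, for the two branches. The charge [q] enters through its values
    only, so that both the sum and the difference with the Dirac mass fit. *)
Lemma delta_split (f : @Xpt R 1 -> R) (z0 : R -> R) (m sg : R) (q : @signed_measure R) :
  Chom f -> L1I z0 -> 0 <= m ->
  (forall A : set (measurableTypeR R), measurable A ->
     q A = (L1_charge z0 A + (m * sg * \1_A 0%R)%:E)%E) ->
  delta (pair_charges (fun=> cscale m (dirac_charge (0 : R))) (fun=> q)) f =
  \int[leb]_(y in I_) f (y, pair_mx1 0 (z0 y), 1) + m * f (0, pair_mx1 1 sg, 0).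
Proof.
move=> hf zi m0 qE.
rewrite (@delta_formula _ _ _ (fun _ j => if j == 0 then (fun=> 0) else z0)
   (fun _ j => if j == 0 then m else m * sg)) //.
- congr (_ + _).
    apply: eq_Rintegral => y _; congr (f (_, _, _)).
    by apply/matrixP => i j; rewrite !mxE; case: ifP.
  rewrite -(Chom_hom hf) ?mulr0//; last by apply/Ibar_bounds; lra.
  congr (f (_, _, _)); apply/matrixP => i j; rewrite !mxE; case: ifP => _ //.
  by rewrite mulr1.
- by move=> _ j; case: ifP => // _; exact: L1I_cst.
- move=> i j A mA; rewrite /pair_charges; case: ifP => _.
    rewrite (_ : (\int[leb]_(y in A `&` I_) 0%:E)%E = 0%E); last exact: integral0.
    by rewrite add0e EFinM; congr (_ * _)%E; exact: diracE.
  by rewrite qE// L1_charge_lebI.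
Qed.

End ConcreteIntegrands.

(** * Bounds and integrability of the initial datum *)

Section InitialDatum.
Context {R : realType}.
Notation leb := (@leb R).
Notation I_ := (@I_ R).
Variable z0 : R -> R.
Hypothesis hz0odd : forall y, Ibar y -> z0 (- y) = - z0 y.
Hypothesis hz0cont : {within (`[- (2^-1), 0[ `|` `]0, 2^-1] : set R), continuous z0}.
Hypothesis hz0bnd : forall y, 0 < y <= 2^-1 -> 0 <= z0 y < 1.

Lemma datum_bound y : I_ y -> `|z0 y| <= 1.
Proof.
move=> Iy; have /I_bounds/andP[y1 y2] := Iy.
have pos x : 0 < x <= 2^-1 -> `|z0 x| <= 1.
  by move=> /hz0bnd ?; rewrite ler_norml; lra.
have [y0|y0|y0] := ltgtP y 0.
- rewrite -normrN -hz0odd; last exact: subset_I_Ibar.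
  by apply: pos; lra.
- by apply: pos; lra.
- have I0 : Ibar (0 : R) by apply/Ibar_bounds; lra.
  have := hz0odd I0; rewrite oppr0 y0 => h.
  have -> : z0 0 = 0 by lra.
  by rewrite normr0.
Qed.

Lemma datum_L1I : L1I z0.
Proof.
apply: (@L1I_bounded _ _ 1) => [|y]; last exact: datum_bound.
have mD : measurable (`[- (2^-1), 0[ `|` `]0, 2^-1] : set R).
  by apply: measurableU; exact: measurable_itv.
have m1 : measurable_fun (`[- (2^-1), 0[ `|` `]0, 2^-1] : set R) z0.
  exact: subspace_continuous_measurable_fun.
have m2 : measurable_fun ([set 0] : set R) z0 by exact: measurable_fun_set1.
have m3 : measurable_fun ((`[- (2^-1), 0[ `|` `]0, 2^-1]) `|` [set 0] : set R) z0.
  by apply/measurable_funU => //; exact: measurable_set1.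
apply: (measurable_funS _ _ m3).
  by apply: measurableU => //; exact: measurable_set1.
move=> y /I_bounds/andP[y1 y2] /=; rewrite !in_itv/=.
have [y0|y0|y0] := ltgtP y 0; [left; left|left; right|by right].
  by rewrite (ltW y1).
by rewrite (ltW y2).
Qed.

End InitialDatum.

(** * Limits of the regularized solutions at fixed times *)

Section VanishingRegularization.
Context {R : realType}.
Notation leb := (@leb R).
Notation I_ := (@I_ R).

Lemma dist_le_eq (a b : R) : (forall e, 0 < e -> `|a - b| <= e) -> a = b.
Proof.
move=> h; apply/eqP; rewrite -subr_eq0 -normr_le0; apply/ler_addgt0Pr => e e0.
by rewrite add0r; exact: h.
Qed.

Lemma left_dense (Theta : set R) (t d : R) : Theta 0 ->
  leb.-negligible (halfline `\` Theta) -> 0 <= t -> 0 < d ->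
  exists s, [/\ Theta s, 0 <= s & t - d < s <= t].
Proof.
move=> T0 neg; rewrite le_eqVlt => /predU1P[<-|t0] d0.
  (* Nothing lies to the left of 0 in the half-line; this is where [Theta 0] enters. *)
  by exists 0; split => //; rewrite lexx andbT; lra.
pose a := Num.max (t - d) 0.
have at_ : a < t by rewrite gt_max t0 andbT; lra.
apply: contrapT => /forallNP h.
have : leb `]a, t[ = 0%E.
  apply: (@measure_negligible _ _ _ leb) => //.
  apply: negligibleS neg => s /=; rewrite in_itv/= gt_max => /andP[/andP[s1 s2] s3].
  split; first by rewrite /halfline/= in_itv/= andbT ltW.
  by move=> Ts; apply: (h s); rewrite s1 (ltW s2) (ltW s3).
rewrite /Defs.leb lebesgue_measure_itv/= lte_fin at_ -EFinB => -[] /eqP.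
by rewrite subr_eq0 gt_eqF.
Qed.

Lemma pair_integral_eqI n (f : @Xpt R n -> R) (b th b' th' : 'I_n -> R -> R) :
  Chom f -> (forall i, L1I (b i)) -> (forall i, L1I (th i)) ->
  (forall i, L1I (b' i)) -> (forall i, L1I (th' i)) ->
  (forall i, eqI (b i) (b' i)) -> (forall i, eqI (th i) (th' i)) ->
  \int[leb]_(y in I_) f (y, pair_mx (fun i => b i y) (fun i => th i y), 1) =
  \int[leb]_(y in I_) f (y, pair_mx (fun i => b' i y) (fun i => th' i y), 1).
Proof.
move=> hf bi thi bi' thi' bb thth; apply: (@ae_eq_Rintegral _ _ _ leb) => //.
- exact: L1I_pair_integrand.
- exact: L1I_pair_integrand.
- have hb := @filter_forall _ _ _ _ (@leb_ae_filter R) bb.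
  have ht := @filter_forall _ _ _ _ (@leb_ae_filter R) thth.
  move: hb ht; apply: filterS2 => y hb ht Iy; congr (f (_, _, _)).
  by apply/matrixP => i j; rewrite !mxE; case: ifP => _; [exact: hb|exact: ht].
Qed.

Variables (V : R -> R) (M : R) (z0 : R -> R).
Hypothesis hg : driving (force V) M.
Hypothesis cF : continuous (force V).
Hypothesis F1 : force V 1 = 1.
Hypothesis Flt1 : forall x, x < 1 -> force V x < 1.
Hypothesis hz0odd : forall y, Ibar y -> z0 (- y) = - z0 y.
Hypothesis hz0cont : {within (`[- (2^-1), 0[ `|` `]0, 2^-1] : set R), continuous z0}.
Hypothesis hz0lim : z0 y @[y --> 0^'+] --> (1 : R).
Hypothesis hz0bnd : forall y, 0 < y <= 2^-1 -> 0 <= z0 y < 1.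
Variables (eps : nat -> R) (u_ e_ p_ z_ : nat -> R -> R -> R).
Hypothesis eps0 : forall k, 0 < eps k.
Hypothesis epsl : eps @ \oo --> (0 : R).
Hypothesis reg : forall k, regularized_solution V (fun t y => t * y) (fun=> 0) (fun=> 0)
  (fun=> 0) z0 (eps k) (u_ k) (e_ k) (p_ k) (z_ k).

Let z0i : L1I z0. Proof. exact: datum_L1I. Qed.
Let z0b y : I_ y -> `|z0 y| <= 1. Proof. exact: datum_bound. Qed.

Lemma regularized_L1I k t : 0 <= t ->
  [/\ L1I (u_ k t), L1I (e_ k t), L1I (p_ k t) & L1I (z_ k t)].
Proof.
move=> t0; have [[ud [Du [Dud [hu _ _]]]] [ed [pd [zd [[he hp hz] _]]]]] := reg k.
by split; [exact: path_L1I hu _ t0|exact: path_L1I he _ t0|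
  exact: path_L1I hp _ t0|exact: path_L1I hz _ t0].
Qed.

Lemma regularized_admissible : exists (s_ : nat -> R -> R) (P_ Z_ : nat -> R -> R -> R),
  (forall k, pointwise_solution V z0 (eps k) (u_ k) (e_ k) (p_ k) (z_ k) (s_ k) (P_ k) (Z_ k)) /\
  (forall eta, 0 < eta -> \forall k \near \oo, admissible z0 eta (s_ k) (P_ k) (Z_ k)).
Proof.
have H k : exists sPZ : (R -> R) * (R -> R -> R) * (R -> R -> R),
    pointwise_solution V z0 (eps k) (u_ k) (e_ k) (p_ k) (z_ k) sPZ.1.1 sPZ.1.2 sPZ.2.
  by have [s [P [Z h]]] := regularized_pointwise cF (eps0 k) (reg k); exists (s, P, Z).
have [F hF] := choice H.
exists (fun k => (F k).1.1), (fun k => (F k).1.2), (fun k => (F k).2); split => // eta eta0.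
have [d d0 hd] := concentration hg cF F1 Flt1 hz0odd hz0cont hz0lim hz0bnd eta0.
have : \forall k \near \oo, eps k < d by exact: (cvgr_lt _ epsl _ d0).
apply: filterS => k kd; split.
  by apply: (hd _ _ _ _ _ _ _ _ _ (hF k)); rewrite eps0 ltW.
have [[_ _ h1 h2] _] := hF k.
by move=> t t0; have [_ _ _ h3 h4] := h1 t t0; split => //; exact: h2.
Qed.

(** Value at [f] of the measure in the theorem: the initial datum with no plastic strain, plus half
    of the mass at 0 in each of the directions [(1, 1)] and [(1, -1)]. *)
Definition young_limit (f : @Xpt R 1 -> R) (t : R) : R :=
  \int[leb]_(y in I_) f (y, pair_mx1 0 (z0 y), 1) +
  Num.max (t - 1) 0 / 2 * (f (0, pair_mx1 1 1, 0) + f (0, pair_mx1 1 (-1), 0)).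

Lemma single_limit (f : @Xpt R 1 -> R) t : Chom f -> 0 <= t ->
  delta (pair_charges (fun _ : 'I_1 => L1_charge (p_ k t)) (fun=> L1_charge (z_ k t))) f
    @[k --> \oo] --> young_limit f t.
Proof.
move=> hf t0.
have [s_ [P_ [Z_ [hp hadm]]]] := regularized_admissible.
apply/cvgrPdist_le => e e0.
have [eta eta0 heta] := single_time hf z0i z0b t0 e0.
apply: filterS (hadm eta eta0) => k /heta.
have [_ _ pi zi] := regularized_L1I k t0.
have [[_ _ h1 _] _] := hp k; have [_ pP zZ Pi Zi] := h1 t t0.
rewrite (@delta_L1 _ 1 (fun=> p_ k t) (fun=> z_ k t))//.
rewrite (@pair_integral_eqI _ f (fun=> p_ k t) (fun=> z_ k t) (fun=> P_ k t) (fun=> Z_ k t))//.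
by rewrite distrC.
Qed.

Lemma pair_limit (t : 'I_2 -> R) : 0 <= t ord0 -> t ord0 <= t ord_max ->
  delta (pair_charges (fun i => L1_charge (p_ k (t i))) (fun i => L1_charge (z_ k (t i))))
    (HR_diff ord_max ord0) @[k --> \oo] -->
  2 * (Num.max (t ord_max - 1) 0 - Num.max (t ord0 - 1) 0).
Proof.
move=> t0 t01; have t1 := le_trans t0 t01.
have tt (i : 'I_2) : 0 <= t i.
  by case: (unliftP ord0 i) => [j ->|->//]; rewrite (_ : lift _ _ = ord_max)//; apply/val_inj; rewrite /= ord1.
have [s_ [P_ [Z_ [hp hadm]]]] := regularized_admissible.
have hf := @Chom_HR_diff R 2 ord_max ord0.
apply/cvgrPdist_le => e e0.
have e4 : 0 < e / 4 by lra.
apply: filterS (hadm _ e4) => k adm.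
have hall i : [/\ L1I (p_ k (t i)), L1I (z_ k (t i)), eqI (p_ k (t i)) (P_ k (t i)),
    eqI (z_ k (t i)) (Z_ k (t i)) & L1I (P_ k (t i)) /\ L1I (Z_ k (t i))].
  have [_ _ pi zi] := regularized_L1I k (tt i).
  by have [[_ _ h1 _] _] := hp k; have [_ pP zZ Pi Zi] := h1 _ (tt i).
rewrite delta_L1//; [|by move=> i; have [] := hall i|by move=> i; have [] := hall i].
rewrite (@pair_integral_eqI _ _ _ _ (fun i => P_ k (t i)) (fun i => Z_ k (t i)))//;
  try by move=> i; have [? ? ? ? []] := hall i.
have -> : \int[leb]_(y in I_) HR_diff ord_max ord0
    (y, pair_mx (fun i => P_ k (t i) y) (fun i => Z_ k (t i) y), 1) =
  \int[leb]_(y in I_) HR (P_ k (t ord_max) y - P_ k (t ord0) y) (Z_ k (t ord_max) y - Z_ k (t ord0) y).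
  by apply: eq_Rintegral => y _; rewrite /HR_diff/= !mxE.
rewrite (two_times adm)//.
have := mass_limit adm t0; have := mass_limit adm t1.
rewrite !ler_norml; set A := Num.max _ _; set B := Num.max _ _.
by move=> *; lra.
Qed.

Lemma stress_limit (g : R -> R) t : L2I g -> 0 <= t ->
  innerI (e_ k t) g @[k --> \oo] --> Num.min t 1 * \int[leb]_(y in I_) g y.
Proof.
move=> g2 t0; have gi := L2I_L1I g2.
have [s_ [P_ [Z_ [hp hadm]]]] := regularized_admissible.
have E k : innerI (e_ k t) g = s_ k t * \int[leb]_(y in I_) g y.
  have [_ ei _ _] := regularized_L1I k t0.
  have [[_ _ h1 _] _] := hp k; have [es _ _ _ _] := h1 t t0.
  have sgi : L1I (fun y => s_ k t * g y) by exact: intgZ.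
  have ae : {ae leb, forall y, I_ y -> s_ k t * g y = e_ k t y * g y}.
    by apply: filterS es => y h Iy; rewrite h.
  have meg : measurable_fun I_ (fun y => e_ k t y * g y).
    by apply: measurable_funM; exact: L1I_measurable.
  have egi := @intg_ae_eq _ _ _ leb _ measurable_I_ _ _ sgi meg ae.
  rewrite /innerI -(@ae_eq_Rintegral _ _ _ leb _ measurable_I_ _ _ sgi egi ae).
  by rewrite RintegralZl.
rewrite (_ : (fun k => innerI (e_ k t) g) = (fun k => s_ k t * \int[leb]_(y in I_) g y)); last first.
  by apply/funext => k; rewrite E.
apply: cvgMl; apply/cvgrPdist_le => e e0.
apply: filterS (hadm _ e0) => k [[h _ _] _].
have /andP[h1 h2] := h t t0.
by rewrite ler_norml; move: h1 h2; set m := Num.min _ _ => *; lra.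
Qed.

Lemma limit_displacement_L1I (t : R) : L1I (limit_displacement t).
Proof.
have i1 : L1I ((fun=> Num.max (t - 1) 0) \_ `]0, +oo[).
  by apply: L1I_patch => //; exact: L1I_cst.
have i2 : L1I (fun y => Num.min t 1 * (y + 2^-1)).
  apply: intgZ => //; apply: (@L1I_bounded _ _ 1).
    by apply: measurable_funD => //; exact: measurable_id.
  by move=> y /I_bounds/andP[y1 y2]; rewrite ler_norml; lra.
have i3 : L1I (fun y => - (t / 2) + Num.min t 1 * (y + 2^-1)).
  by apply: intgD => //; exact: L1I_cst.
have -> : limit_displacement t = (fun y => (- (t / 2) + Num.min t 1 * (y + 2^-1)) +
    ((fun=> Num.max (t - 1) 0) \_ `]0, +oo[) y).
  apply/funext => y; rewrite /limit_displacement patchE; congr (_ + _).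
  have -> // : (y \in `]0, +oo[%classic) = (0 < y).
  by apply/idP/idP; rewrite inE/= in_itv/= andbT.
by apply: intgD.
Qed.

Lemma limit_displacement_lip (t t' y : R) : I_ y ->
  `|limit_displacement t y - limit_displacement t' y| <= 3 * `|t - t'|.
Proof.
move=> /I_bounds/andP[y1 y2]; rewrite /limit_displacement.
wlog tt : t t' / t <= t'.
  move=> h; have [|/ltW] := leP t t'; first exact: h.
  by rewrite distrC (distrC t); exact: h.
rewrite (ler0_norm (_ : t - t' <= 0)) ?subr_le0// ler_norml.
by case: ifP => _; have [h1|h1] := leP t 1; have [h2|h2] := leP t' 1;
  have [h3|h3] := leP (t - 1) 0; have [h4|h4] := leP (t' - 1) 0; nra.
Qed.

Lemma displacement_limit t : 0 <= t ->
  \int[leb]_(y in I_) `|u_ k t y - limit_displacement t y| @[k --> \oo] --> (0 : R).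
Proof.
move=> t0.
have [s_ [P_ [Z_ [hp hadm]]]] := regularized_admissible.
apply/cvgrPdist_le => e e0.
pose eta := Num.min 2^-1 (e / (2 * (1 + t))).
have t1 : 0 < 1 + t by lra.
have eta0 : 0 < eta by rewrite lt_min invr_gt0 ltr0n/= divr_gt0// mulr_gt0.
have eta1 : 0 < eta <= 2^-1 by rewrite eta0 ge_min lexx.
have eta2 : eta <= e / (2 * (1 + t)) by rewrite ge_min lexx orbT.
apply: filterS (hadm _ eta0) => k adm.
have [ui _ _ _] := regularized_L1I k t0.
have [_ [hu _]] := hp k.
rewrite sub0r normrN ger0_norm; last by apply: Rintegral_ge0.
apply: (le_trans (displacement_error adm t0 eta1 ui (hu t t0) (limit_displacement_L1I t))).
have : eta * (2 * (1 + t)) <= e / (2 * (1 + t)) * (2 * (1 + t)).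
  by rewrite ler_pM2r// mulr_gt0.
rewrite divfK; last by rewrite mulf_neq0// gt_eqF.
by move: eta {eta0 eta1 eta2 adm} => eta h; nra.
Qed.

End VanishingRegularization.

(** * Tools for the passage to all times *)

Section LimitEvolution.
Context {R : realType}.
Notation leb := (@leb R).
Notation I_ := (@I_ R).

(** At a time of [Theta] close to [t] and not beyond it, [F] and [G] coincide and each is close to
    its value at [t]. The scheme serves the Young measure, the displacement and the stress. *)
Lemma left_dense_ext (Theta : set R) (F G : R -> R) t : Theta 0 ->
  leb.-negligible (halfline `\` Theta) -> 0 <= t ->
  (forall s, Theta s -> 0 <= s -> F s = G s) ->
  (forall e, 0 < e -> exists2 d, 0 < d &
     forall s, 0 <= s -> t - d < s <= t -> `|F s - F t| < e) ->
  (exists2 K, 0 <= K & forall s, 0 <= s -> `|G s - G t| <= K * `|s - t|) -> F t = G t.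
Proof.
move=> T0 Tneg t0 FG Fl [K K0 GK]; apply: dist_le_eq => e e0.
have e2 : 0 < e / 2 by lra.
have [d d0 hd] := Fl _ e2.
have c0 : 0 < e / (2 * (K + 1)) by rewrite divr_gt0// mulr_gt0//; lra.
pose d' := Num.min d (e / (2 * (K + 1))).
have d'0 : 0 < d' by rewrite lt_min d0.
have dd : d' <= d by rewrite ge_min lexx.
have dc : d' <= e / (2 * (K + 1)) by rewrite ge_min lexx orbT.
clearbody d'.
have [s [Ts s0 /andP[s1 s2]]] := left_dense T0 Tneg t0 d'0.
have h1 : `|F s - F t| < e / 2 by apply: hd => //; rewrite s2 andbT; lra.
have h2 : `|G s - G t| <= e / 2.
  apply: (le_trans (GK s s0)).
  have st : `|s - t| <= e / (2 * (K + 1)) by rewrite ler0_norm; lra.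
  have : K * `|s - t| <= (K + 1) * (e / (2 * (K + 1))) by apply: ler_pM => //; lra.
  have -> : (K + 1) * (e / (2 * (K + 1))) = e / 2 by field; lra.
  by [].
have -> : F t - G t = (G s - G t) - (F s - F t) by have e' := FG s Ts s0; rewrite e'; ring.
by apply: (le_trans (ler_normB _ _)); lra.
Qed.

Lemma at_left_dist (F : R -> R) t (l : R) : F s @[s --> t^'-] --> l ->
  forall e, 0 < e -> exists2 d, 0 < d & forall s, t - d < s < t -> `|F s - l| < e.
Proof.
move=> /cvgrPdist_lt h e e0; have [d /= d0 hd] := h e e0.
exists d => // s /andP[s1 s2]; rewrite distrC; apply: hd => //.
by rewrite /ball/= ger0_norm; lra.
Qed.

Lemma pos_shift_lip (s t : R) :
  `|Num.max (s - 1) 0 - Num.max (t - 1) 0| <= `|s - t|.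
Proof.
wlog st : s t / s <= t.
  move=> h; have [|/ltW] := leP s t; first exact: h.
  by rewrite distrC (distrC s); exact: h.
rewrite (ler0_norm (_ : s - t <= 0)) ?subr_le0// ler_norml.
by have [h1|h1] := leP (s - 1) 0; have [h2|h2] := leP (t - 1) 0; lra.
Qed.

Lemma min_shift_lip (s t : R) : `|Num.min s 1 - Num.min t 1| <= `|s - t|.
Proof.
wlog st : s t / s <= t.
  move=> h; have [|/ltW] := leP s t; first exact: h.
  by rewrite distrC (distrC s); exact: h.
rewrite (ler0_norm (_ : s - t <= 0)) ?subr_le0// ler_norml.
by have [h1|h1] := leP s 1; have [h2|h2] := leP t 1; lra.
Qed.

(** For [t >= 0], [min t 1 = t^+ - (t - 1)^+], whose primitive is a difference of two [pos_prim]. *)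
Lemma Rintegral_min (T : R) : 0 < T ->
  \int[leb]_(t in `[0, T]) Num.min t 1 = Num.min T 1 ^+ 2 / 2 + Num.max (T - 1) 0.
Proof.
move=> T0.
pose F (t : R) := pos_prim t - pos_prim (t - 1).
have dF (t : R) : is_derive t 1 F (pos_part t - pos_part (t - 1)).
  have d1 : is_derive t 1 (fun x : R => x - 1) 1.
    by apply: (is_derive_eq (is_deriveB (is_derive_id t 1) (is_derive_cst (1 : R) t 1))); rewrite subr0.
  have d2 := @is_derive1_comp R pos_prim (fun x => x - 1) t _ _ (is_derive_pos_prim _) d1.
  apply: (is_derive_eq (is_deriveB (is_derive_pos_prim t) d2)).
  by rewrite mulr1.
have cF : continuous F.
  by move=> t; apply: differentiable_continuous; apply/derivable1_diffP; have [] := dF t.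
pose f (t : R) := pos_part t - pos_part (t - 1).
have cf : continuous f.
  move=> t; apply: cvgB; first exact: continuous_pos_part.
  apply: (@continuous_comp _ _ _ (fun x : R => x - 1) pos_part).
    by apply: cvgB; [exact: cvg_id|exact: cvg_cst].
  exact: continuous_pos_part.
have FLR : derivable_oo_LRcontinuous F 0 T.
  split.
  - by move=> x _; have [] := dF x.
  - exact/cvg_at_right_filter/cF.
  - exact/cvg_at_left_filter/cF.
have Fd : {in `]0, T[, derive1 F =1 f}.
  by move=> x _; rewrite derive1E; have [] := dF x.
have cf' : {within `[0, T], continuous f} by exact: continuous_subspaceT.
have e := continuous_FTC2 T0 cf' FLR Fd.
transitivity (\int[leb]_(t in `[0, T]) f t).
  apply: eq_Rintegral => t; rewrite inE/= in_itv/= => /andP[t0 _].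
  rewrite /f; have -> : pos_part t = t by rewrite /pos_part max_l.
  by have [[? ->]|[? ->]] := pos_part_cases (t - 1); have [h|h] := leP t 1; lra.
rewrite /Rintegral [X in fine X]e -EFinB /= /F /pos_prim.
have -> : pos_part (0 : R) = 0 by rewrite /pos_part maxxx.
have -> : pos_part (0 - 1 : R) = 0 by rewrite /pos_part max_r//; lra.
have -> : pos_part T = T by rewrite /pos_part max_l// ltW.
rewrite -/(pos_part (T - 1)).
by have [[? ->]|[? ->]] := pos_part_cases (T - 1); have [h|h] := leP T 1;
  rewrite ?expr0n/=; nra.
Qed.

(** Testing with [g = e - m] makes the integral of [(e - m) ^ 2] vanish. *)
Lemma L2_eq_cst (e : R -> R) (m : R) : L2I e ->
  (forall g, L2I g -> innerI e g = m * \int[leb]_(y in I_) g y) -> eqI e (fun=> m).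
Proof.
move=> e2 h; have [me ei2] := e2; have ei := L2I_L1I e2.
have sqi : L1I (fun y => (e y - m) ^+ 2).
  have -> : (fun y => (e y - m) ^+ 2) = (fun y => e y ^+ 2 + (- (2 * m) * e y + m ^+ 2)).
    by apply/funext => y; ring.
  apply: intgD => //; apply: intgD => //; [exact: intgZ|exact: L1I_cst].
have g2 : L2I (fun y => e y - m) by split => //; exact: measurable_funB.
have gi := L2I_L1I g2.
have egi : L1I (fun y => e y * (e y - m)).
  have -> : (fun y => e y * (e y - m)) = (fun y => (e y - m) ^+ 2 + m * (e y - m)).
    by apply/funext => y; ring.
  by apply: intgD => //; exact: intgZ.
have int0 : \int[leb]_(y in I_) ((e y - m) ^+ 2) = 0.
  have -> : \int[leb]_(y in I_) ((e y - m) ^+ 2) =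
     \int[leb]_(y in I_) (e y * (e y - m) - m * (e y - m)).
    by apply: eq_Rintegral => y _; ring.
  rewrite RintegralB//; last exact: intgZ.
  by rewrite RintegralZl// -(h _ g2) /innerI subrr.
have int0' : \int[leb]_(y in I_) `|(e y - m) ^+ 2| = 0.
  by rewrite -int0; apply: eq_Rintegral => y _; rewrite ger0_norm// sqr_ge0.
have := @Rintegral_norm_eq0 _ _ _ leb _ measurable_I_ _ sqi int0'.
apply: filterS => y hy Iy; have /eqP := hy Iy.
by rewrite sqrf_eq0 subr_eq0 => /eqP.
Qed.

Lemma telescope_ord k (g : 'I_k.+1 -> R) :
  \sum_(i < k) (g (lift ord0 i) - g (widen_ord (leqnSn k) i)) = g ord_max - g ord0.
Proof.
pose G n := g (inord n).
have -> : \sum_(i < k) (g (lift ord0 i) - g (widen_ord (leqnSn k) i)) =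
    \sum_(i < k) (G i.+1 - G i).
  apply: eq_bigr => i _; have ik := ltn_ord i.
  congr (g _ - g _); apply/val_inj; rewrite /= inordK//.
  exact: ltnW.
rewrite -(big_mkord xpredT (fun i => G i.+1 - G i)) telescope_sumr//.
by congr (g _ - g _); apply/val_inj; rewrite /= inordK.
Qed.

Lemma time_seq1 (t : R) : 0 <= t -> time_seq (fun _ : 'I_1 => t).
Proof. by move=> t0; split => // i j; rewrite !ord1 ltnn. Qed.

Definition pair_seq (a b : R) (i : 'I_2) : R := if i == ord0 then a else b.

Lemma time_seq2 a b : 0 <= a -> a < b -> time_seq (pair_seq a b).
Proof.
move=> a0 ab; split => [i|i j]; rewrite /pair_seq.
  by case: ifP => // _; rewrite (le_trans a0)// ltW.
case: i => -[|[|//]] hi; case: j => -[|[|//]] hj //= _.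
Qed.

(** Projection onto two consecutive times turns each term into an increment of [W], so every
    partition gives the same sum and the supremum is over a single value. *)
Lemma dissipation_telescope (mu : @Yfamily R) (W : R -> R) (T : R) : SGY mu -> 0 < T ->
  (forall a b, 0 <= a -> a < b ->
    mu 2%N (pair_seq a b) (HR_diff ord_max ord0) = W b - W a) ->
  dissipation mu 0 T = (W T - W 0)%:E.
Proof.
move=> [_ hproj] T0 h.
have sumE k (t : 'I_k.+1 -> R) : time_seq t ->
   \sum_(i < k) mu k.+1 t (fun x =>
      let cur := lift ord0 i in let prev := widen_ord (leqnSn k) i in
      HR (x.1.2 cur 0 - x.1.2 prev 0) (x.1.2 cur 1 - x.1.2 prev 1)) =
   W (t ord_max) - W (t ord0).
  move=> ts; rewrite -(telescope_ord (fun i => W (t i))).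
  apply: eq_bigr => i _.
  pose cur := lift ord0 i; pose prev := widen_ord (leqnSn k) i.
  have [t0 tm] := ts.
  have pc : t prev < t cur by apply: tm; rewrite /=.
  rewrite -h//.
  pose hh (j : 'I_2) := if j == ord0 then prev else cur.
  rewrite (hproj 2%N k.+1 (pair_seq (t prev) (t cur)) t hh (time_seq2 (t0 prev) pc) ts).
  - by congr (mu _ _ _); apply/funext => x; rewrite /HR_diff/= !mxE.
  - by move=> j; rewrite /pair_seq /hh; case: ifP.
  - exact: Chom_HR_diff.
rewrite /dissipation (_ : [set r | _] = [set (W T - W 0)%:E]) ?ereal_sup1//.
apply/seteqP; split => r.
- by move=> [k [t [ts t0 tT ->]]]; rewrite sumE// tT t0.
- move=> ->; exists 1%N, (pair_seq 0 T); split => //; first exact: time_seq2.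
  by rewrite sumE//; exact: time_seq2.
Qed.

End LimitEvolution.

(** * Identification of the limit evolution *)

Section ApproximableEvolution.
Context {R : realType}.
Notation leb := (@leb R).
Notation I_ := (@I_ R).
Variables (V : R -> R) (M : R) (z0 : R -> R).
Hypothesis hV1 : forall x, derivable V x 1.
Hypothesis hVeven : forall x, V x = V (- x).
Hypothesis hg : driving (force V) M.
Hypothesis cF : continuous (force V).
Hypothesis F1 : forall x, force V x = 1 <-> 1 <= x.
Hypothesis Flt1 : forall x, x < 1 -> force V x < 1.
Hypothesis hz0odd : forall y, Ibar y -> z0 (- y) = - z0 y.
Hypothesis hz0cont : {within (`[- (2^-1), 0[ `|` `]0, 2^-1] : set R), continuous z0}.
Hypothesis hz0lim : z0 y @[y --> 0^'+] --> (1 : R).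
Hypothesis hz0bnd : forall y, 0 < y <= 2^-1 -> 0 <= z0 y < 1.
Variables (u e : R -> R -> R) (mu : @Yfamily R).
Arguments mu : clear implicits.
Hypothesis evol : approximable_evolution V (fun t y => t * y) (fun=> 0) (fun=> 0) (fun=> 0) z0
  u e mu.

Let F11 : force V 1 = 1. Proof. exact/F1. Qed.
Let z0i : L1I z0. Proof. exact: datum_L1I. Qed.

Lemma evolution_young (f : @Xpt R 1 -> R) t : Chom f -> 0 <= t ->
  mu 1%N (fun=> t) f = young_limit z0 f t.
Proof.
move=> hf t0.
have [_ [[_ _ muleft] [eps [Th [u_ [e_ [p_ [z_ [[eps0 epsl _ T0 Tneg] [reg _ _ mucv]]]]]]]]]] :=
  evol.
apply: (left_dense_ext (F := fun s => mu 1%N (fun=> s) f) T0 Tneg t0).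
- move=> s Ts s0.
  have c1 := mucv 1%N (fun=> s) (time_seq1 s0) (fun=> Ts) f hf.
  have c2 := single_limit hg cF F11 Flt1 hz0odd hz0cont hz0lim hz0bnd eps0 epsl reg hf s0.
  exact: cvg_unique c1 c2.
- move=> d d0; have [c c0 hc] := muleft _ _ f (time_seq1 t0) hf d d0.
  by exists c => // s s0 hs; apply: hc => //; exact: time_seq1.
- exists (`|f (0, pair_mx1 1 1, 0) + f (0, pair_mx1 1 (-1), 0)| / 2).
    by rewrite divr_ge0.
  move=> s s0; rewrite /young_limit opprD addrACA subrr add0r -mulrBl -mulrBl.
  rewrite normrM mulrC mulrAC -mulrA ler_wpM2l// normrM normfV (ger0_norm (_ : 0 <= 2 :> R))//.
  by rewrite ler_wpM2r// pos_shift_lip.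
Qed.

Lemma evolution_increment a b : 0 <= a -> a < b ->
  mu 2%N (pair_seq a b) (HR_diff ord_max ord0) = 2 * Num.max (b - 1) 0 - 2 * Num.max (a - 1) 0.
Proof.
move=> a0 ab.
have [_ [[_ _ muleft] [eps [Th [u_ [e_ [p_ [z_ [[eps0 epsl _ T0 Tneg] [reg _ _ mucv]]]]]]]]]] :=
  evol.
have b0 : 0 <= b by lra.
have hf := @Chom_HR_diff R 2 ord_max ord0.
have onT s0 s1 : Th s0 -> Th s1 -> 0 <= s0 -> s0 < s1 ->
    mu 2%N (pair_seq s0 s1) (HR_diff ord_max ord0) =
    2 * (Num.max (s1 - 1) 0 - Num.max (s0 - 1) 0).
  move=> T0' T1' s00 s01.
  have Ti i : Th (pair_seq s0 s1 i) by rewrite /pair_seq; case: ifP.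
  have c1 := mucv 2%N (pair_seq s0 s1) (time_seq2 s00 s01) Ti _ hf.
  have c2 := @pair_limit R V M z0 hg cF F11 Flt1 hz0odd hz0cont hz0lim hz0bnd eps
    u_ e_ p_ z_ eps0 epsl reg (pair_seq s0 s1) s00 (ltW s01).
  exact: cvg_unique c1 c2.
apply: dist_le_eq => d d0; have d2 : 0 < d / 2 by lra.
have [c c0 hc] := muleft _ _ _ (time_seq2 a0 ab) hf _ d2.
(* [r <= b - a] keeps the approximating times in order, [s0 <= a <= b - r < s1]; the bound [d / 8]
   pays for the factor 2 at both ends. *)
pose r := Num.min c (Num.min (b - a) (d / 8)).
have r0 : 0 < r by rewrite !lt_min c0/=; apply/andP; split; lra.
have rc : r <= c by rewrite ge_min lexx.
have rab : r <= b - a by rewrite !ge_min lexx orbT.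
have rd : r <= d / 8 by rewrite !ge_min lexx !orbT.
clearbody r.
have [s0 [Ts0 s00 /andP[s01 s02]]] := left_dense T0 Tneg a0 r0.
have [s1 [Ts1 s10 /andP[s11 s12]]] := left_dense T0 Tneg b0 r0.
have ss : s0 < s1 by lra.
have : `|mu 2%N (pair_seq s0 s1) (HR_diff ord_max ord0) -
   mu 2%N (pair_seq a b) (HR_diff ord_max ord0)| < d / 2.
  apply: hc; first exact: time_seq2.
  by move=> i; rewrite /pair_seq; case: ifP => _; apply/andP; split; lra.
rewrite onT//; have := pos_shift_lip s0 a; have := pos_shift_lip s1 b.
rewrite (ler0_norm (_ : s0 - a <= 0)) ?subr_le0// (ler0_norm (_ : s1 - b <= 0)) ?subr_le0//.
rewrite ltr_norml !ler_norml.
by move: (Num.max _ _) (Num.max _ _) (Num.max _ _) (Num.max _ _) (mu _ _ _) => *; lra.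
Qed.

Lemma evolution_dissipation T : 0 < T ->
  dissipation mu 0 T = (2 * Num.max (T - 1) 0)%:E.
Proof.
move=> T0; have [[_ _ hS] _] := evol.
rewrite (dissipation_telescope (W := fun t => 2 * Num.max (t - 1) 0) hS T0); last first.
  exact: evolution_increment.
by rewrite (@max_r _ _ (0 - 1)) ?mulr0 ?subr0//; lra.
Qed.

(** The quantity carried along is the L^1 distance to the explicit displacement: it is 0 on [Theta]
    and left-continuous in time, since [u] is left-continuous in L^1 and [limit_displacement] is
    Lipschitz. *)
Lemma evolution_displacement t : 0 <= t -> eqI (u t) (limit_displacement t).
Proof.
move=> t0.
have [[[ubv _ _] _ _] [[uleft _ _] [eps [Th [u_ [e_ [p_ [z_ [[eps0 epsl _ T0 Tneg] [reg ucv _ _]]]]]]]]]] :=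
  evol.
have ui s : 0 <= s -> L1I (u s) by move=> /ubv[].
have li := @limit_displacement_L1I R.
have L1dist f g h : L1I f -> L1I g -> L1I h ->
    \int[leb]_(y in I_) `|f y - h y| <=
    \int[leb]_(y in I_) `|f y - g y| + \int[leb]_(y in I_) `|g y - h y|.
  move=> fi gi hi; rewrite -RintegralD//; last 2 first.
    exact/intg_norm/intgB.
    exact/intg_norm/intgB.
  apply: (@ae_le_Rintegral _ _ _ leb) => //.
  - exact/intg_norm/intgB.
  - by apply: intgD => //; exact/intg_norm/intgB.
  - by apply: aeW => y _; have := ler_normD (f y - g y) (g y - h y); rewrite addrA subrK.
have int0 : \int[leb]_(y in I_) `|u t y - limit_displacement t y| = 0.
  apply: (left_dense_ext (G := fun=> 0)
    (F := fun s => \int[leb]_(y in I_) `|u s y - limit_displacement s y|) T0 Tneg t0).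
  - move=> s Ts s0.
    (* On [Theta], [u s] and the explicit displacement are L^1 limits of one and the same
       sequence. *)
    have c1 := (ucv s Ts).1.
    have c2 := displacement_limit hg cF F11 Flt1 hz0odd hz0cont hz0lim hz0bnd eps0 epsl reg s0.
    have uki k : L1I (u_ k s) by have [] := regularized_L1I reg k s0.
    have c3 : \int[leb]_(y in I_) `|u_ k s y - u s y| +
       \int[leb]_(y in I_) `|u_ k s y - limit_displacement s y| @[k --> \oo] --> (0 : R).
      by rewrite -[X in _ --> X](addr0 0); exact: cvgD.
    apply/eqP; rewrite eq_le Rintegral_ge0// andbT.
    rewrite -[leRHS](cvg_lim _ c3)//; apply: limr_ge; first by apply/cvg_ex; exists 0.
    apply: nearW => k.
    apply: (le_trans (L1dist _ _ _ (ui s s0) (uki k) (li s))).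
    rewrite lerD2r le_eqVlt; apply/orP; left; apply/eqP.
    by apply: eq_Rintegral => y _; rewrite distrC.
  - move: t0; rewrite le_eqVlt => /predU1P[<- d d0|t0 d d0].
      exists 1 => // s s0 /andP[_ s1]; have -> : s = 0 by lra.
      by rewrite subrr normr0.
    have d2 : 0 < d / 2 by lra.
    have [c c0 hc] := at_left_dist (uleft t t0).1 d2.
    pose r := Num.min c (d / 8).
    have r0 : 0 < r by rewrite lt_min c0; lra.
    have rc : r <= c by rewrite ge_min lexx.
    have rd : r <= d / 8 by rewrite ge_min lexx orbT.
    clearbody r; exists r => // s s0 /andP[s1]; rewrite le_eqVlt => /predU1P[->|s2].
      by rewrite subrr normr0.
    have ust : \int[leb]_(y in I_) `|u s y - u t y| < d / 2.
      have := hc s; rewrite subr0 ger0_norm; last exact: Rintegral_ge0.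
      by apply; rewrite s2 andbT; lra.
    have lst : \int[leb]_(y in I_) `|limit_displacement s y - limit_displacement t y| <= 3 * r.
      rewrite -(@Rint_I_cst R (3 * r)); apply: (@ae_le_Rintegral _ _ _ leb) => //.
      - by apply/intg_norm/intgB => //; exact: li.
      - exact: L1I_cst.
      - apply: aeW => y Iy; apply: (le_trans (limit_displacement_lip s t Iy)).
        by rewrite ler0_norm ?ler_pM2l//; lra.
    have usi := ui s s0; have uti := ui t (ltW t0).
    have sym (f g : R -> R) : \int[leb]_(y in I_) `|f y - g y| = \int[leb]_(y in I_) `|g y - f y|.
      by apply: eq_Rintegral => y _; rewrite distrC.
    have h1 := L1dist _ _ _ usi uti (li s).
    have h2 := L1dist _ _ _ uti (li t) (li s).
    have h3 := L1dist _ _ _ uti usi (li t).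
    have h4 := L1dist _ _ _ usi (li s) (li t).
    rewrite (sym (u t) (u s)) in h3; rewrite (sym (limit_displacement t) (limit_displacement s)) in h2.
    by rewrite ltr_norml; lra.
  - by exists 0 => // s _; rewrite subrr normr0 mul0r.
have di : L1I (fun y => u t y - limit_displacement t y).
  by apply: intgB => //; [exact: (ui t t0)|exact: (li t)].
have := @Rintegral_norm_eq0 _ _ _ leb _ measurable_I_ _ di int0.
by apply: filterS => y h Iy; apply/eqP; rewrite -subr_eq0 h.
Qed.

Lemma evolution_stress t : 0 <= t -> eqI (e t) (fun=> Num.min t 1).
Proof.
move=> t0.
have [[_ [e2 _ _] _] [[_ eleft _] [eps [Th [u_ [e_ [p_ [z_ [[eps0 epsl _ T0 Tneg] [reg _ ecv _]]]]]]]]]] :=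
  evol.
apply: L2_eq_cst; first exact: e2.
move=> g g2.
apply: (left_dense_ext (G := fun s => Num.min s 1 * \int[leb]_(y in I_) g y)
  (F := fun s => innerI (e s) g) T0 Tneg t0).
- move=> s Ts s0.
  have c1 := ecv s Ts g g2.
  have c2 := stress_limit hg cF F11 Flt1 hz0odd hz0cont hz0lim hz0bnd eps0 epsl reg g2 s0.
  exact: cvg_unique c1 c2.
- move: t0; rewrite le_eqVlt => /predU1P[<- d d0|t0 d d0].
    exists 1 => // s s0 /andP[_ s1]; have -> : s = 0 by lra.
    by rewrite subrr normr0.
  have [c c0 hc] := at_left_dist (eleft t t0 g g2) d0.
  exists c => // s s0 /andP[s1]; rewrite le_eqVlt => /predU1P[->|s2].
    by rewrite subrr normr0.
  by apply: hc; rewrite s1.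
- exists `|\int[leb]_(y in I_) g y| => // s s0.
  by rewrite -mulrBl normrM mulrC ler_wpM2l// min_shift_lip.
Qed.

Lemma stress_mean t (c : R) : 0 <= t -> innerI (e t) (fun=> c) = Num.min t 1 * c.
Proof.
move=> t0; have [[_ [e2 _ _] _] _] := evol.
have ei := L2I_L1I (e2 t t0).
transitivity (\int[leb]_(y in I_) (Num.min t 1 * c)); last exact: Rint_I_cst.
apply: (@ae_eq_Rintegral _ _ _ leb) => //.
- have -> : (EFin \o (fun y => e t y * c)) = (EFin \o (fun y => c * e t y)).
    by apply/funext => y /=; rewrite mulrC.
  exact: intgZ.
- exact: L1I_cst.
- by apply: filterS (evolution_stress t0) => y h Iy; rewrite h.
Qed.

Lemma stress_energy t : 0 <= t -> innerI (e t) (e t) = Num.min t 1 ^+ 2.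
Proof.
move=> t0; have [[_ [e2 _ _] _] _] := evol; have [me ei2] := e2 t t0.
transitivity (\int[leb]_(y in I_) (Num.min t 1 ^+ 2)); last exact: Rint_I_cst.
apply: (@ae_eq_Rintegral _ _ _ leb) => //.
- exact: L1I_cst.
- by apply: filterS (evolution_stress t0) => y h Iy; rewrite h// expr2.
Qed.

(** Both branches see the recession function [- |th|] with half of the mass each; together they
    release [(t - 1)^+]. *)
Lemma evolution_potential t : 0 <= t ->
  mu 1%N (fun=> t) (fun x => Vbrace V (x.1.2 ord0 1) x.2) =
  \int[leb]_(y in I_) V (z0 y) - Num.max (t - 1) 0.
Proof.
move=> t0; have F1E x : 1 <= x -> force V x = 1 by move/F1.
rewrite evolution_young//; last exact: Chom_Vbrace hV1 hg hVeven F1E _ _.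
rewrite /young_limit/=; congr (_ + _).
  by apply: eq_Rintegral => y _; rewrite /Vbrace ltr01 mxE/= mul1r divr1.
rewrite /Vbrace ltxx !(VinftyE hV1 hg hVeven F1E) !mxE/= normrN normr1.
by move: (Num.max _ _) => m; lra.
Qed.

End ApproximableEvolution.

Theorem theorem8p4 (R : realType) (V : R -> R) (M : R)
    (hM : 0 <= M)
    (hV1 : forall x, derivable V x 1)
    (hV2 : forall x, derivable (derive1 V) x 1)
    (hV2c : continuous (derive1 (derive1 V)))
    (hV2b : forall x, - M <= derive1 (derive1 V) x <= 0)
    (hVeven : forall x, V x = V (- x))
    (hVlin : forall x, derive1 V x = -1 <-> 1 <= x)
    (z0 : R -> R)
    (hz0odd : forall y, Ibar y -> z0 (- y) = - z0 y)
    (hz0cont : {within (`[- (2^-1), 0[ `|` `]0, 2^-1] : set R), continuous z0})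
    (hz0lim : z0 y @[y --> 0^'+] --> (1 : R))
    (hz0bnd : forall y, 0 < y <= 2^-1 -> 0 <= z0 y < 1)
    (u e : R -> R -> R) (mu : @Yfamily R) :
  let w := fun t y : R => t * y in
  let pR := fun t : R => cscale (Num.max (t - 1) 0) (dirac_charge 0) in
  approximable_evolution V w (fun=> 0) (fun=> 0) (fun=> 0) z0 u e mu ->
  (forall t, 0 <= t ->
    [/\ {ae leb, forall y, I_ y ->
          [/\ t <= 1 -> u t y = t * y,
              1 < t -> 0 < y -> u t y = y + (t - 1) / 2 &
              1 < t -> y < 0 -> u t y = y - (t - 1) / 2]},
        eqI (e t) (fun=> Num.min t 1) &
        forall f, Chom f ->
          mu 1%N (fun=> t) f =
            2^-1 * delta (pair_charges (fun=> pR t)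
                            (fun=> cadd (L1_charge z0) (pR t))) f +
            2^-1 * delta (pair_charges (fun=> pR t)
                            (fun=> cadd (L1_charge z0) (copp (pR t)))) f]) /\
  (forall T, 0 < T ->
    dissipation mu 0 T = (2 * Num.max (T - 1) 0)%:E /\
    ((2^-1 * innerI (e T) (e T))%:E + dissipation mu 0 T +
      (mu 1%N (fun=> T) (fun x => Vbrace V (x.1.2 ord0 1) x.2))%:E =
     (\int[leb]_(y in I_) V (z0 y) +
      \int[leb]_(t in `[0, T])
        innerI (e t) (derive1 (fun y => derive1 (fun s => w s y) t)))%:E)%E).
Proof.
move=> w pR evol.
have hg : driving (force V) M.
  split => [x y|x|x y|x].
  - exact: force_lip.
  - exact: forceN.
  - exact: force_homo.
  - apply/andP; split; [exact: (@force_geN1 _ V M)|exact: (@force_le1 _ V M)].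
have cF : continuous (force V) by exact: continuous_force.
have F1 x : force V x = 1 <-> 1 <= x by exact: force1.
have Flt1 x : x < 1 -> force V x < 1 by move=> x1; exact: (@force_lt1 _ V M).
have z0i : L1I z0 by exact: datum_L1I.
split.
- move=> t t0; split.
  + have hu := evolution_displacement hg cF F1 Flt1 hz0odd hz0cont hz0lim hz0bnd evol t0.
    apply: filterS2 hu (leb_ae_neq 0) => y hu y0 Iy; rewrite hu// /limit_displacement.
    split.
    * move=> t1; rewrite min_l// max_r ?subr_le0//; case: ifP => _; lra.
    * move=> t1 y_gt0; rewrite y_gt0 min_r ?(ltW t1)// max_l; lra.
    * move=> t1 y_lt0; rewrite ltNge (ltW y_lt0)/= min_r ?(ltW t1)//; lra.
  + exact: (evolution_stress hg cF F1 Flt1 hz0odd hz0cont hz0lim hz0bnd evol t0).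
  + move=> f hf.
    rewrite (evolution_young hg cF F1 Flt1 hz0odd hz0cont hz0lim hz0bnd evol hf t0).
    have m0 : 0 <= Num.max (t - 1) 0 by rewrite le_max lexx orbT.
    rewrite (@delta_split R f z0 _ 1 _ hf z0i m0); last first.
      by move=> A mA; rewrite mulr1.
    rewrite (@delta_split R f z0 _ (-1) _ hf z0i m0); last first.
      by move=> A mA; rewrite mulrN1 mulNr EFinN.
    rewrite /young_limit; move: (Num.max _ _) (Rintegral _ _ _) (f _) (f _) => *; lra.
- move=> T T0; have T0' := ltW T0.
  have hd := evolution_dissipation hg cF F1 Flt1 hz0odd hz0cont hz0lim hz0bnd evol T0.
  split => //; rewrite hd.
  rewrite (stress_energy hg cF F1 Flt1 hz0odd hz0cont hz0lim hz0bnd evol T0').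
  rewrite (evolution_potential hV1 hVeven hg cF F1 Flt1 hz0odd hz0cont hz0lim hz0bnd evol T0').
  (* The load has [D (dw/dt) = 1], so the power is [min t 1]. The balance closes because the
     dissipation [2 (T - 1)^+], less the potential released, leaves the [(T - 1)^+] supplied after
     time 1. *)
  rewrite [X in _ = (_ + X)%:E](_ : _ = Num.min T 1 ^+ 2 / 2 + Num.max (T - 1) 0).
    by rewrite -!EFinD; congr (_%:E); move: (Num.max _ _) (Num.min _ _) (Rintegral _ _ _) => *; lra.
  rewrite -Rintegral_min//; apply: eq_Rintegral => t; rewrite inE/= in_itv/= => /andP[t0 _].
  have -> : derive1 (fun y => derive1 (fun s => w s y) t) = (fun=> 1).
    apply/funext => x.
    have -> : (fun y => derive1 (fun s => w s y) t) = id.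
      apply/funext => y; rewrite derive1E /w.
      have h : is_derive t 1 (fun s : R => s * y) y.
        by apply: (is_derive_eq (is_deriveM (is_derive_id t 1) (is_derive_cst y t 1)));
          rewrite scaler0 add0r; exact: mulr1.
      by have [] := h.
    by rewrite derive1E; have [] := is_derive_id x (1 : R).
  by rewrite (stress_mean hg cF F1 Flt1 hz0odd hz0cont hz0lim hz0bnd evol)// mulr1.
Qed.
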